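(* Let $p \geqslant 3$ be a prime, let $k$ be a field of characteristic coprime with $p$, let $X$ be a non-trivial Severi--Brauer variety of dimension $p-1$ over $k$, and let $G$ be a finite subgroup of $\mathrm{Aut}(X)$. Then there exist a positive integer $n$ and a balanced semidirect product $\mathbb{Z}/n\mathbb{Z} \rtimes \mathbb{Z}/p\mathbb{Z}$ such that $G$ is isomorphic to a subgroup of $(\mathbb{Z}/n\mathbb{Z} \rtimes \mathbb{Z}/p\mathbb{Z}) \times \mathbb{Z}/p\mathbb{Z}$.
   Context: A Severi--Brauer variety of dimension $m$ over $k$ is an algebraic variety over $k$ that becomes isomorphic to $\mathbb{P}^{m}$ over the algebraic closure of $k$; it is non-trivial if it is not isomorphic to $\mathbb{P}^m_k$ over $k$. Severi--Brauer varieties of dimension $m$ over $k$ correspond one-to-one (up to isomorphism) to central simple $k$-algebras of degree $m+1$ (dimension $(m+1)^2$), with $X$ non-trivial if and only if the corresponding algebra $A$ is not isomorphic to a matrix algebra over $k$, and $\mathrm{Aut}(X) \cong \mathrm{Aut}(A) \cong A^*/k^*$. A semidirect product $\mathbb{Z}/n\mathbb{Z} \rtimes \mathbb{Z}/m\mathbb{Z}$ of two cyclic groups is called balanced if it has trivial center. ''Characteristic coprime with $p$'' means $\mathrm{char}\,k \neq p$ (characteristic $0$ is allowed). *)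

(* Defs.v *)
From HB Require Import structures.
From mathcomp Require Import all_boot all_order all_algebra all_fingroup.
From mathcomp Require Import all_solvable.
From mathcomp Require Import mpoly.

Set Implicit Arguments.
Unset Strict Implicit.
Unset Printing Implicit Defensive.

Import GRing.Theory.
Local Open Scope ring_scope.

(* Algebraic varieties are described in the classical (Weil-Serre) language:
   a variety over a field k is its set of points over an algebraic closure kbar
   together with a finite atlas of affine charts, whose images and transition
   maps are given by polynomials with coefficients in k.  All the notions below
   are relative to an embedding iota : F -> kbar: taking F = k gives the notion
   over k, and taking F = kbar and iota = idfun gives the notion over kbar.
   Base change from k to kbar therefore leaves the atlas untouched and merely
   enlarges the field in which the coefficients of polynomials may lie. *)

Definition is_algebraic_closure (k : fieldType) (kbar : closedFieldType)
    (iota : {rmorphism k -> kbar}) : Prop :=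
  forall x : kbar, algebraicOver iota x.

Record atlas (kbar : closedFieldType) := Atlas {
  pt : Type;
  chart_num : nat;
  chart_dim : 'I_chart_num -> nat;
  chart_dom : 'I_chart_num -> pt -> Prop;
  chart : forall i : 'I_chart_num, pt -> 'rV[kbar]_(chart_dim i)
}.

Section Varieties.

Variables (F : fieldType) (kbar : closedFieldType).
Variable (iota : {rmorphism F -> kbar}).

Definition ev n (q : {mpoly F[n]}) (x : 'rV[kbar]_n) : kbar :=
  (map_mpoly iota q).@[fun t => x 0 t].

Definition zariski_closed n (V : 'rV[kbar]_n -> Prop) : Prop :=
  forall y, (forall q : {mpoly F[n]}, (forall x, V x -> ev q x = 0) ->
                                      ev q y = 0) -> V y.

(* V is the zero set of polynomials over F, and the ideal of all polynomials
   over kbar vanishing on V is generated by polynomials over F.  The second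
   condition follows from the first when F is perfect; in general it says that
   the F-scheme Spec (F[x] / I_F(V)) is geometrically reduced. *)
Definition affine_algebraic_set n (V : 'rV[kbar]_n -> Prop) : Prop :=
  zariski_closed V /\
  (forall q : {mpoly kbar[n]},
     (forall x, V x -> q.@[fun t => x 0 t] = 0) ->
     exists s : seq ({mpoly kbar[n]} * {mpoly F[n]}),
       (forall u, u \in s -> forall x, V x -> ev u.2 x = 0) /\
       q = \sum_(u <- s) u.1 * map_mpoly iota u.2).

(* In the charts i and j, f is given near x by the rational functions a_t / h
   with coefficients in F: the conclusion holds on the F-open neighbourhood of x
   where h does not vanish. *)
Definition regular_at (X Y : atlas kbar) (f : pt X -> pt Y) i j (x : pt X) :
    Prop :=
  exists (a : 'I_(chart_dim (a:=Y) j) -> {mpoly F[chart_dim (a:=X) i]})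
         (h : {mpoly F[chart_dim i]}),
    ev h (chart i x) != 0 /\
    forall y, chart_dom i y -> ev h (chart i y) != 0 ->
      chart_dom j (f y) /\
      forall t, chart j (f y) 0 t = ev (a t) (chart i y) / ev h (chart i y).

Definition is_morphism (X Y : atlas kbar) (f : pt X -> pt Y) : Prop :=
  forall x, exists i j, chart_dom i x /\ regular_at f i j x.

Definition isomorphic (X Y : atlas kbar) : Prop :=
  exists (f : pt X -> pt Y) (g : pt Y -> pt X),
    [/\ is_morphism f, is_morphism g, cancel f g & cancel g f].

(* The fields say that the charts cover, are injective, have affine images,
   are glued along F-open subsets by F-regular maps, and that the diagonal is
   closed. *)
Record is_variety (X : atlas kbar) : Prop := IsVariety {
  variety_cover : forall x : pt X, exists i, chart_dom i x;
  variety_inj : forall i (x y : pt X),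
    chart_dom i x -> chart_dom i y -> chart i x = chart i y -> x = y;
  variety_affine : forall i,
    affine_algebraic_set
      (fun v => exists x : pt X, chart_dom i x /\ chart i x = v);
  variety_glue : forall i j (x : pt X),
    chart_dom i x -> chart_dom j x -> regular_at (@id (pt X)) i j x;
  variety_separated : forall i j (x y : pt X),
    chart_dom i x -> chart_dom j y ->
    (forall q : {mpoly F[chart_dim i + chart_dim j]},
       (forall z, chart_dom i z -> chart_dom j z ->
          ev q (row_mx (chart i z) (chart j z)) = 0) ->
       ev q (row_mx (chart i x) (chart j y)) = 0) ->
    x = y
}.

(* phi identifies the abstract group gT with a finite subgroup of the group of
   automorphisms of X over F; the inverse of phi g is the morphism phi g^-1. *)
Definition is_finite_aut_group (X : atlas kbar) (gT : finGroupType)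
    (phi : gT -> pt X -> pt X) : Prop :=
  [/\ forall g, is_morphism (phi g),
      forall x, phi 1%g x = x,
      forall g h x, phi (g * h)%g x = phi g (phi h x)
    & forall g h, phi g =1 phi h -> g = h].

End Varieties.

(* Points are lines in kbar^(m+1); the i-th chart divides the homogeneous
   coordinates by the i-th one and drops the resulting 1.  Nothing depends on
   the nonzero vector chosen by vpick. *)
Definition projective_space (kbar : closedFieldType) (m : nat) : atlas kbar :=
  @Atlas kbar {l : {vspace 'rV[kbar]_m.+1} | \dim l == 1%N} m.+1 (fun _ => m)
    (fun i l => vpick (val l) 0 i != 0)
    (fun i l => col' i ((vpick (val l) 0 i)^-1 *: vpick (val l))).

(* A separated k-scheme of finite type that becomes isomorphic to P^m over kbar
   is geometrically reduced and geometrically irreducible, so describing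
   varieties by their kbar-points excludes none of them, and irreducibility
   need not be required separately. *)
Definition severi_brauer (k : fieldType) (kbar : closedFieldType)
    (iota : {rmorphism k -> kbar}) (m : nat) (X : atlas kbar) : Prop :=
  is_variety iota X /\
  isomorphic (idfun : {rmorphism kbar -> kbar}) X (projective_space kbar m).

Definition nontrivial_severi_brauer (k : fieldType) (kbar : closedFieldType)
    (iota : {rmorphism k -> kbar}) (m : nat) (X : atlas kbar) : Prop :=
  severi_brauer iota m X /\ ~ isomorphic iota X (projective_space kbar m).

(* [Zp n] is cyclic of order n for every n > 0, including n = 1. *)
Definition balanced_sdprod (n m : nat) (hT : finGroupType) : Prop :=
  (exists N M : {group hT},
     [/\ N \isog Zp n, M \isog Zp m & (N ><| M = [set: hT])%g]) /\
  'Z([set: hT])%g = 1%g.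

(* Main.v *)
Require Import Defs.
From HB Require Import structures.
From mathcomp Require Import generic_quotient.
From mathcomp Require Import all_boot all_order all_algebra all_fingroup.
From mathcomp Require Import all_solvable.
From mathcomp Require Import separable mpoly zify ring.
From mathcomp Require classical_sets.
From Stdlib Require Import Classical IndefiniteDescription.

(** Write p = m + 1 and K for the closure of k.  Let zeta = (1, z_1, .., z_m) be the
    generic point of P^m, so that KK = K(z_1, .., z_m) is the function field of X over K,
    and let K0 in KK be the function field of X over k.  The global vector fields of P^m
    are induced by the homogeneous fields v zeta with v in M_p(K), and v is determined by
    the field together with its divergence, as p is invertible.  The v whose field preserves
    K0 and whose divergence lies in K0 form a k-subalgebra A of M_p(K) with
    A (x) K = M_p(K): expand the values of a vector field over a k-basis of K.

    If u rho_0, .., u rho_m are in A for a column u and the rows rho_j of an invertible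
    matrix, then the ratios (rho_j zeta) / (rho_0 zeta) lie in K0 and give an isomorphism
    from X to P^m over k.  As p is prime, the minimal rank of a nonzero element of A is 1
    or p, so A is a division algebra when X is non-trivial.  An automorphism of X over k
    acts on KK by z_j |-> (a zeta)_j / (a zeta)_0 for some a in A^*, unique up to k^*.

    An element of A outside k generates a separable extension of degree p, hence has p
    distinct eigenvalues, and two elements with a common eigenvector commute because their
    commutator is singular.  Let H be the subgroup of G where the reduced norm is a p-th
    power modulo k^{*p}.  It contains no element of order p, since such an element has
    norm c with X^p - c irreducible.  Normalizers of centralizers in H act freely on p
    eigenlines, so centralizers are self-normalizing and counting conjugates makes H
    abelian; the ratio of two eigenvalues then makes it cyclic.  A complement P of H has
    exponent p, C_P(H) is cyclic, and P / C_P(H) acts freely on the p eigenlines of H.  If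
    that action is trivial, the required multiplier of order p modulo |H| is found among
    the exponents u for which l and l^u are both eigenvalues of a generator of H. *)

(** The field k may be imperfect, so no Galois action on K is at hand to cut out A: finite k-free
    families and their independence over K0 replace descent. Vector fields by themselves carry only
    a Lie bracket, and closure of A under products has another source. Left multiplication by v
    respects every KK-linear relation between columns w zeta. When v w is expanded over a k-free
    family that starts with 1, each component respects the same relations, which forces it to be
    left multiplication by a constant matrix; for v in A only the component at 1 survives.

    On the group side, commuting in G differs from commuting of lifts by a p-th root of unity. That
    root is trivial as soon as one element has order prime to p, but not inside P. Oddness of p
    fixes the sign in det a = c when a^p = c. If H is trivial, nothing in G suggests n; the proof
    then takes n = 2^p - 1 with multiplier 2. *)

Set Implicit Arguments.
Unset Strict Implicit.
Unset Printing Implicit Defensive.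
Import GRing.Theory.

(** * Group theory *)

Section Groups.
Local Open Scope group_scope.
Variable gT : finGroupType.

(* The centralizers are self-normalizing and meet trivially, so two distinct conjugacy families
   of proper centralizers would cover too many elements. *)
Lemma abelian_of_centralizers (H : {group gT}) :
  (forall x y z, x \in H -> y \in H -> z \in H -> x != 1 -> commute x y -> commute x z -> commute y z) ->
  (forall x g, x \in H -> g \in H -> x != 1 -> commute x (x ^ g) -> commute x g) ->
  abelian H.
Proof.
move=> ct sn; apply: contraT => nab.
have memC x y : reflect [/\ y != 1, y \in H & commute x y] (y \in 'C_H[x]^#).
  rewrite in_setD1; apply: (iffP andP) => [[ny /subcent1P [Hy /commute_sym c]]|[ny Hy c]].
    by split=> //; exact: commute_sym.
  by split=> //; apply/subcent1P; split=> //.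
have TI x : x \in H -> x != 1 -> normedTI 'C_H[x]^# H 'C_H[x].
  move=> Hx nx; apply/normedTI_P; split.
  - by apply/set0Pn; exists x; apply/memC.
  - by rewrite normD1 subsetI subsetIl normG.
  move=> g Hg /pred0Pn [y /andP [/= /memC [ny Hy xy]]].
  move=> /imsetP [z /memC [nz Hz xz] yE].
  apply/subcent1P; split=> //.
  by apply: (ct z) => //; apply: (sn z) => //; rewrite -yE; exact: (ct x).
(* The conjugates of the nontrivial part of C = ['C_H[x]] are disjoint and C is its own normalizer,
   so they cover (|C| - 1)|H : C| = |H| - |H : C| elements, at least half of H. *)
have card x : x \in H -> x != 1 ->
    (#|class_support 'C_H[x]^# H| + #|H : 'C_H[x]|)%N = #|H| /\ (1 < #|H : 'C_H[x]|)%N /\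
    (1 < #|'C_H[x]|)%N.
  move=> Hx nx; split; first rewrite (card_support_normedTI (TI x Hx nx)).
    by rewrite -(Lagrange (subsetIl H 'C[x])) (cardsD1 1 'C_H[x]) group1 mulnDl mul1n addnC.
  split.
    rewrite indexg_gt1; apply: contra nab => sub; apply/centsP => y Hy z Hz.
    have [_ cy] := subcent1P _ _ _ (subsetP sub _ Hy).
    have [_ cz] := subcent1P _ _ _ (subsetP sub _ Hz).
    exact: (ct x).
  by rewrite cardG_gt1; apply/trivgPn; exists x => //; apply/subcent1P.
have half x : x \in H -> x != 1 -> (#|H| <= 2 * #|class_support 'C_H[x]^# H|)%N.
  move=> Hx nx; have [e [_ h2]] := card x Hx nx.
  have : (2 * #|H : 'C_H[x]| <= #|H|)%N.
    by rewrite -[leqRHS](Lagrange (subsetIl H 'C[x])) leq_mul2r h2 orbT.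
  by move: (#|H : _|) e; move: #|_| #|_| => a b c; lia.
have sub x : class_support 'C_H[x]^# H \subset H^#.
  apply/subsetP => y /imset2P [u g /memC [nu Hu _] Hg ->].
  by rewrite in_setD1 -(inj_eq (conjg_inj g^-1)) conjgK conj1g nu groupJ.
have cH : #|H| = #|H^#|.+1 by rewrite (cardsD1 1) group1.
have [x Hx nx] : exists2 x, x \in H & x != 1.
  by apply/trivgPn; apply: contra nab => /eqP ->; apply: abelian1.
set X := class_support 'C_H[x]^# H.
(* One family misses |H : C| - 1 > 0 nontrivial elements. The family of such an element is disjoint
   from the first, and two disjoint halves of H leave no room for 1. *)
have [y /setD1P [ny Hy] nXy] : exists2 y, y \in H^# & y \notin X.
  apply/subsetPn; apply: contraL (proj1 (proj2 (card x Hx nx))) => /subset_leq_card le.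
  have [e _] := card x Hx nx; rewrite -leqNgt; move: le e; rewrite -/X cH.
  by move: (#|H : _|); move: #|_| #|_| => a b c; lia.
set Y := class_support 'C_H[y]^# H.
have dis : [disjoint X & Y].
  apply/pred0P => z; apply/negP => /andP [/= /imset2P [u g /memC [nu Hu xu] Hg zE]].
  move=> /imset2P [v h /memC [nv Hv yv] Hh zE'].
  move/negP: nXy; apply; apply/imset2P.
  have vE : v = u ^ (g * h^-1) by rewrite conjgM -zE zE' conjgK.
  have uE : u = v ^ (h * g^-1) by rewrite conjgM -zE' zE conjgK.
  have gh : (h * g^-1) * (g * h^-1) = 1 by rewrite mulgA mulgKV mulgV.
  exists (y ^ (h * g^-1)) (g * h^-1); rewrite ?groupM ?groupV //; last first.
    by rewrite -conjgM gh conjg1.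
  apply/memC; split.
  - by rewrite -(inj_eq (conjg_inj (g * h^-1))) conj1g -conjgM gh conjg1.
  - by rewrite groupJ ?groupM ?groupV.
  apply: (ct u) => //; first by rewrite groupJ ?groupM ?groupV.
  by rewrite uE /commute -!conjMg yv.
have : (#|X| + #|Y| <= #|H^#|)%N.
  by rewrite -cardsUI (disjoint_setI0 dis) cards0 addn0 subset_leq_card // subUset !sub.
have := half x Hx nx; have := half y Hy ny; rewrite -/X -/Y cH.
by move: #|X| #|Y| #|_| => a b c; lia.
Qed.

(** The values of [f] separate the right cosets of C. It serves twice: with [f] the eigenline
    reached from a fixed one, and with [f] the commutation factor with a fixed element. *)
Lemma index_bound (T : eqType) (s : seq T) (f : gT -> T) (C P : {group gT}) :
  C \subset P -> (forall g, g \in P -> f g \in s) ->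
  (forall g h, g \in P -> h \in P -> f g = f h -> g * h^-1 \in C) -> (#|P| <= size s * #|C|)%N.
Proof.
move=> sCP fs fC; rewrite -(Lagrange sCP) mulnC leq_mul2r; apply/orP; right.
have u : uniq [seq f (repr K) | K <- enum (rcosets C P)].
  rewrite map_inj_in_uniq ?enum_uniq // => K L; rewrite !mem_enum.
  move=> /rcosetsP [g Pg ->] /rcosetsP [h Ph ->] e.
  have hr x : x \in P -> repr (C :* x) \in P.
    by move=> Px; case: repr_rcosetP => c Cc; rewrite groupM // (subsetP sCP).
  rewrite -(rcoset_repr C g) -(rcoset_repr C h); apply/rcoset_eqP.
  by rewrite mem_rcoset; apply: fC; rewrite ?hr.
have := uniq_leq_size u; rewrite size_map -cardE => /(_ s); apply => y /mapP [K].
rewrite mem_enum => /rcosetsP [g Pg ->] ->; apply: fs.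
by case: repr_rcosetP => c Cc; rewrite groupM // (subsetP sCP).
Qed.

Lemma cyclic_Zp n : cyclic (Zp n).
Proof. by rewrite /Zp; case: ifP => _; rewrite ?Zp_cycle ?cycle_cyclic ?cyclic1. Qed.

Lemma isog_prime_order (hT : finGroupType) (p : nat) (C : {group gT}) (M : {group hT}) :
  prime p -> #|C| %| p -> #|M| = p -> exists S : {group hT}, C \isog S.
Proof.
move=> pp Cp Mp; have [c1|cp] := orP (proj2 (primeP pp) _ Cp).
  by exists 1%G; apply: trivial_isog => //; apply/eqP; rewrite trivg_card1.
exists M; rewrite isog_cyclic_card; last by rewrite prime_cyclic // (eqP cp).
by rewrite (eqP cp) Mp eqxx andbT prime_cyclic // Mp.
Qed.

Lemma dprod_embedding (hT : finGroupType) (p : nat) (U C : {group gT}) (S1 : {group hT}) :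
  prime p -> U \x C = [set: gT] -> U \isog S1 -> #|C| %| p ->
  exists S : {group (hT * 'Z_p)%type}, [set: gT] \isog S.
Proof.
move=> pp UC US Cp; have [S2 CS] := isog_prime_order pp Cp (card_Zp (prime_gt0 pp)).
exists (setX_group S1 S2); apply: (isog_dprod UC (setX_dprod S1 S2)).
  exact: isog_trans US (isog_setX1 _ S1).
exact: isog_trans CS (isog_set1X _ S2).
Qed.

Lemma balanced_subg (n p : nat) (U H Q : {group gT}) : H ><| Q = U -> H \isog Zp n ->
  Q \isog Zp p -> 'Z(U) = 1 -> balanced_sdprod n p (subg_of U).
Proof.
move=> UE Hn Qp ZU; have inj := injm_subg U.
have [sH sQ] : H \subset U /\ Q \subset U.
  by have [/mulG_sub [? ?] _] := (sdprodW UE, 0%N).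
split; last by rewrite -[setT](im_subg U) -injm_center // ZU morphim1.
exists (subg U @* H)%G, (subg U @* Q)%G; split.
- by apply: isog_trans Hn; rewrite isog_sym sub_isog.
- by apply: isog_trans Qp; rewrite isog_sym sub_isog.
by rewrite /= (injm_sdprod (subxx _) inj UE) im_subg.
Qed.
End Groups.

(** * Affine groups over Z/n *)

Section Affine.
Variables (n p : nat) (a : 'Z_n).
Hypothesis n_gt1 : 1 < n.
Hypothesis p_prime : prime p.
Hypothesis ap : (a ^+ p = 1)%R.
Hypothesis a1 : ((a - 1)%R \is a GRing.unit).

Let tr (x : 'Z_n) : {perm 'Z_n} := perm (@GRing.addIr _ x).

Lemma mulIa : injective (fun y : 'Z_n => y * a)%R.
Proof.
apply: (can_inj (g := fun y => y * a ^+ p.-1)%R) => y.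
by rewrite /= -mulrA -exprS (prednK (prime_gt0 p_prime)) ap mulr1.
Qed.
Let ml : {perm 'Z_n} := perm mulIa.

Lemma trX k y : ((tr 1%R ^+ k)%g y = y + k%:R)%R.
Proof.
elim: k => [|k IH]; first by rewrite expg0 perm1 addr0.
by rewrite expgSr permM IH permE -addrA natr1.
Qed.

Lemma mlX k y : ((ml ^+ k)%g y = y * a ^+ k)%R.
Proof.
elim: k => [|k IH]; first by rewrite expg0 perm1 mulr1.
by rewrite expgSr permM IH permE exprSr mulrA.
Qed.

(** Translations and multiplication by [a] act on Z/n. A central z is a translation because it
    commutes with translation by 1, and commuting with multiplication by [a] gives z(0)(a - 1) = 0;
    this is why a - 1 has to be a unit, not merely nonzero. *)
Lemma balanced_affine : exists hT : finGroupType, balanced_sdprod n p hT.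
Proof.
Local Open Scope group_scope.
pose N : {group {perm 'Z_n}} := <[tr 1%R]>%G; pose M : {group {perm 'Z_n}} := <[ml]>%G.
have a_neq1 : a != 1%R by apply: contraL a1 => /eqP ->; rewrite subrr unitr0.
have oN : #|N| = n.
  apply/eqP; rewrite eqn_dvd; apply/andP; split.
    by rewrite order_dvdn; apply/eqP/permP => y; rewrite trX perm1 char_Zp // addr0.
  have := expg_order (tr 1%R) => /permP /(_ 0%R); rewrite trX perm1 add0r => e.
  have /eqP := congr1 val e; rewrite /= val_Zp_nat //.
have oM : #|M| = p.
  apply: nt_prime_order => //; first by apply/permP => y; rewrite mlX perm1 ap mulr1.
  apply/eqP => /permP /(_ 1%R) /eqP; rewrite permE perm1 mul1r; exact/negP.
have trE (x : 'Z_n) : tr x = tr 1%R ^+ x.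
  by apply/permP => y; rewrite trX permE natr_Zp.
have nMN : M \subset 'N(N).
  rewrite cycle_subG; apply/normP; apply/eqP; rewrite eqEcard cardJg leqnn andbT.
  rewrite -cycleJ cycle_subG.
  suff -> : tr 1%R ^ ml = tr a by rewrite trE mem_cycle.
  apply/permP => y; have [z ->] : exists z, y = ml z by exists (ml^-1 y); rewrite permKV.
  by rewrite permJ !permE mulrDl mul1r.
have tiNM : N :&: M = 1.
  apply/trivgP/subsetP => g /setIP [/cycleP [i ->] /cycleP [j e]].
  have := congr1 (fun s : {perm 'Z_n} => s 0%R) e; rewrite trX mlX add0r mul0r => i0.
  by rewrite inE; apply/eqP/permP => y; rewrite trX i0 addr0 perm1.
have UE : N ><| M = (N <*> M)%G by rewrite /= norm_joinEr // sdprodE.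
exists (subg_of (N <*> M)%G); apply: (balanced_subg UE).
- by rewrite isog_cyclic_card ?cycle_cyclic // cyclic_Zp oN card_Zp ?eqxx // ltnW.
- by rewrite isog_cyclic_card ?cycle_cyclic // cyclic_Zp oM card_Zp ?eqxx // prime_gt0.
apply/trivgP/subsetP => z /setIP [_ /centP cz].
have cN : commute z (tr 1%R) by apply: cz; rewrite mem_gen // inE cycle_id.
have cM : commute z ml by apply: cz; rewrite mem_gen // inE cycle_id orbT.
have zE k : (z k%:R = z 0 + k%:R)%R.
  elim: k => [|k IH]; first by rewrite addr0.
  have := congr1 (fun s : {perm 'Z_n} => s k%:R%R) cN; rewrite !permM !permE IH => h.
  by rewrite -natr1 -h -addrA.
have z0 : (z 0 = 0)%R.
  have := congr1 (fun s : {perm 'Z_n} => s 0%R) cM; rewrite !permM !permE mul0r => h.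
  apply: (mulIr a1); by rewrite mulrBr h mulr1 subrr mul0r.
by rewrite inE; apply/eqP/permP => y; rewrite perm1 -[y]natr_Zp zE z0 add0r.
Qed.
End Affine.

Local Open Scope ring_scope.

(** * Hilbert's Nullstellensatz over algebraically closed fields *)

Definition is_ideal (B : comNzRingType) (J : B -> Prop) :=
  [/\ J 0, forall x y, J x -> J y -> J (x + y) & forall a x, J x -> J (a * x)].

Definition is_prime (B : comNzRingType) (M : B -> Prop) :=
  [/\ is_ideal M, ~ M 1 & forall x y, M (x * y) -> M x \/ M y].

Lemma prime_above (B : comNzRingType) (J : B -> Prop) :
  is_ideal J -> ~ J 1 -> exists M, is_prime M /\ forall x, J x -> M x.
Proof.
move=> [J0 JD JM] J1.
pose P (I : B -> Prop) := (forall x, J x -> I x) -> is_ideal I /\ ~ I 1.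
have [|A [PA maxA]] := @classical_sets.Zorn_bigcup B
  (fun I => (forall x, I x -> False) \/ [/\ is_ideal I, ~ I 1 & forall x, J x -> I x]).
  move=> F FP Ftot.
  case: (classic (exists2 X, F X & exists x, X x)) => [[X0 FX0 [x0 X0x0]]|noX]; last first.
    by left => x [X FX Xx]; apply: noX; exists X => //; exists x.
  right.
  have good X : F X -> (exists x, X x) ->
      [/\ is_ideal X, ~ X 1 & forall x, J x -> X x].
    by move=> FX [x Xx]; case: (FP _ FX) => // /(_ _ Xx).
  have ne : exists x, X0 x by exists x0.
  have [[X00 _ _] _ JX0] := good _ FX0 ne.
  split; last 2 first.
  - by move=> [X FX X1]; have [|_ + _] := good X FX; first by exists 1.
  - by move=> x Jx; exists X0 => //; apply: JX0.
  split; first by exists X0.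
  - move=> x y [X FX Xx] [Y FY Yy].
    have [//|XY|YX] := Ftot X Y FX.
    + have [|[_ YD _] _ _] := good Y FY; first by exists y.
      by exists Y => //; apply: YD => //; apply: XY.
    + have [|[_ XD _] _ _] := good X FX; first by exists x.
      by exists X => //; apply: XD => //; apply: YX.
  - move=> a x [X FX Xx]; have [|[_ _ XM] _ _] := good X FX; first by exists x.
    by exists X => //; apply: XM.
have maxA' I : is_ideal I -> ~ I 1 -> (forall x, J x -> I x) ->
   (forall x, A x -> I x) -> forall x, I x -> A x.
  move=> Iid I1 JI AI x Ix; apply: NNPP => nAx; apply: (maxA I); last by right; split.
  by split => // IA; apply: nAx; apply: IA.
have [Aid A1 JA] : [/\ is_ideal A, ~ A 1 & forall x, J x -> A x].
  case: PA => // A0; case: (A0 0); apply: (maxA' J) => // x Ax; case: (A0 _ Ax).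
exists A; split => //; split => // x y Axy; apply: NNPP => /not_or_and [nAx nAy].
case: (Aid) => A0 AD AM.
have key z : ~ A z -> exists a b, A b /\ 1 = a * z + b.
  move=> nAz; apply: NNPP => no; apply: nAz.
  apply: (maxA' (fun t => exists a b, A b /\ t = a * z + b)).
  - split; first by exists 0, 0; rewrite mul0r addr0.
    + move=> _ _ [a [b [Ab ->]]] [a' [b' [Ab' ->]]]; exists (a + a'), (b + b').
      by split; [apply: AD | rewrite mulrDl addrACA].
    + move=> c _ [a [b [Ab ->]]]; exists (c * a), (c * b).
      by split; [apply: AM | rewrite mulrDr mulrA].
  - by move=> ?; apply: no.
  - by move=> t Jt; exists 0, t; rewrite mul0r add0r; split => //; apply: JA.
  - by move=> t At; exists 0, t; rewrite mul0r add0r.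
  - by exists 1, 0; rewrite mul1r addr0.
have [a [b [Ab e1]]] := key _ nAx; have [a' [b' [Ab' e2]]] := key _ nAy.
apply: A1; rewrite -[1]mulr1 {1}e1 e2.
rewrite mulrDr; apply: (AD); last by apply: (AM).
rewrite mulrDl; apply: (AD); last by rewrite mulrC; apply: (AM).
by rewrite mulrACA; apply: AM.
Qed.

Lemma size_pseudo_step (R : comNzRingType) (P f : {poly R}) :
  f != 0 -> (size f <= size P)%N ->
  (size (lead_coef f *: P - (lead_coef P *: 'X^(size P - size f)) * f)%R
     < size P)%N.
Proof.
move=> nf le.
have sf0 : (0 < size f)%N by rewrite size_poly_gt0.
have sP0 : (0 < size P)%N by apply: leq_trans le.
rewrite -[X in (_ < X)%N](prednK sP0) ltnS; apply/leq_sizeP => i hi.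
rewrite coefB coefZ -scalerAl coefZ coefXnM.
have lt : (i < size P - size f)%N = false.
  by apply/negbTE; rewrite -leqNgt (leq_trans _ hi) // -subn1 leq_sub2l.
rewrite lt; move: hi; rewrite leq_eqVlt => /orP [/eqP <-|hi].
  have -> : ((size P).-1 - (size P - size f) = (size f).-1)%N.
    by move: (size P) (size f) sf0 sP0 le => a b; clear; lia.
  by rewrite -/(lead_coef P) -/(lead_coef f) mulrC subrr.
by rewrite !nth_default ?mulr0 ?subr0 //;
  move: (size P) (size f) sf0 sP0 le hi => a b; clear; lia.
Qed.

Section Nullstellensatz.
Variables (K : closedFieldType) (n : nat).
Local Notation B := {mpoly K[n]}.
Variable M : B -> Prop.
Hypothesis Mprime : is_prime M.

Let M0 : M 0. Proof. by case: Mprime => [[]]. Qed.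
Let MD x y : M x -> M y -> M (x + y). Proof. by case: Mprime => [[_ h _]] _ _; apply: h. Qed.
Let MM a x : M x -> M (a * x). Proof. by case: Mprime => [[_ _ h]] _ _; apply: h. Qed.
Let MMr a x : M x -> M (x * a). Proof. by rewrite mulrC; apply: MM. Qed.
Let MN x : M x -> M (- x). Proof. by rewrite -mulN1r; apply: MM. Qed.
Let M1 : ~ M 1. Proof. by case: Mprime. Qed.
Let Mpr x y : M (x * y) -> M x \/ M y. Proof. by case: Mprime => _ _; apply. Qed.
Let MX x k : ~ M x -> ~ M (x ^+ k).
Proof. by move=> nx; elim: k => [|k IH]; rewrite ?expr0 // exprS => /Mpr []. Qed.
Let Msum (I : Type) (r : seq I) (P : pred I) F : (forall i, P i -> M (F i)) -> M (\sum_(i <- r | P i) F i).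
Proof. by move=> h; elim/big_ind: _. Qed.

Let x (j : nat) : B := if insub j is Some i then 'X_i else 0.
Local Notation ev y := (meval (fun i : 'I_n => y (val i))).

(** This is the subring K[x_0, .., x_(j-1)], obtained by iterated evaluation inside the fixed ring
    [B], so that the ideal [M] and the evaluation maps keep their types during the induction on
    j. *)
Fixpoint tower (j : nat) (q : B) : Prop :=
  if j is j'.+1 then exists P : {poly B}, (forall i, tower j' P`_i) /\ q = P.[x j']
  else exists c, q = c%:MP.

Let good j (P : {poly B}) := forall i, tower j P`_i.

Lemma tower_ring j : [/\ forall c, tower j c%:MP,
  forall p q, tower j p -> tower j q -> tower j (p + q) &
  forall p q, tower j p -> tower j q -> tower j (p * q)].
Proof.
elim: j => [|j [IC ID IM]].
  split; first by move=> c; exists c.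
  - by move=> _ _ [a ->] [b ->]; exists (a + b); rewrite mpolyCD.
  - by move=> _ _ [a ->] [b ->]; exists (a * b); rewrite mpolyCM.
have I0 : tower j 0 by rewrite -(mpolyC0 n K).
split.
- move=> c; exists (c%:MP%:P); split; last by rewrite hornerC.
  by move=> [|i]; rewrite coefC //=.
- move=> _ _ [P [gP ->]] [Q [gQ ->]]; exists (P + Q); rewrite hornerD; split=> // i.
  by rewrite coefD; apply: (ID); [apply: gP | apply: gQ].
- move=> _ _ [P [gP ->]] [Q [gQ ->]]; exists (P * Q); rewrite hornerM; split=> // i.
  by rewrite coefM; elim/big_ind: _ => // t _; apply: (IM); [apply: gP | apply: gQ].
Qed.
Let tC j c : tower j c%:MP. Proof. by case: (tower_ring j). Qed.
Let tD j p q : tower j p -> tower j q -> tower j (p + q).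
Proof. by case: (tower_ring j) => _ h _; apply: h. Qed.
Let tM j p q : tower j p -> tower j q -> tower j (p * q).
Proof. by case: (tower_ring j) => _ _; apply. Qed.
Let t0 j : tower j 0. Proof. by rewrite -(mpolyC0 n K); apply: tC. Qed.
Let t1 j : tower j 1. Proof. by rewrite -(mpolyC1 n K); apply: tC. Qed.
Let tN j p : tower j p -> tower j (- p).
Proof. by move=> h; rewrite -mulN1r -(mpolyC1 n K) -mpolyCN; apply: tM. Qed.
Let tX j p k : tower j p -> tower j (p ^+ k).
Proof. by move=> h; elim: k => [|k IH]; rewrite ?expr0 // exprS; apply: tM. Qed.
Let tS j p : tower j p -> tower j.+1 p.
Proof.
move=> h; exists p%:P; rewrite hornerC; split => // -[|i]; by rewrite coefC.
Qed.
Let tx j : tower j.+1 (x j).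
Proof. by exists 'X; rewrite hornerX; split => // i; rewrite coefX; case: eqP. Qed.
Let tle j j' p : (j <= j')%N -> tower j p -> tower j' p.
Proof.
move=> /subnK <- h; elim: (j' - j)%N => // d IH; rewrite addSn; exact: tS.
Qed.
Let tsum j (I : Type) (r : seq I) (P : pred I) F :
  (forall i, P i -> tower j (F i)) -> tower j (\sum_(i <- r | P i) F i).
Proof. by move=> h; elim/big_ind: _ => //; apply: tD. Qed.

Lemma tower_full q : tower n q.
Proof.
rewrite (mpolyE q); apply: tsum => m _; rewrite -mul_mpolyC; apply: tM => //.
rewrite mpolyXE_id; elim/big_ind: _ => //; first by move=> ? ? ? ?; apply: tM.
move=> i _; apply: tX; have -> : 'X_i = x i by rewrite /x valK.
by apply: (tle (ltn_ord i)).
Qed.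

Let gC j c : tower j c -> good j c%:P. Proof. by move=> h [|i]; rewrite coefC. Qed.
Let gD j p q : good j p -> good j q -> good j (p + q).
Proof. by move=> hp hq i; rewrite coefD; apply: tD; [apply: hp | apply: hq]. Qed.
Let gM j p q : good j p -> good j q -> good j (p * q).
Proof. by move=> hp hq i; rewrite coefM; apply: tsum => t _; apply: tM; [apply: hp | apply: hq]. Qed.
Let gN j p : good j p -> good j (- p).
Proof. by move=> hp i; rewrite coefN; apply: tN; apply: hp. Qed.
Let gX j k : good j 'X^k.
Proof. by move=> i; rewrite coefXn; case: eqP. Qed.

Lemma pseudo_div j (f : {poly B}) : good j f -> f != 0 -> forall P : {poly B}, good j P ->
  exists N q r, [/\ good j q, good j r, (size r < size f)%N &
    (lead_coef f ^+ N) *: P = q * f + r].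
Proof.
move=> gf nf P; move: {2}(size P) (leqnn (size P)) => s.
have g0 : good j 0 by move=> i; rewrite coef0.
elim: s P => [|s IH] P sP gP.
  exists 0%N, 0, 0; split => //; first by rewrite size_poly0 size_poly_gt0.
  by move: sP; rewrite leqn0 size_poly_eq0 => /eqP ->; rewrite scaler0 mul0r addr0.
have [lt|le] := ltnP (size P) (size f).
  by exists 0%N, 0, P; split => //; rewrite expr0 scale1r mul0r add0r.
have lt := size_pseudo_step nf le.
set b := lead_coef P *: _ in lt; set P' := _ - _ in lt.
have gb : good j b by rewrite /b -mul_polyC; exact: (gM (gC (gP _)) (gX _ _)).
have gP' : good j P'.
  apply: gD; last exact: (gN (gM gb gf)).
  by rewrite -mul_polyC; exact: (gM (gC (gf _)) gP).
have [||N [q [r [gq gr sr e]]]] := IH P'; [by rewrite -ltnS (leq_trans lt) | by []|].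
exists N.+1, (q + lead_coef f ^+ N *: b), r; split => //.
  by apply: (gD gq); rewrite -mul_polyC; exact: (gM (gC (tX _ (gf _))) gb).
rewrite mulrDl -addrA [_ * f + r]addrC addrA -e /P' scalerBr -/b scalerAl.
by rewrite subrK scalerA exprSr.
Qed.

(** Polynomials that vanish modulo [M]; the quotient ring itself is never formed. *)
Let triv (P : {poly B}) := forall i, M P`_i.

Let triv_horner P t : triv P -> M P.[t].
Proof. by move=> h; rewrite horner_coef; apply: Msum => i _; apply: MMr. Qed.
Let trivD P Q : triv P -> triv Q -> triv (P + Q).
Proof. by move=> hP hQ i; rewrite coefD; apply: MD; [apply: hP | apply: hQ]. Qed.
Let trivM P Q : triv Q -> triv (P * Q).
Proof. by move=> hQ i; rewrite coefM; apply: Msum => t _; apply: MM; apply: hQ. Qed.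
Let trivN P : triv P -> triv (- P).
Proof. by move=> hP i; rewrite coefN; apply: MN; apply: hP. Qed.

(** At least size, a leading term with coefficient in [M] could be dropped, leaving a shorter
    polynomial that is still nontrivial; [Nt] keeps it in [N]. *)
Lemma min_nontrivial j (N : {poly B} -> Prop) :
  (forall P Q, good j P -> N P -> good j Q -> triv Q -> N (P + Q)) ->
  (exists P, [/\ good j P, N P & ~ triv P]) ->
  exists f, [/\ good j f, N f, ~ M (lead_coef f) & forall h, good j h -> N h ->
     (size h < size f)%N -> triv h].
Proof.
move=> Nt [P0]; move: {2}(size P0) (leqnn (size P0)) => s.
elim: s P0 => [|s IH] P0 sP [gP NP ntP].
  case: ntP; move: sP; rewrite leqn0 size_poly_eq0 => /eqP -> i.
  by rewrite coef0.
case: (classic (exists h, [/\ good j h, N h & ~ triv h] /\ (size h < size P0)%N)).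
  by move=> [h [H lt]]; apply: (IH h) => //; rewrite -ltnS (leq_trans lt).
move=> no; exists P0; split => //; last first.
  by move=> h gh Nh lt; apply: NNPP => nt; apply: no; exists h.
move=> Ml; apply: no; pose Q := - (lead_coef P0 *: 'X^((size P0).-1)).
have tQ : triv Q by move=> i; rewrite coefN coefZ; apply: MN; apply: MMr.
have gQ : good j Q.
  by apply: gN; rewrite -mul_polyC; exact: (gM (gC (gP _)) (gX _ _)).
have nP0 : (0 < size P0)%N.
  rewrite size_poly_gt0; apply/eqP => e; apply: ntP => i; by rewrite e coef0.
exists (P0 + Q); split.
  split; [exact: gD | exact: Nt |] => tPQ; apply: ntP => i.
  by rewrite -[P0](addrK Q); apply: trivD tPQ (trivN tQ) i.
rewrite -[in X in (_ < X)%N](prednK nP0) ltnS; apply/leq_sizeP => i.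
rewrite coefD coefN coefZ coefXn leq_eqVlt => /orP [/eqP <-|lt].
  by rewrite eqxx mulr1 subrr.
rewrite nth_default ?add0r; last by rewrite -(prednK nP0).
by rewrite gtn_eqF // mulr0 oppr0.
Qed.

Lemma good_ev j (P : {poly B}) y y' : good j P ->
  (forall q, tower j q -> ev y' q = ev y q) -> map_poly (ev y') P = map_poly (ev y) P.
Proof. by move=> gP h; apply/polyP => i; rewrite !coef_map /= h. Qed.

Lemma tower_ev j q y y' : (forall i, (i < j)%N -> y' i = y i) -> tower j q -> ev y' q = ev y q.
Proof.
elim: j q => [|j IH] q h; first by move=> [c ->]; rewrite !mevalC.
move=> [P [gP ->]]; rewrite -!horner_map /= (good_ev (y := y) gP); last first.
  by move=> p; apply: IH => i lt; apply: h; rewrite ltnS ltnW.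
congr (_.[_]); rewrite /x; case: insubP => [i _ e|_]; last by rewrite !meval0.
by rewrite !mevalXU e h.
Qed.

Lemma ev_x j y : (j < n)%N -> ev y (x j) = y j.
Proof. by move=> lt; rewrite /x insubT mevalXU. Qed.

Let upd (y : nat -> K) j t i := if i == j then t else y i.
Let updE y j t i : (i < j)%N -> upd y j t i = y i.
Proof. by move=> lt; rewrite /upd ltn_eqF. Qed.
Let upd_horner y j t (P : {poly B}) : (j < n)%N -> good j P ->
  ev (upd y j t) P.[x j] = (map_poly (ev y) P).[t].
Proof.
move=> lt gP; rewrite -horner_map /= ev_x // {2}/upd eqxx (good_ev (y := y) gP) //.
by move=> q; apply: tower_ev => i; apply: updE.
Qed.

(* Induction on the number of variables.  If the next variable satisfies no relation modulo
   [M], almost any value will do.  Otherwise let [f] be a relation of minimal degree: [s] is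
   prime to [f], so some combination [c] of both has degree 0, and where neither [c] nor the
   lead coefficient of [f] vanishes, any root of [f] extends the zero. *)
Lemma tower_zero j s : (j <= n)%N -> tower j s -> ~ M s ->
  exists y, ev y s != 0 /\ forall q, tower j q -> M q -> ev y q = 0.
Proof.
elim: j s => [|j IH] s.
  move=> _ [c ->] nM; exists (fun=> 0); rewrite mevalC; split.
    by apply/eqP => c0; apply: nM; rewrite c0 mpolyC0.
  move=> _ [d ->]; rewrite mevalC => Md; apply/eqP/negPn/negP => nd; apply: M1.
  have -> : 1 = d^-1%:MP * d%:MP :> B by rewrite -mpolyCM mulVf.
  exact: MM.
move=> ltj [Ps [gPs ->]] nMs; have lej := ltnW ltj.
pose N P := M P.[x j].
have Nt P Q : good j P -> N P -> good j Q -> triv Q -> N (P + Q).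
  by move=> _ NP _ tQ; rewrite /N hornerD; apply: MD => //; apply: triv_horner.
case: (classic (exists P, [/\ good j P, N P & ~ triv P])); last first.
  move=> no; have allt P : good j P -> N P -> triv P.
    by move=> gP NP; apply: NNPP => nt; apply: no; exists P.
  have [c nMc] : exists i, ~ M Ps`_i.
    apply: NNPP => no'; apply: nMs; apply: triv_horner => i; apply: NNPP => h.
    by apply: no'; exists i.
  have [y [yc y0]] := IH _ lej (gPs c) nMc.
  have nz : map_poly (ev y) Ps != 0.
    by apply/eqP => e; move: yc; rewrite -coef_map /= e coef0 eqxx.
  have [t /negP nrt] := closed_nonrootP _ nz.
  exists (upd y j t); rewrite upd_horner //; split; first by apply/negP.
  move=> _ [P [gP ->]] MP; rewrite upd_horner //.
  suff -> : map_poly (ev y) P = 0 by rewrite horner0.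
  by apply/polyP => i; rewrite coef_map coef0 /= (y0 _ (gP i) (allt _ gP MP i)).
move=> /(min_nontrivial Nt) [f [gf Nf Mlf minf]].
have nf : f != 0 by apply/eqP => e; apply: Mlf; rewrite e lead_coef0.
have good0 : good j 0 by move=> i; rewrite coef0.
have good1 : good j 1 by move=> i; rewrite coef1; case: eqP.
have sf : (1 < size f)%N.
  rewrite ltnNge; apply/negP => le; apply: Mlf; move: Nf; rewrite /N.
  by rewrite (size1_polyC le) hornerC lead_coefC.
(* Modulo [M], these are the combinations of s and f; a shortest nontrivial one will turn out to be
   constant. *)
pose N' h := exists u w, [/\ good j u, good j w & triv (h - (u * Ps + w * f))].
have N't P Q : good j P -> N' P -> good j Q -> triv Q -> N' (P + Q).
  move=> _ [u [w [gu gw tr]]] _ tQ; exists u, w; split => //.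
  by rewrite addrAC; apply: trivD.
have Mlc_triv (h : {poly B}) N1 : ~ M (lead_coef h) -> forall P, triv (lead_coef h ^+ N1 *: P) -> triv P.
  move=> nl P tP i; move: (tP i); rewrite coefZ => /Mpr [] // /MX; case; exact: nl.
have [h0 [gh0 N'h0 Mlh minh]] : exists h, [/\ good j h, N' h, ~ M (lead_coef h)
   & forall h', good j h' -> N' h' -> (size h' < size h)%N -> triv h'].
  by apply: (min_nontrivial N't); exists f; split => //;
    [exists 0, 1; split => // i; rewrite mul0r add0r mul1r subrr coef0
    | move=> tf; apply: Mlf; apply: tf].
have nh0 : h0 != 0 by apply/eqP => e; apply: Mlh; rewrite e lead_coef0.
(* Otherwise the remainder of s by f, a member of [N'] shorter than h0, would be trivial, and a
   power of the leading coefficient of f times s would lie in [M]. *)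
have lth : (size h0 < size f)%N.
  rewrite ltnNge; apply/negP => le.
  have [N1 [q [r [gq gr sr e]]]] := pseudo_div gf nf gPs.
  have tr : triv r.
    apply: minh => //; last by apply: leq_trans le.
    exists (lead_coef f ^+ N1)%:P, (- q); split; [|exact: (gN gq)|].
      by exact: (gC (tX _ (gf _))).
    by move=> i; rewrite mul_polyC e mulNr addrAC subrr add0r subrr coef0.
  have : M ((lead_coef f ^+ N1) *: Ps).[x j].
    by rewrite e hornerD hornerM; apply: MD; [apply: MM | apply: triv_horner].
  by rewrite hornerZ => /Mpr [] // /MX; apply.
(* If h0 had positive degree, dividing f by it would leave a trivial remainder. By primality the
   quotient or h0 would then be a relation shorter than f, hence trivial, and both cases contradict
   a leading coefficient outside [M]. *)
have sh : size h0 = 1%N.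
  apply/eqP; rewrite eqn_leq size_poly_gt0 nh0 andbT leqNgt; apply/negP => lt1.
  have [N1 [q [r [gq gr sr e]]]] := pseudo_div gh0 nh0 gf.
  have [u [w [gu gw tr0]]] := N'h0.
  have tr : triv r.
    apply: minh => //; exists (- q * u), ((lead_coef h0 ^+ N1)%:P - q * w).
    split; first exact: (gM (gN gq) gu).
      exact: (gD (gC (tX _ (gh0 _))) (gN (gM gq gw))).
    have -> : r - (- q * u * Ps + ((lead_coef h0 ^+ N1)%:P - q * w) * f)
       = - q * (h0 - (u * Ps + w * f)).
      by rewrite mulrBl mul_polyC e; ring.
    exact: trivM.
  have lqh : ~ triv (q * h0).
    move=> tq; apply: Mlf; apply: (Mlc_triv h0 N1 Mlh f) (size f).-1.
    by rewrite e; apply: trivD.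
  have : M (q * h0).[x j].
    have -> : q * h0 = lead_coef h0 ^+ N1 *: f - r by rewrite e addrK.
    rewrite hornerD hornerN hornerZ; apply: MD; first exact: MM.
    by apply: MN; apply: triv_horner.
  rewrite hornerM => /Mpr [] Mq.
    apply: lqh; rewrite mulrC; apply: trivM; apply: minf => //.
    have [->|nq] := eqVneq q 0; first by rewrite size_poly0 size_poly_gt0.
    have : (size (q * h0)%R <= size f)%N.
      have -> : q * h0 = lead_coef h0 ^+ N1 *: f - r by rewrite e addrK.
      rewrite (leq_trans (size_polyD _ _)) // geq_max size_polyN size_scale_leq /=.
      exact: (ltnW (ltn_trans sr lth)).
    rewrite size_mul //; move: (size q) (size h0) (size f) lt1 nq => a b d; lia.
  apply: Mlh; exact: (minf h0).
pose c := h0`_0; have h0E : h0 = c%:P by apply: size1_polyC; rewrite sh.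
have tc : tower j c by apply: gh0.
have Mc : ~ M c by move: Mlh; rewrite h0E lead_coefC.
have [y [yc y0]] : exists y, ev y (c * lead_coef f) != 0 /\ forall q, tower j q -> M q -> ev y q = 0.
  by apply: IH => //; [apply: tM => //; apply: gf | move=> /Mpr []].
move: yc; rewrite mevalM mulf_eq0 negb_or => /andP [yc yl].
have y0P P : good j P -> triv P -> map_poly (ev y) P = 0.
  by move=> gP tP; apply/polyP => i; rewrite coef_map coef0 /= (y0 _ (gP i) (tP i)).
have [t /eqP rt] : exists t, root (map_poly (ev y) f) t.
  apply/closed_rootP; rewrite size_map_poly_id0 //; by rewrite gtn_eqF.
have [u [w [gu gw tr0]]] := N'h0.
exists (upd y j t); rewrite upd_horner //; split.
  have gall := gD gh0 (gN (gD (gM gu gPs) (gM gw gf))).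
  have /(congr1 (fun P => P.[t])) := y0P _ gall tr0.
  rewrite h0E rmorphB rmorphD !rmorphM /= map_polyC /=.
  rewrite !hornerE rt mulr0 addr0 => /eqP; rewrite subr_eq0 => /eqP e.
  by apply: contra yc => /eqP e0; rewrite e e0 mulr0.
(* Up to a power of the leading coefficient of f, the relation P is a multiple of f plus a relation
   shorter than f. The latter is trivial, so P vanishes at the root t of f. *)
move=> _ [P [gP ->]] MP; rewrite upd_horner //.
have [N1 [q [r [gq gr sr e]]]] := pseudo_div gf nf gP.
have tr : triv r.
  apply: minf => //; rewrite /N.
  have -> : r = lead_coef f ^+ N1 *: P - q * f by rewrite e addrAC subrr add0r.
  rewrite hornerD hornerN hornerZ hornerM; apply: MD; [exact: MM|].
  by apply: MN; apply: MM.
have /(congr1 (fun P => (map_poly (ev y) P).[t])) := e.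
rewrite /= rmorphD rmorphM /= (y0P r) // addr0 -mul_polyC rmorphM /= map_polyC /=.
rewrite !hornerM hornerC rt mulr0 => /eqP; rewrite mulf_eq0 rmorphXn /= expf_eq0.
by rewrite (negbTE yl) andbF => /eqP.
Qed.

Lemma prime_zero : exists y : 'I_n -> K, forall q, M q -> q.@[y] = 0.
Proof.
have [y [_ hy]] := tower_zero (leqnn n) (tower_full 1) M1.
by exists (fun i => y (val i)) => q Mq; apply: hy => //; apply: tower_full.
Qed.

End Nullstellensatz.

Theorem nullstellensatz (K : closedFieldType) (n : nat)
    (J : {mpoly K[n]} -> Prop) : is_ideal J ->
  (forall y : 'I_n -> K, exists2 q, J q & q.@[y] != 0) -> J 1.
Proof.
move=> Jid nz; apply: NNPP => /(prime_above Jid) [M [Mp JM]].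
have [y hy] := prime_zero Mp; have [q Jq /eqP] := nz y; apply.
exact: hy (JM _ Jq).
Qed.

(** * Linear independence over k and local rings *)

Section LinearDisjointness.
Variables (F E : fieldType) (iota : {rmorphism F -> E}).

(** Coefficients are indexed by all of [nat], so that a family can be enlarged by concatenation
    without reindexing. *)
Definition kspan (e : seq E) (x : E) :=
  exists c : nat -> F, x = \sum_(i < size e) iota (c i) * e`_i.

Definition kfree (e : seq E) := forall c : nat -> F,
  \sum_(i < size e) iota (c i) * e`_i = 0 -> forall i, (i < size e)%N -> c i = 0.

Lemma kfree1 : kfree [:: 1].
Proof.
move=> c; rewrite big_ord1 mulr1 => /eqP; rewrite fmorph_eq0 => /eqP h.
by case.
Qed.

Lemma kspan_cat e e' x : kspan e x -> kspan (e ++ e') x.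
Proof.
move=> [c ->]; exists (fun i => if (i < size e)%N then c i else 0).
rewrite size_cat big_split_ord /= [X in _ + X]big1 ?addr0.
  by apply: eq_bigr => i _; rewrite nth_cat ltn_ord.
by move=> i _; rewrite ltnNge leq_addr rmorph0 mul0r.
Qed.

Lemma kspan_nth e i : (i < size e)%N -> kspan e e`_i.
Proof.
move=> lt; exists (fun j => (j == i)%:R).
rewrite (bigD1 (Ordinal lt)) //= eqxx rmorph1 mul1r big1 ?addr0 // => j.
by rewrite -val_eqE /= => /negbTE ->; rewrite rmorph0 mul0r.
Qed.

Lemma kfree_rcons e x : kfree e -> ~ kspan e x -> kfree (rcons e x).
Proof.
move=> fe nx c; rewrite size_rcons big_ord_recr /= nth_rcons ltnn eqxx.
rewrite (eq_bigr (fun i : 'I__ => iota (c i) * e`_i)); last first.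
  by move=> i _; rewrite nth_rcons ltn_ord.
have [c0|nc] := eqVneq (c (size e)) 0.
  rewrite c0 rmorph0 mul0r addr0 => /fe h i.
  by rewrite ltnS leq_eqVlt => /orP [/eqP ->|/h].
move=> e0; case: nx; exists (fun i => - c i / c (size e)).
have nc' : iota (c (size e)) != 0 by rewrite fmorph_eq0.
apply: (mulfI nc'); rewrite mulr_sumr.
have {e0} : iota (c (size e)) * x = - \sum_(i < size e) iota (c i) * e`_i.
  by apply/eqP; rewrite -addr_eq0 addrC e0.
move=> ->; rewrite -sumrN; apply: eq_bigr => i _.
by rewrite rmorphM fmorphV rmorphN /=; field.
Qed.

(** This replaces the choice of a k-basis of K: each argument involves finitely many elements, and a
    free family is enlarged on demand. *)
Lemma kfree_extend e (l : seq E) : kfree e ->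
  exists e', kfree (e ++ e') /\ forall x, x \in l -> kspan (e ++ e') x.
Proof.
elim: l e => [|y l IH] e fe; first by exists [::]; rewrite cats0.
case: (classic (kspan e y)) => hy.
  have [e' [fe' h]] := IH e fe; exists e'; split => // x.
  by rewrite inE => /orP [/eqP ->|/h] //; apply: kspan_cat.
have [e' [fe' h]] := IH _ (kfree_rcons fe hy); exists (y :: e').
rewrite -cat_rcons; split => // x; rewrite inE => /orP [/eqP ->|/h] //.
apply: kspan_cat; have := @kspan_nth (rcons e y) (size e).
by rewrite nth_rcons ltnn eqxx size_rcons; apply.
Qed.

Definition pspan n (e : seq E) (q : {mpoly E[n]}) :=
  exists qq : nat -> {mpoly F[n]},
    q = \sum_(i < size e) e`_i *: map_mpoly iota (qq i).

Lemma pspan_coef n e (q : {mpoly E[n]}) :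
  (forall m, m \in msupp q -> kspan e q@_m) -> pspan e q.
Proof.
move=> h; rewrite (mpolyE q) big_seq; elim/big_ind: _.
- by exists (fun=> 0); rewrite big1 // => i _; rewrite rmorph0 scaler0.
- move=> _ _ [a ->] [b ->]; exists (fun i => a i + b i).
  by rewrite -big_split; apply: eq_bigr => i _; rewrite rmorphD scalerDr.
- move=> m /h [c ->]; exists (fun i => c i *: 'X_[m]).
  rewrite scaler_suml; apply: eq_bigr => i _.
  by rewrite map_mpolyZ map_mpolyX scalerA mulrC.
Qed.

Definition mcoefs n (q : {mpoly E[n]}) := [seq q@_m | m <- msupp q].

Lemma pspan_extend e (l : seq {n & {mpoly E[n]}}) : kfree e ->
  exists e', kfree (e ++ e') /\ forall n (q : {mpoly E[n]}),
    List.In (existT _ n q) l -> pspan (e ++ e') q.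
Proof.
move=> fe; have [e' [fe' h]] := kfree_extend (flatten [seq mcoefs (projT2 u) | u <- l]) fe.
exists e'; split => // n q ql; apply: pspan_coef => m mq; apply: h.
elim: l ql => //= u l IH [e0|/IH h]; rewrite mem_cat; last by rewrite h orbT.
by rewrite e0 /=; apply/orP; left; exact: (map_f (fun m => q@_m) mq).
Qed.

Lemma pspan_family n e N (q : 'I_N -> {mpoly E[n]}) : kfree e ->
  exists e', kfree (e ++ e') /\ forall i, pspan (e ++ e') (q i).
Proof.
move=> fe; have [e' [fe' h]] := kfree_extend (flatten [seq mcoefs (q i) | i <- enum 'I_N]) fe.
exists e'; split => // i; apply: pspan_coef => m mq; apply: h.
apply/flattenP; exists (mcoefs (q i)); last exact: (map_f (fun m => (q i)@_m) mq).
by apply/mapP; exists i; rewrite // mem_enum.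
Qed.

End LinearDisjointness.

(** * Local rings at specializations of a generic point *)

Section Local.
Variables (K KK : fieldType) (cst : {rmorphism K -> KK}).

Local Notation pev := (mmap cst).

Lemma mmapXU n (xi : 'I_n -> KK) i : pev xi 'X_i = xi i.
Proof. by rewrite mmapX mmap1U. Qed.

Lemma mmap_mderivXU n (xi : 'I_n -> KK) i t : pev xi ('X_i)^`M(t) = (i == t)%:R.
Proof.
rewrite mderivX mnm1E; have [->|_] := eqVneq i t; last by rewrite scale0r rmorph0.
by rewrite scale1r -{1}[U_(t)%MM]add0m addmK mpolyX0 rmorph1.
Qed.

Lemma mpoly_ring_ind n (P : {mpoly K[n]} -> Prop) :
  (forall c, P c%:MP) -> (forall i, P 'X_i) ->
  (forall p q, P p -> P q -> P (p + q)) -> (forall p q, P p -> P q -> P (p * q)) ->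
  forall q, P q.
Proof.
move=> PC PX PD PM q; rewrite (mpolyE q).
have P0 : P 0 by rewrite -(mpolyC0 n K).
have P1 : P 1 by rewrite -(mpolyC1 n K).
elim/big_ind: _ => // m _; rewrite -mul_mpolyC; apply: (PM) => //.
rewrite mpolyXE_id; elim/big_ind: _ => // i _.
by elim: (m i) => [|k IH]; rewrite ?expr0 // exprS; apply: (PM).
Qed.

(* [loc xi y r c]: the rational function [r] of the coordinates [xi] is regular
   at the point [y], with value [c]. *)
Definition loc n (xi : 'I_n -> KK) (y : 'I_n -> K) (r : KK) (c : K) :=
  exists A B : {mpoly K[n]},
    [/\ B.@[y] != 0, r * pev xi B = pev xi A & c * B.@[y] = A.@[y]].

(** The point [y] is a specialization of [xi] in the sense of Weil: evaluation at [y] factors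
    through K[xi]. This is what makes the value in [loc] unique. *)
Definition compat n (xi : 'I_n -> KK) (y : 'I_n -> K) :=
  forall A, pev xi A = 0 -> A.@[y] = 0.

Section OnePoint.
Variables (n : nat) (xi : 'I_n -> KK) (y : 'I_n -> K).
Hypothesis xiy : compat xi y.

Lemma pev_neq0 B : B.@[y] != 0 -> pev xi B != 0.
Proof. by apply: contra => /eqP /xiy ->. Qed.

Lemma loc_uniq r c c' : loc xi y r c -> loc xi y r c' -> c = c'.
Proof.
move=> [A [B [nB rB cB]]] [A' [B' [nB' rB' cB']]].
have /xiy : pev xi (A * B' - A' * B) = 0.
  by rewrite rmorphB !rmorphM /= -rB -rB'; ring.
rewrite mevalB !mevalM -cB -cB' => e.
apply: (mulIf nB); apply: (mulIf nB'); apply/eqP; rewrite -subr_eq0 -e.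
by apply/eqP; ring.
Qed.

Lemma loc_pev q : loc xi y (pev xi q) q.@[y].
Proof. by exists q, 1; rewrite meval1 rmorph1 !mulr1 oner_neq0. Qed.

Lemma loc_cst c : loc xi y (cst c) c.
Proof. by have := loc_pev c%:MP; rewrite mmapC mevalC. Qed.

Lemma locX i : loc xi y (xi i) (y i).
Proof. by have := loc_pev 'X_i; rewrite mmapXU mevalXU. Qed.

Lemma locD r c r' c' : loc xi y r c -> loc xi y r' c' -> loc xi y (r + r') (c + c').
Proof.
move=> [A [B [nB rB cB]]] [A' [B' [nB' rB' cB']]].
exists (A * B' + A' * B), (B * B').
rewrite mevalD !mevalM rmorphD !rmorphM /= -rB -rB' -cB -cB' mulf_neq0 //.
by split => //; ring.
Qed.

Lemma locM r c r' c' : loc xi y r c -> loc xi y r' c' -> loc xi y (r * r') (c * c').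
Proof.
move=> [A [B [nB rB cB]]] [A' [B' [nB' rB' cB']]].
exists (A * A'), (B * B').
rewrite !mevalM !rmorphM /= -rB -rB' -cB -cB' mulf_neq0 //.
by split => //; ring.
Qed.

Lemma locN r c : loc xi y r c -> loc xi y (- r) (- c).
Proof. by rewrite -mulN1r -[- c]mulN1r -(rmorphN1 cst); apply: locM (loc_cst _). Qed.

Lemma locB r c r' c' : loc xi y r c -> loc xi y r' c' -> loc xi y (r - r') (c - c').
Proof. by move=> h h'; apply: locD h (locN h'). Qed.

Lemma loc_neq0 r c : loc xi y r c -> c != 0 -> r != 0.
Proof.
move=> h; apply: contra => /eqP r0; have := loc_cst 0; rewrite rmorph0 -r0 => h0.
by apply/eqP; apply: loc_uniq h h0.
Qed.

Lemma locV r c : loc xi y r c -> c != 0 -> loc xi y r^-1 c^-1.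
Proof.
move=> h nc; have nr := loc_neq0 h nc; move: h => [A [B [nB rB cB]]].
exists B, A; rewrite -cB -rB mulf_neq0 //; split => //; first by rewrite mulrA mulVf ?mul1r.
by rewrite mulrA mulVf ?mul1r.
Qed.

Lemma locF r c r' c' : loc xi y r c -> loc xi y r' c' -> c' != 0 ->
  loc xi y (r / r') (c / c').
Proof. by move=> h h' n'; apply: locM h (locV h' n'). Qed.

Section Subst.
Variables (n' : nat) (eta : 'I_n' -> KK) (y' : 'I_n' -> K).
Hypothesis etay : forall t, loc xi y (eta t) (y' t).

Lemma loc_subst q : loc xi y (pev eta q) q.@[y'].
Proof.
elim/mpoly_ring_ind: q => [c|i|p q hp hq|p q hp hq].
- by rewrite mmapC mevalC; apply: loc_cst.
- by rewrite mmapXU mevalXU.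
- by rewrite rmorphD mevalD; apply: locD.
- by rewrite rmorphM mevalM; apply: locM.
Qed.

Lemma compat_subst : compat eta y'.
Proof.
move=> A A0; have := loc_subst A; rewrite A0 => h.
by apply: loc_uniq h _; have := loc_cst 0; rewrite rmorph0.
Qed.

Lemma loc_trans r c : loc eta y' r c -> loc xi y r c.
Proof.
move=> [A [B [nB rB cB]]]; have hB := loc_subst B.
have nB' := loc_neq0 hB nB.
have -> : r = pev eta A / pev eta B by rewrite -rB mulfK.
have -> : c = A.@[y'] / B.@[y'] by rewrite -cB mulfK.
by apply: locF => //; apply: loc_subst.
Qed.
End Subst.
End OnePoint.
End Local.

(** * Derivations of the function field *)

Section Derivations.
Variables (K KK : fieldType) (cst : {rmorphism K -> KK}).
Local Notation pev := (mmap cst).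

Definition deriv (d : KK -> KK) :=
  [/\ forall x y, d (x + y) = d x + d y,
      forall x y, d (x * y) = d x * y + x * d y
    & forall c, d (cst c) = 0].

Section OneDerivation.
Variable d : KK -> KK.
Hypothesis hd : deriv d.

Lemma derivD x y : d (x + y) = d x + d y. Proof. by case: hd. Qed.
Lemma derivM x y : d (x * y) = d x * y + x * d y. Proof. by case: hd. Qed.
Lemma derivC c : d (cst c) = 0. Proof. by case: hd. Qed.
Lemma deriv0 : d 0 = 0. Proof. by rewrite -[X in d X](rmorph0 cst) derivC. Qed.
Lemma deriv1 : d 1 = 0. Proof. by rewrite -[X in d X](rmorph1 cst) derivC. Qed.
Lemma derivN x : d (- x) = - d x.
Proof. by apply/eqP; rewrite -addr_eq0 -derivD addNr deriv0. Qed.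
Lemma derivB x y : d (x - y) = d x - d y.
Proof. by rewrite derivD derivN. Qed.
Lemma deriv_sum (I : Type) (r : seq I) (P : pred I) F :
  d (\sum_(i <- r | P i) F i) = \sum_(i <- r | P i) d (F i).
Proof. exact: (big_morph d derivD deriv0). Qed.
Lemma derivCM c x : d (cst c * x) = cst c * d x.
Proof. by rewrite derivM derivC mul0r add0r. Qed.

Lemma deriv_div x y : y != 0 -> d (x / y) = (d x * y - x * d y) / y ^+ 2.
Proof.
move=> ny; have : d x = d (x / y) * y + x / y * d y by rewrite -derivM divfK.
by move=> ->; field.
Qed.

Lemma deriv_pev n (xi : 'I_n -> KK) q :
  d (pev xi q) = \sum_t pev xi q^`M(t) * d (xi t).
Proof.
elim/mpoly_ring_ind: q => [c|i|p q hp hq|p q hp hq].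
- rewrite mmapC derivC big1 // => t _; by rewrite mderivC rmorph0 mul0r.
- rewrite mmapXU (bigD1 i) //= big1 ?addr0.
    by rewrite mmap_mderivXU eqxx mul1r.
  by move=> j nij; rewrite mmap_mderivXU eq_sym (negbTE nij) mul0r.
- rewrite rmorphD derivD hp hq -big_split; apply: eq_bigr => t _.
  by rewrite mderivD rmorphD mulrDl.
- rewrite rmorphM derivM hp hq mulr_suml mulr_sumr -big_split; apply: eq_bigr => t _.
  by rewrite mderivM rmorphD !rmorphM /=; ring.
Qed.
End OneDerivation.

Definition generates n (xi : 'I_n -> KK) :=
  forall r, exists A B, pev xi B != 0 /\ r * pev xi B = pev xi A.

Lemma deriv_ext n (xi : 'I_n -> KK) d d' : generates xi -> deriv d -> deriv d' ->
  (forall t, d (xi t) = d' (xi t)) -> d =1 d'.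
Proof.
move=> gxi hd hd' e r; have [A [B [nB rB]]] := gxi r.
have eq q : d (pev xi q) = d' (pev xi q).
  by rewrite (deriv_pev hd) (deriv_pev hd'); apply: eq_bigr => t _; rewrite e.
have -> : r = pev xi A / pev xi B by rewrite -rB mulfK.
by rewrite (deriv_div hd) // (deriv_div hd') // !eq.
Qed.

(** The quotient rule defines the extension as a relation [R]; the hypothesis on polynomial
    relations makes the result independent of the chosen fraction. *)
Lemma deriv_extend n (xi : 'I_n -> KK) (r : 'I_n -> KK) : generates xi ->
  (forall q, pev xi q = 0 -> \sum_t pev xi q^`M(t) * r t = 0) ->
  exists d, deriv d /\ forall t, d (xi t) = r t.
Proof.
move=> gxi hr; pose D q := \sum_t pev xi q^`M(t) * r t.
have DD p q : D (p + q) = D p + D q.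
  by rewrite -big_split; apply: eq_bigr => t _; rewrite mderivD rmorphD mulrDl.
have DM p q : D (p * q) = D p * pev xi q + pev xi p * D q.
  rewrite mulr_suml mulr_sumr -big_split; apply: eq_bigr => t _.
  by rewrite mderivM rmorphD !rmorphM /=; ring.
have DC c : D c%:MP = 0.
  by apply: big1 => t _; rewrite mderivC rmorph0 mul0r.
have DX i : D 'X_i = r i.
  rewrite /D (bigD1 i) //= big1 ?addr0.
    by rewrite mmap_mderivXU eqxx mul1r.
  by move=> j nij; rewrite mmap_mderivXU eq_sym (negbTE nij) mul0r.
have DN q : D (- q) = - D q.
  by apply/eqP; rewrite -addr_eq0 -DD addNr -(mpolyC0 n K) DC.
pose R w u := exists A B, [/\ pev xi B != 0, w * pev xi B = pev xi A &
  u * pev xi B ^+ 2 = D A * pev xi B - pev xi A * D B].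
have Rfun w u u' : R w u -> R w u' -> u = u'.
  move=> [A [B [nB wB uB]]] [A' [B' [nB' wB' uB']]].
  have : D (A * B' - A' * B) = 0.
    by apply: hr; rewrite rmorphB !rmorphM /= -wB -wB'; ring.
  rewrite DD DN !DM -wB -wB' => e.
  have nBB : pev xi B * pev xi B' != 0 by rewrite mulf_neq0.
  apply: (mulIf nBB); apply: (mulIf nBB).
  have -> : u * (pev xi B * pev xi B') * (pev xi B * pev xi B') =
    (u * pev xi B ^+ 2) * pev xi B' ^+ 2 by ring.
  have -> : u' * (pev xi B * pev xi B') * (pev xi B * pev xi B') =
    (u' * pev xi B' ^+ 2) * pev xi B ^+ 2 by ring.
  rewrite uB uB' -wB -wB'; apply/eqP; rewrite -subr_eq0 -(mulr0 (pev xi B * pev xi B')) -e.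
  by apply/eqP; ring.
have Rtot w : exists u, R w u.
  have [A [B [nB wB]]] := gxi w.
  exists ((D A * pev xi B - pev xi A * D B) / pev xi B ^+ 2), A, B; split => //.
  by rewrite divfK // expf_eq0.
have [d dP] := functional_choice _ Rtot.
have RE w u : R w u -> d w = u by move=> h; apply: Rfun (dP w) h.
have RX q : R (pev xi q) (D q).
  exists q, 1; rewrite rmorph1 !mulr1 oner_neq0 -(mpolyC1 n K) DC mulr0 subr0.
  by rewrite expr1n mulr1.
exists d; split; last by move=> t; rewrite -DX -[X in d X](mmapXU cst); apply: RE.
split.
- move=> w w'; apply: RE; have [A [B [nB wB uB]]] := dP w.
  have [A' [B' [nB' wB' uB']]] := dP w'.
  exists (A * B' + A' * B), (B * B'); rewrite rmorphD !rmorphM mulf_neq0 //=.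
  split => //; first by rewrite -wB -wB'; ring.
  rewrite DD !DM mulrDl.
  have -> : d w * (pev xi B * pev xi B') ^+ 2 = (d w * pev xi B ^+ 2) * pev xi B' ^+ 2 by ring.
  have -> : d w' * (pev xi B * pev xi B') ^+ 2 = (d w' * pev xi B' ^+ 2) * pev xi B ^+ 2 by ring.
  by rewrite uB uB'; ring.
- move=> w w'; apply: RE; have [A [B [nB wB uB]]] := dP w.
  have [A' [B' [nB' wB' uB']]] := dP w'.
  exists (A * A'), (B * B'); rewrite !rmorphM mulf_neq0 //=.
  split => //; first by rewrite -wB -wB'; ring.
  rewrite !DM mulrDl.
  have -> : d w * w' * (pev xi B * pev xi B') ^+ 2 =
    (d w * pev xi B ^+ 2) * (w' * pev xi B') * pev xi B' by ring.
  have -> : w * d w' * (pev xi B * pev xi B') ^+ 2 =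
    (d w' * pev xi B' ^+ 2) * (w * pev xi B) * pev xi B by ring.
  by rewrite uB uB' wB wB'; ring.
- by move=> c; apply: RE; rewrite -[cst c](mmapC xi) -(DC c).
Qed.

Lemma deriv_add d d' : deriv d -> deriv d' -> deriv (fun x => d x + d' x).
Proof.
move=> hd hd'; split=> [x y|x y|c].
- by rewrite (derivD hd) (derivD hd'); ring.
- by rewrite (derivM hd) (derivM hd'); ring.
- by rewrite (derivC hd) (derivC hd') addr0.
Qed.

Lemma deriv_scale a d : deriv d -> deriv (fun x => a * d x).
Proof.
move=> hd; split=> [x y|x y|c].
- by rewrite (derivD hd); ring.
- by rewrite (derivM hd); ring.
- by rewrite (derivC hd) mulr0.
Qed.

Lemma deriv_zero : deriv (fun=> 0).
Proof. by split=> *; rewrite ?mulr0 ?mul0r ?addr0. Qed.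

Lemma deriv_big (I : Type) (r : seq I) (P : pred I) (d : I -> KK -> KK) :
  (forall i, P i -> deriv (d i)) -> deriv (fun x => \sum_(i <- r | P i) d i x).
Proof.
move=> h; elim: r => [|i r IH].
  by split=> *; rewrite !big_nil ?mulr0 ?mul0r ?addr0.
have e x : \sum_(j <- i :: r | P j) d j x =
   (if P i then d i x else 0) + \sum_(j <- r | P j) d j x.
  by rewrite big_cons; case: (P i); rewrite ?add0r.
case: (boolP (P i)) e => [/h hi|_] e; last first.
  by split=> *; rewrite !e !add0r; [apply: (derivD IH) | apply: (derivM IH) | apply: (derivC IH)].
have h2 := deriv_add hi IH.
by split=> *; rewrite !e; [apply: (derivD h2) | apply: (derivM h2) | apply: (derivC h2)].
Qed.
End Derivations.

(** * Homogeneous vector fields and their divergence *)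

Section ProjectiveSpace.
Variables (K KK : fieldType) (cst : {rmorphism K -> KK}) (m : nat).
Local Notation pev := (mmap cst).
Variables (z : 'I_m -> KK) (pd : 'I_m -> KK -> KK).
Hypothesis z_gen : generates cst z.
Hypothesis pd_deriv : forall j, deriv cst (pd j).
Hypothesis pdz : forall j i, pd j (z i) = (i == j)%:R.

Definition zeta : 'cV[KK]_m.+1 :=
  \col_i (if unlift ord0 i is Some j then z j else 1).

Lemma zeta0 : zeta ord0 0 = 1.
Proof. by rewrite mxE unlift_none. Qed.
Lemma zetaS j : zeta (lift ord0 j) 0 = z j.
Proof. by rewrite mxE liftK. Qed.

(* [dv y] is the vector field on affine space [A^m] induced by the homogeneous vector field
   of degree one whose components, divided by the 0-th coordinate, are [y], and [dvg y] is
   the divergence of the latter, which tells apart the fields [y + r *: zeta] inducing [dv y]. *)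
Definition dvc (y : 'cV[KK]_m.+1) j := y (lift ord0 j) 0 - z j * y 0 0.
Definition dv y (r : KK) := \sum_j dvc y j * pd j r.
Definition dvg y := \sum_j pd j (dvc y j) + m.+1%:R * y 0 0.

Lemma dv_deriv y : deriv cst (dv y).
Proof. by apply: deriv_big => j _; apply: deriv_scale. Qed.

Lemma dvz y j : dv y (z j) = dvc y j.
Proof.
rewrite /dv (bigD1 j) //= pdz eqxx mulr1 big1 ?addr0 // => i nij.
by rewrite pdz eq_sym (negbTE nij) mulr0.
Qed.

Lemma dvcD y y' j : dvc (y + y') j = dvc y j + dvc y' j.
Proof. by rewrite /dvc !mxE; ring. Qed.
Lemma dvcZ a y j : dvc (a *: y) j = a * dvc y j.
Proof. by rewrite /dvc !mxE; ring. Qed.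

Lemma dvD y y' r : dv (y + y') r = dv y r + dv y' r.
Proof. by rewrite -big_split; apply: eq_bigr => j _; rewrite dvcD mulrDl. Qed.
Lemma dvZ a y r : dv (a *: y) r = a * dv y r.
Proof. by rewrite mulr_sumr; apply: eq_bigr => j _; rewrite dvcZ mulrA. Qed.
Lemma dv0 r : dv 0 r = 0.
Proof. by rewrite -(scale0r (0 : 'cV__)) dvZ mul0r. Qed.
Lemma dv_sum (I : Type) (s : seq I) (P : pred I) F r :
  dv (\sum_(i <- s | P i) F i) r = \sum_(i <- s | P i) dv (F i) r.
Proof. by apply: (big_morph (dv^~ r)) => [x y|]; rewrite ?dvD ?dv0. Qed.

Lemma dvgD y y' : dvg (y + y') = dvg y + dvg y'.
Proof.
rewrite /dvg (eq_bigr (fun j => pd j (dvc y j) + pd j (dvc y' j))).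
  by rewrite big_split /= mxE; ring.
by move=> j _; rewrite dvcD (derivD (pd_deriv j)).
Qed.
Lemma dvgZ a y : dvg (a *: y) = a * dvg y + dv y a.
Proof.
rewrite /dvg (eq_bigr (fun j => a * pd j (dvc y j) + dvc y j * pd j a)).
  rewrite big_split /= -mulr_sumr mxE /dv; ring.
by move=> j _; rewrite dvcZ (derivM (pd_deriv j)); ring.
Qed.
Lemma dvg0 : dvg 0 = 0.
Proof. by rewrite -(scale0r (0 : 'cV__)) dvgZ dv0 mul0r addr0. Qed.
Lemma dvgCZ c y : dvg (cst c *: y) = cst c * dvg y.
Proof. by rewrite dvgZ (derivC (dv_deriv y)) addr0. Qed.
Lemma dvg_sum (I : Type) (s : seq I) (P : pred I) F :
  dvg (\sum_(i <- s | P i) F i) = \sum_(i <- s | P i) dvg (F i).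
Proof. by apply: (big_morph dvg) => [x y|]; rewrite ?dvgD ?dvg0. Qed.

Lemma cV_eqP (u v : 'cV[KK]_m.+1) :
  u 0 0 = v 0 0 -> (forall j, u (lift ord0 j) 0 = v (lift ord0 j) 0) -> u = v.
Proof.
move=> h0 hS; apply/matrixP => i k; rewrite !ord1.
by case: (unliftP ord0 i) => [j|] ->.
Qed.

Lemma dv_eq0 y : (forall j, dvc y j = 0) -> y = y 0 0 *: zeta.
Proof.
move=> h; apply: cV_eqP; first by rewrite mxE zeta0 mulr1.
move=> j; rewrite mxE zetaS mulrC; apply/eqP; rewrite -subr_eq0; apply/eqP.
exact: h.
Qed.

Lemma dvc_zeta j : dvc zeta j = 0.
Proof. by rewrite /dvc zetaS zeta0 mulr1 subrr. Qed.
Lemma dv_zeta r : dv zeta r = 0.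
Proof. by apply: big1 => j _; rewrite dvc_zeta mul0r. Qed.
Lemma dvg_zeta : dvg zeta = m.+1%:R.
Proof.
rewrite /dvg zeta0 mulr1 big1 ?add0r // => j _.
by rewrite dvc_zeta (deriv0 (pd_deriv j)).
Qed.

Hypothesis p_neq0 : m.+1%:R != 0 :> KK.

(** The induced field determines y up to a multiple u zeta, and that multiple changes the divergence
    by (m + 1)u. *)
Lemma dv_inj y y' : (forall j, dv y (z j) = dv y' (z j)) -> dvg y = dvg y' -> y = y'.
Proof.
move=> h hg; pose u := y - y'.
have e : u = u 0 0 *: zeta.
  apply: dv_eq0 => j; rewrite /u -scaleN1r dvcD dvcZ mulN1r -!dvz h; exact: subrr.
have : dvg u = 0 by rewrite /u dvgD -scaleN1r -(rmorphN1 cst) dvgCZ rmorphN1 hg; ring.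
rewrite e dvgZ dv_zeta dvg_zeta addr0 => /eqP; rewrite mulf_eq0 (negbTE p_neq0) orbF.
move=> /eqP u0; apply/eqP; rewrite -subr_eq0 -/u; by rewrite e u0 scale0r.
Qed.

Lemma dv_surj d s : deriv cst d -> exists y, (forall r, dv y r = d r) /\ dvg y = s.
Proof.
(* The 0-th component is free, since the others compensate for it in the induced field; it is solved
   for from the prescribed divergence. *)
move=> hd; pose y0 := (s - \sum_j pd j (d (z j))) / m.+1%:R.
pose y : 'cV[KK]_m.+1 := \col_i (if unlift ord0 i is Some j then d (z j) + z j * y0 else y0).
have y00 : y 0 0 = y0 by rewrite mxE unlift_none.
have ec j : dvc y j = d (z j) by rewrite /dvc y00 mxE liftK addrK.
exists y; split.
  apply: (deriv_ext z_gen (dv_deriv y) hd) => j; by rewrite dvz.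
rewrite /dvg y00 /y0 mulrC divfK // (eq_bigr (fun j => pd j (d (z j)))); last by move=> j _; rewrite ec.
by rewrite addrC subrK.
Qed.

Definition mz (v : 'M[K]_m.+1) : 'cV[KK]_m.+1 := map_mx cst v *m zeta.

Lemma mzD v w : mz (v + w) = mz v + mz w.
Proof. by rewrite /mz map_mxD mulmxDl. Qed.
Lemma mzZ c v : mz (c *: v) = cst c *: mz v.
Proof. by rewrite /mz map_mxZ scalemxAl. Qed.
Lemma mz0 : mz 0 = 0. Proof. by rewrite /mz map_mx0 mul0mx. Qed.
Lemma mzM v w : mz (v *m w) = map_mx cst v *m mz w.
Proof. by rewrite /mz map_mxM mulmxA. Qed.
Lemma mz1 : mz 1%:M = zeta.
Proof. by rewrite /mz map_mx1 mul1mx. Qed.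
Lemma mz_sum (I : Type) (s : seq I) (P : pred I) F :
  mz (\sum_(i <- s | P i) F i) = \sum_(i <- s | P i) mz (F i).
Proof. exact: (big_morph mz mzD mz0). Qed.

Lemma mzE v i : mz v i 0 = cst (v i 0) + \sum_j cst (v i (lift ord0 j)) * z j.
Proof.
rewrite /mz mxE big_ord_recl zeta0 mulr1 !mxE; congr (_ + _).
by apply: eq_bigr => j _; rewrite zetaS mxE.
Qed.

Lemma mz_delta i k : mz (delta_mx i k) = zeta k 0 *: delta_mx i 0.
Proof.
apply/matrixP => a b; rewrite ord1 /mz mxE (bigD1 k) //= big1 ?addr0.
  rewrite [map_mx _ _ _ _]mxE [delta_mx i k _ _]mxE eqxx andbT rmorph_nat.
  by rewrite [RHS]mxE [delta_mx _ _ _ _]mxE eqxx andbT mulrC.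
move=> l nl; rewrite [map_mx _ _ _ _]mxE [delta_mx i k _ _]mxE (negbTE nl) andbF.
by rewrite rmorph0 mul0r.
Qed.

Lemma pd_mz v i j : pd j (mz v i 0) = cst (v i (lift ord0 j)).
Proof.
have hj := pd_deriv j.
rewrite mzE (derivD hj) (derivC hj) add0r (deriv_sum hj) (bigD1 j) //= big1 ?addr0.
  by rewrite (derivCM hj) pdz eqxx mulr1.
by move=> l nl; rewrite (derivCM hj) pdz (negbTE nl) mulr0.
Qed.

Lemma dvg_mz v : dvg (mz v) = cst (\tr v).
Proof.
rewrite /dvg (eq_bigr (fun j => cst (v (lift ord0 j) (lift ord0 j)) - mz v 0 0
   - z j * cst (v 0 (lift ord0 j)))); last first.
  move=> j _; rewrite /dvc (derivB (pd_deriv j)) (derivM (pd_deriv j)) !pd_mz pdz eqxx.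
  by rewrite mul1r opprD addrA.
rewrite !sumrB sumr_const card_ord /mxtrace big_ord_recl rmorphD rmorph_sum /=.
rewrite mulrSr mulrDl mul1r mulr_natl [X in _ + (_ + X)]mzE.
have -> : \sum_(i < m) z i * cst (v 0 (lift ord0 i)) = \sum_j cst (v 0 (lift ord0 j)) * z j.
  by apply: eq_bigr => i _; rewrite mulrC.
by ring.
Qed.

End ProjectiveSpace.

(** * Regular vector fields on projective space *)

Lemma mmap_comp (K : fieldType) (S T : comNzRingType) (f : {rmorphism K -> S})
    (phi : {rmorphism S -> T}) n (h : 'I_n -> S) (q : {mpoly K[n]}) :
  phi (mmap f h q) = mmap (phi \o f) (phi \o h) q.
Proof.
rewrite /mmap rmorph_sum; apply: eq_bigr => t _; rewrite rmorphM; congr (_ * _).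
by rewrite /mmap1 rmorph_prod; apply: eq_bigr => i _; rewrite rmorphXn.
Qed.

Lemma mmap_eq (K S : nzRingType) (f g : K -> S) n (h k : 'I_n -> S) (q : {mpoly K[n]}) :
  f =1 g -> h =1 k -> mmap f h q = mmap g k q.
Proof.
move=> e e'; apply: eq_bigr => t _; rewrite e; congr (_ * _).
exact: mmap1_eq.
Qed.

Lemma mpoly_nonroot (K : closedFieldType) n (B : {mpoly K[n]}) :
  B != 0 -> exists u, B.@[u] != 0.
Proof.
move=> nB; have pr : is_prime (fun q : {mpoly K[n]} => q = 0).
  split; [split => // | by apply/eqP; exact: oner_neq0 |].
  - by move=> x y -> ->; rewrite addr0.
  - by move=> a x ->; rewrite mulr0.
  - move=> x y /eqP; rewrite mulf_eq0 => /orP [] /eqP; by [left|right].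
have [|y [yB _]] := tower_zero pr (leqnn n) (tower_full B); first exact/eqP.
by exists (fun i => y (val i)).
Qed.

(** The denominators of r form an ideal without zeros. At a specialization of [xi] local regularity
    supplies a nonvanishing denominator; at any other point some polynomial killed by [xi] does not
    vanish, and it is a denominator with numerator 0. *)
Lemma loc_global (K : closedFieldType) (KK : fieldType) (cst : {rmorphism K -> KK})
    n (xi : 'I_n -> KK) r :
  (forall y, compat cst xi y -> exists c, loc cst xi y r c) ->
  exists A, r = mmap cst xi A.
Proof.
move=> h; pose J B := exists A, r * mmap cst xi B = mmap cst xi A.
suff [A] : J 1 by rewrite rmorph1 mulr1; exists A.
apply: nullstellensatz.
  split; first by exists 0; rewrite !rmorph0 mulr0.
  - by move=> x y [A eA] [B eB]; exists (A + B); rewrite !rmorphD mulrDr eA eB.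
  - by move=> a x [A eA]; exists (a * A); rewrite !rmorphM /= mulrCA eA.
move=> y; case: (classic (compat cst xi y)) => [/h [c [A [B [nB rB _]]]]|nc].
  by exists B => //; exists A.
have [A A0] : exists A, mmap cst xi A = 0 /\ A.@[y] != 0.
  apply: NNPP => no; apply: nc => A A0; apply: NNPP => /eqP nA.
  by apply: no; exists A.
case: A0 => A0 nA; exists A => //.
by exists 0; rewrite A0 mulr0 rmorph0.
Qed.

Section ProjectiveRegularity.
Variables (K : closedFieldType) (KK : fieldType) (cst : {rmorphism K -> KK}) (m : nat).
Local Notation pev := (mmap cst).
Variables (z : 'I_m -> KK).
Hypothesis z_free : forall A, pev z A = 0 -> A = 0.
Local Notation zt i := (zeta z i 0).

(** Affine coordinates of the generic point in the l-th chart. The coordinate j = l, constantly 1,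
    is kept so that all charts share one index set. *)
Definition pz (l : 'I_m.+1) (j : 'I_m.+1) := zt j / zt l.
Definition pn (x : 'I_m.+1 -> K) l (j : 'I_m.+1) := x j / x l.

Lemma z_neq0 j : z j != 0.
Proof.
apply/eqP; rewrite -(mmapXU cst) => /z_free /(congr1 (mcoeff U_(j))).
by rewrite mcoeffX eqxx mcoeff0 => /eqP; rewrite oner_eq0.
Qed.

Lemma zeta_neq0 j : zt j != 0.
Proof. by rewrite mxE; case: unlift => [i|]; rewrite ?z_neq0 ?oner_neq0. Qed.

Lemma pzE l l' j : pz l' j = pz l j / pz l l'.
Proof. by rewrite /pz; field; rewrite !zeta_neq0. Qed.

Definition spec0 (A : {mpoly K[m.+1]}) : {mpoly K[m]} :=
  mmap (@mpolyC m K) (fun i => if unlift ord0 i is Some j then 'X_j else 1) A.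

Lemma pev_spec0 A : pev (fun j => zt j) A = pev z (spec0 A).
Proof.
rewrite /spec0 (mmap_comp (@mpolyC m K) (mmap cst z)).
apply: mmap_eq => [c|i] /=; first by rewrite mmapC.
by rewrite mxE; case: unlift => [j|]; rewrite ?mmapXU ?rmorph1.
Qed.

Lemma mmapZE (q : {mpoly K[m.+1]}) (x : 'I_m.+1 -> K) i t :
  (mmap (@polyC K) (fun j => (x j)%:P + (j == i)%:R * 'X) q).[t] =
  q.@[fun j => x j + (j == i)%:R * t].
Proof.
have := mmap_comp (@polyC K) (horner_eval t) (fun j => (x j)%:P + (j == i)%:R * 'X) q.
rewrite /= /horner_eval => ->; apply: mmap_eq => [c|j] /=; first by rewrite hornerC.
by rewrite !hornerE; case: (j == i); rewrite /= ?hornerE.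
Qed.

(** Where x_0 is nonzero this is freeness of [z]. Otherwise x is approached along the line x + t
    e_0: the polynomial in t obtained from A vanishes for every nonzero t, hence also at 0. *)
Lemma pz_compat x l : x l != 0 -> compat cst (pz l) (pn x l).
Proof.
have h0 (y : 'I_m.+1 -> K) : y ord0 != 0 -> compat cst (pz ord0) (pn y ord0).
  move=> ny A; have -> : pev (pz ord0) A = pev (fun j => zt j) A.
    by apply: mmap_eq => // i; rewrite /pz zeta0 divr1.
  rewrite pev_spec0 => /z_free A0.
  have := mmap_comp (@mpolyC m K) (meval (fun j => pn y ord0 (lift ord0 j)))
    (fun i => if unlift ord0 i is Some j then 'X_j else 1) A.
  rewrite -/(spec0 A) A0 rmorph0 => ->; apply: mmap_eq => [c|i] /=.
    by rewrite mevalC.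
  case: unliftP => [j|] -> ; first by rewrite mevalXU.
  by rewrite meval1 /pn divff.
have h1 (y : 'I_m.+1 -> K) : y ord0 != 0 -> y l != 0 -> compat cst (pz l) (pn y l).
  move=> n0 nl; apply: (compat_subst (h0 _ n0)) => t.
  rewrite (pzE ord0); have -> : pn y l t = pn y ord0 t / pn y ord0 l.
    by rewrite /pn; field; rewrite n0.
  apply: locF; [exact: h0 | exact: locX | exact: locX |].
  by rewrite /pn mulf_neq0 // invr_neq0.
move=> nl; have [x0|n0] := eqVneq (x ord0) 0; last exact: h1.
move=> A A0; pose y := pn x l.
have nl0 : l != ord0 by apply: contraNneq nl => ->; rewrite x0.
pose P := mmap (@polyC K) (fun j => (y j)%:P + (j == ord0)%:R * 'X) A.
suff : P = 0.
  move=> /(congr1 (fun P => P.[0])); rewrite mmapZE horner0 => <-.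
  by apply: mmap_eq => // j; rewrite mulr0 addr0.
apply/eqP/negPn/negP => nP.
have /closed_nonrootP [t] : P * 'X != 0 by rewrite mulf_neq0 // polyX_eq0.
rewrite rootM negb_or rootE mmapZE => /andP [/eqP h nt]; apply: h.
have nt' : t != 0 by move: nt; rewrite rootE hornerX.
have := h1 (fun j => y j + (j == ord0)%:R * t).
rewrite eqxx (negbTE nl0) mul0r addr0 mul1r.
have -> : y ord0 = 0 by rewrite /y /pn x0 mul0r.
have yl : y l = 1 by rewrite /y /pn divff.
rewrite add0r yl => /(_ nt' (oner_neq0 _) A A0) <-.
by apply: mmap_eq => // j; rewrite /pn (negbTE nl0) mul0r addr0 yl divr1.
Qed.

Definition rloc (x : 'I_m.+1 -> K) r c :=
  exists l, x l != 0 /\ loc cst (pz l) (pn x l) r c.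

Lemma rloc_pz x l l' : x l != 0 -> x l' != 0 -> forall j,
  loc cst (pz l) (pn x l) (pz l' j) (pn x l' j).
Proof.
move=> nl nl' j; rewrite (pzE l).
have -> : pn x l' j = pn x l j / pn x l l' by rewrite /pn; field; rewrite nl.
apply: locF; [exact: pz_compat | exact: locX | exact: locX |].
by rewrite /pn mulf_neq0 // invr_neq0.
Qed.

Lemma rlocP x l r c : x l != 0 -> rloc x r c -> loc cst (pz l) (pn x l) r c.
Proof.
move=> nl [l' [nl' h]]; apply: (loc_trans (pz_compat nl)) h.
exact: rloc_pz.
Qed.

Lemma rlocI x l r c : x l != 0 -> loc cst (pz l) (pn x l) r c -> rloc x r c.
Proof. by exists l. Qed.

Lemma rloc_eq x x' l r c : x l != 0 -> x' l != 0 -> pn x l =1 pn x' l ->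
  rloc x r c -> rloc x' r c.
Proof.
move=> nl nl' e /(rlocP nl) [A [B [nB rB cB]]]; exists l; split => //.
have ev (q : {mpoly K[m.+1]}) : q.@[pn x' l] = q.@[pn x l] by apply: mmap_eq.
by exists A, B; rewrite !ev.
Qed.

Definition nzpt (x : 'I_m.+1 -> K) := exists l, x l != 0.

(** Preserving every local ring of projective space is how a derivation of KK is a global vector
    field. *)
Definition regder (d : KK -> KK) :=
  forall x r c, nzpt x -> rloc x r c -> exists c', rloc x (d r) c'.

(** The relation [pz l l = 1] forces y_l = 1 at every specialization y, so y is itself a vector of
    homogeneous coordinates to which the hypothesis applies. *)
Lemma rloc_global l r : (forall x, x l != 0 -> exists c, rloc x r c) ->
  exists A, r = pev (pz l) A.
Proof.
move=> h; apply: loc_global => y cy.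
have yl : y l = 1.
  have /cy : pev (pz l) ('X_l - 1) = 0.
    by rewrite rmorphB rmorph1 /= mmapXU /pz divff ?zeta_neq0 ?subrr.
  by rewrite mevalB mevalXU meval1 => /eqP; rewrite subr_eq0 => /eqP.
have nl : y l != 0 by rewrite yl oner_neq0.
have [c /(rlocP nl) [A [B [nB rB cB]]]] := h y nl; exists c, A, B.
have ev (q : {mpoly K[m.+1]}) : q.@[y] = q.@[pn y l].
  by apply: mmap_eq => // j; rewrite /pn yl divr1.
by rewrite !ev.
Qed.

Lemma regder_gen d : deriv cst d ->
  (forall l j, exists A, d (pz l j) = pev (pz l) A) -> regder d.
Proof.
move=> hd h x r c [l nl] /(rlocP nl) [A [B [nB rB cB]]].
have co := pz_compat nl.
have nB' := pev_neq0 co nB.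
have reg q : exists c', loc cst (pz l) (pn x l) (d (pev (pz l) q)) c'.
  rewrite (deriv_pev hd); elim/big_ind: _.
  - by exists 0; rewrite -(rmorph0 cst); apply: loc_cst.
  - by move=> a b [ca ha] [cb hb]; exists (ca + cb); apply: locD.
  - move=> t _; have [C ->] := h l t; exists (q^`M(t).@[pn x l] * C.@[pn x l]).
    by apply: locM; apply: loc_pev.
have -> : r = pev (pz l) A / pev (pz l) B by rewrite -rB mulfK.
rewrite (deriv_div hd) //; have [a ha] := reg A; have [b hb] := reg B.
eexists; apply: (rlocI nl); apply: (locF co).
- apply: locB; apply: locM; [exact: ha|exact: loc_pev|exact: loc_pev|exact: hb].
- by rewrite expr2; apply: locM; apply: loc_pev.
- by rewrite mulf_neq0.
Qed.

Section Vector.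
Variable (pd : 'I_m -> KK -> KK).
Hypothesis pd_deriv : forall j, deriv cst (pd j).
Hypothesis pdz : forall j i, pd j (z i) = (i == j)%:R.

Lemma dv_zt y i : dv z pd y (zt i) = y i 0 - zt i * y 0 0.
Proof.
have hd := dv_deriv z pd_deriv y.
case: (unliftP ord0 i) => [j|] ->.
  by rewrite zetaS (dvz pdz).
by rewrite zeta0 (deriv1 hd) mul1r subrr.
Qed.

Lemma regder_mz v : regder (dv z pd (mz cst z v)).
Proof.
apply: regder_gen; first exact: dv_deriv.
move=> l j; rewrite (deriv_div (dv_deriv z pd_deriv _)) ?zeta_neq0 // !dv_zt.
pose L i := \sum_k v i k *: 'X_k : {mpoly K[m.+1]}.
exists (L j - 'X_j * L l).
have LE i : pev (pz l) (L i) = mz cst z v i 0 / zt l.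
  rewrite /mz mxE mulr_suml rmorph_sum; apply: eq_bigr => k _.
  by rewrite /= mmapZ mmapXU mxE mulrA.
rewrite rmorphB rmorphM /= mmapXU !LE /pz.
by field; rewrite zeta_neq0.
Qed.

Lemma msizeM_deg (H H' : {mpoly K[m]}) N N' : (msize H <= N.+1)%N ->
  (msize H' <= N'.+1)%N -> (msize (H * H')%R <= (N + N').+1)%N.
Proof.
move=> h h'; have [->|nH] := eqVneq H 0; first by rewrite mul0r msize0.
have [->|nH'] := eqVneq H' 0; first by rewrite mulr0 msize0.
by rewrite msizeM //; move: (msize H) (msize H') h h' => u v; lia.
Qed.

(** The bound on the degree by the exponent N of the cleared denominator is the point: it turns
    regularity at infinity into a degree bound. *)
Lemma homogenize a (A : {mpoly K[m.+1]}) : exists N (H : {mpoly K[m]}),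
  (msize H <= N.+1)%N /\ pev (pz (lift ord0 a)) A * z a ^+ N = pev z H.
Proof.
have sX (b : 'I_m) N : (msize ('X_b ^+ N : {mpoly K[m]})%R <= N.+1)%N.
  by rewrite mpolyXn msizeX mdegMn mdeg1 mul1n.
have evX b N : pev z ('X_b ^+ N) = z b ^+ N by rewrite rmorphXn /= mmapXU.
elim/mpoly_ring_ind: A => [c|i|p q [N [H [sH eH]]] [N' [H' [sH' eH']]]|p q [N [H [sH eH]]] [N' [H' [sH' eH']]]].
- exists 0%N, c%:MP; rewrite expr0 mulr1 !mmapC; split => //.
  by rewrite msizeC; case: eqP.
- rewrite mmapXU /pz zetaS.
  case: (unliftP ord0 i) => [j|] ->.
    by exists 1%N, 'X_j; rewrite zetaS mmapXU expr1 divfK ?z_neq0 // msizeX mdeg1.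
  exists 1%N, 1; rewrite zeta0 rmorph1 expr1 divfK ?z_neq0 // msize1; split => //.
- exists (N + N')%N, (H * 'X_a ^+ N' + H' * 'X_a ^+ N); split.
    apply: leq_trans (msizeD_le _ _) _; rewrite geq_max msizeM_deg //=.
    by rewrite addnC msizeM_deg.
  by rewrite !rmorphD !rmorphM /= -eH -eH' !evX exprD; ring.
- exists (N + N')%N, (H * H'); split; first exact: msizeM_deg.
  by rewrite !rmorphM /= -eH -eH' exprD; ring.
Qed.

Hypothesis m_gt1 : (1 < m)%N.
Hypothesis p_neq0 : m.+1%:R != 0 :> K.

Let zinj P Q : pev z P = pev z Q -> P = Q.
Proof. by move=> e; apply/eqP; rewrite -subr_eq0; apply/eqP/z_free; rewrite rmorphB /= e subrr. Qed.

Let coefMXU (q : {mpoly K[m]}) a M : ('X_a * q)@_(M + U_(a)) = q@_M.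
Proof.
rewrite {1}(mpolyE q) [in RHS](mpolyE q) mulr_sumr !raddf_sum; apply: eq_bigr => N _ /=.
by rewrite -scalerAr -mpolyXD !mcoeffZ !mcoeffX addmC eqm_add2r.
Qed.

Let coefMXU0 (q : {mpoly K[m]}) a (M : 'X_{1..m}) : M a = 0%N -> ('X_a * q)@_M = 0.
Proof.
move=> M0; rewrite (mpolyE q) mulr_sumr raddf_sum big1 // => N _ /=.
rewrite -scalerAr -mpolyXD mcoeffZ mcoeffX; case: eqP => [e|]; last by rewrite mulr0.
by move: M0; rewrite -e mnmDE mnm1E eqxx.
Qed.

Let affine (q : {mpoly K[m]}) : (msize q <= 2)%N ->
  pev z q = cst q@_0 + \sum_i cst q@_(U_(i)) * z i.
Proof.
move=> sq; have -> : q = (q@_0)%:MP + \sum_i q@_(U_(i)) *: 'X_i.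
  apply/mpolyP => M; rewrite mcoeffD mcoeffC raddf_sum /=.
  have [->|nM] := eqVneq M 0%MM.
    rewrite mulr1 big1 ?addr0 // => i _; rewrite mcoeffZ mcoeffX.
    case: eqP => [/(congr1 mdeg)|]; last by rewrite mulr0.
    by rewrite mdeg1 mdeg0.
  rewrite mulr0 add0r.
  have [/eqP/mdeg1P [i /eqP ->]|n1] := eqVneq (mdeg M) 1%N.
    rewrite (bigD1 i) //= mcoeffZ mcoeffX eqxx mulr1 big1 ?addr0 // => j nj.
    by rewrite mcoeffZ mcoeffXU (negbTE nj) mulr0.
  rewrite big1 => [|i _]; last first.
    rewrite mcoeffZ mcoeffX; case: eqP => [e|]; last by rewrite mulr0.
    by move: n1; rewrite -e mdeg1.
  apply: memN_msupp_eq0; apply: msize_mdeg_ge; apply: leq_trans sq _.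
  by move: nM n1; rewrite -mdeg_eq0; case: (mdeg M) => [|[|d]].
rewrite rmorphD rmorph_sum /= mmapC; congr (_ + _).
  rewrite mcoeffD mcoeffC eqxx mulr1 raddf_sum /= big1 ?addr0 // => i _.
  rewrite mcoeffZ mcoeffX; case: eqP => [/(congr1 mdeg)|]; last by rewrite mulr0.
  by rewrite mdeg1 mdeg0.
apply: eq_bigr => i _; rewrite mmapZ mmapXU; congr (cst _ * _).
rewrite mcoeffD mcoeffC raddf_sum /=; case: eqP => [/(congr1 mdeg)|_].
  by rewrite mdeg1 mdeg0.
rewrite mulr0 add0r (bigD1 i) //= mcoeffZ mcoeffXU eqxx mulr1 big1 ?addr0 // => j nj.
by rewrite mcoeffZ mcoeffXU (negbTE nj) mulr0.
Qed.

(** Regularity in chart 0 makes the components Q_j polynomial, and regularity in the other charts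
    bounds Q_j and Q_b z_a - z_b Q_a by degree 2. Hence the quadratic part of Q_j is z_j times one
    linear form common to all j, which a multiple of zeta absorbs. The constant divergence then
    makes that multiple constant. *)
Lemma regular_vector_field y c : regder (dv z pd y) -> dvg z pd y = cst c ->
  exists v, y = mz cst z v.
Proof.
move=> reg divy; pose d := dv z pd y.
have hd : deriv cst d := dv_deriv z pd_deriv y.
have dreg l j : exists A, d (pz l j) = pev (pz l) A.
  apply: rloc_global => x nl; apply: (reg x _ (pn x l j)); first by exists l.
  by exists l; split => //; apply: locX.
have sXN a N : msize ('X_a ^+ N : {mpoly K[m]}) = N.+1.
  by rewrite mpolyXn msizeX mdegMn mdeg1 mul1n.
have nXN a N : 'X_a ^+ N != 0 :> {mpoly K[m]}.
  by rewrite -msize_poly_eq0 sXN.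
(* Since [msize] is the degree plus one, this reads deg q + N = 2 + deg H with deg H at most N. *)
have cancelX (q H : {mpoly K[m]}) a N : (msize H <= N.+1)%N ->
    q * 'X_a ^+ N = 'X_a ^+ 2 * H -> (msize q <= 3)%N.
  move=> sH e; have [->|nq] := eqVneq q 0; first by rewrite msize0.
  have nH : H != 0.
    by apply: contra_eqN e => /eqP ->; rewrite mulr0 mulf_neq0.
  move: (congr1 (fun q => msize q) e); rewrite /= (msizeM nq (nXN _ _)) (msizeM (nXN a 2) nH) !sXN.
  by move: (msize q) (msize H) sH => u v; lia.
have [Q hQ] : exists Q : 'I_m -> {mpoly K[m]}, forall j, d (z j) = pev z (Q j).
  apply: (functional_choice (fun j q => d (z j) = pev z q)) => j; have [A] := dreg ord0 (lift ord0 j).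
  rewrite /pz zeta0 divr1 zetaS => ->; exists (spec0 A); rewrite -pev_spec0.
  by apply: mmap_eq => // i; rewrite divr1.
have sQ a : (msize (Q a) <= 3)%N.
  have [A] := dreg (lift ord0 a) ord0.
  have [N [H [sH eH]]] := homogenize a A.
  rewrite {1}/pz (deriv_div hd) ?zeta_neq0 // zeta0 (deriv1 hd) zetaS hQ => e.
  rewrite -msizeN; apply: (cancelX _ H a N sH); apply: zinj.
  rewrite !rmorphM /= -eH -e !rmorphXn rmorphN /= !mmapXU.
  by field; rewrite z_neq0.
have sQQ a b : (msize (Q b * 'X_a - 'X_b * Q a)%R <= 3)%N.
  have [A] := dreg (lift ord0 a) (lift ord0 b).
  have [N [H [sH eH]]] := homogenize a A.
  rewrite {1}/pz (deriv_div hd) ?zeta_neq0 // !zetaS !hQ => e.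
  apply: (cancelX _ H a N sH); apply: zinj.
  rewrite !rmorphM /= -eH -e !rmorphXn rmorphB !rmorphM /= !mmapXU.
  by field; rewrite z_neq0.
have top a b M : mdeg M = 3%N -> ('X_a * Q b)@_M = ('X_b * Q a)@_M.
  move=> dM; apply/eqP; rewrite -subr_eq0 -mcoeffB ['X_a * _]mulrC; apply/eqP.
  by apply: memN_msupp_eq0; apply: msize_mdeg_ge; rewrite dM.
have [j0 [j1 n01]] : exists j0 j1 : 'I_m, j0 != j1.
  by exists (Ordinal (ltnW m_gt1)), (Ordinal m_gt1).
pose cc i := (Q j0)@_(U_(j0) + U_(i)).
have QU j i : (Q j)@_(U_(j) + U_(i)) = cc i.
  rewrite -(coefMXU (Q j) j0) top ?mdegD ?mdeg1 //.
  by rewrite -addmA addmC coefMXU addmC.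
pose T j : {mpoly K[m]} := 'X_j * \sum_i cc i *: 'X_i.
have QT j : (msize (Q j - T j)%R <= 2)%N.
  have sT : (msize (T j) <= 3)%N.
    apply: (@msizeM_deg _ _ 1 1); first by rewrite msizeX mdeg1.
    elim/big_ind: _ => [|p q hp hq|i _]; first by rewrite msize0.
      by apply: leq_trans (msizeD_le _ _) _; rewrite geq_max hp.
    by apply: leq_trans (msizeZ_le _ _) _; rewrite msizeX mdeg1.
  have s3 : (msize (Q j - T j)%R <= 3)%N.
    by apply: leq_trans (msizeD_le _ _) _; rewrite msizeN geq_max sQ.
  rewrite leqNgt; apply/negP => s2.
  have nR : Q j - T j != 0 by apply: contraTneq s2 => ->; rewrite msize0.
  have := mlead_supp nR; have := mlead_deg nR; set M := mlead _.
  have -> : msize (Q j - T j) = 3%N by apply/eqP; rewrite eqn_leq s3.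
  move=> [dM]; rewrite mcoeff_msupp mcoeffB => /eqP; apply.
  (* A top monomial of Q_j without z_j is compared with Q_a for some a different from j: here two
     distinct coordinates are needed. *)
  have [Mj|Mj] := eqVneq (M j) 0%N.
    have [a na] : exists a, a != j.
      by have [e|n] := eqVneq j0 j; [exists j1; rewrite -e eq_sym | exists j0].
    rewrite (coefMXU0 _ Mj) subr0 -(coefMXU _ a) top ?mdegD ?dM ?mdeg1 //.
    by apply: coefMXU0; rewrite mnmDE Mj mnm1E (negbTE na).
  have ME : M = (U_(j) + (M - U_(j)))%MM.
    by rewrite addmC submK //; apply/mnm_lepP => i; rewrite mnm1E; case: eqP => // <-; rewrite lt0n.
  have /mdeg1P [i /eqP iE] : mdeg (M - U_(j))%MM == 1%N.
    by rewrite -(eqn_add2l 1) -{1}(mdeg1 j) -mdegD -ME dM.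
  rewrite ME iE QU addmC coefMXU raddf_sum /= (bigD1 i) //= mcoeffZ mcoeffXU eqxx mulr1.
  rewrite big1 ?addr0 ?subrr // => l nl; by rewrite mcoeffZ mcoeffXU (negbTE nl) mulr0.
(* Subtracting e zeta does not change the induced field. With this e the 0-th component becomes
   minus the common linear form, and the other components become Q_j - T_j, which are affine. *)
pose e := y 0 0 + \sum_i cst (cc i) * z i.
pose v : 'M[K]_m.+1 := \matrix_(a, b)
  if unlift ord0 a is Some j then
    (if unlift ord0 b is Some i then (Q j - T j)@_(U_(i)) else (Q j - T j)@_0)
  else (if unlift ord0 b is Some i then - cc i else 0).
have v00 : v ord0 0 = 0 by rewrite mxE unlift_none.
have v0S i : v ord0 (lift ord0 i) = - cc i by rewrite mxE unlift_none liftK.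
have vS0 j : v (lift ord0 j) 0 = (Q j - T j)@_0 by rewrite mxE unlift_none liftK.
have vSS j i : v (lift ord0 j) (lift ord0 i) = (Q j - T j)@_(U_(i)) by rewrite mxE !liftK.
have yE : y = mz cst z v + e *: zeta z.
  apply: cV_eqP => [|j]; rewrite [RHS]mxE [X in _ = _ + X]mxE mzE.
    rewrite zeta0 mulr1 v00 rmorph0 add0r /e.
    rewrite addrCA -big_split big1 ?addr0 // => i _ /=.
    by rewrite v0S rmorphN mulNr addNr.
  have -> : y (lift ord0 j) 0 = d (z j) + z j * y 0 0.
    by rewrite /d (dvz pdz) /dvc subrK.
  have -> : d (z j) = pev z (Q j - T j) + z j * \sum_i cst (cc i) * z i.
    rewrite hQ rmorphB rmorphM /= mmapXU rmorph_sum /=.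
    under eq_bigr => i _ do rewrite mmapZ mmapXU.
    by rewrite subrK.
  rewrite (affine (QT j)) vS0 zetaS /e.
  under [X in _ = _ + X + _]eq_bigr => i _ do rewrite vSS.
  by ring.
have p_neq0' : m.+1%:R != 0 :> KK by rewrite -(rmorph_nat cst) fmorph_eq0.
have eE : e = cst ((c - \tr v) / m.+1%:R).
  move: divy; rewrite yE (dvgD z pd_deriv) (dvg_mz pd_deriv pdz) (dvgZ z pd_deriv).
  rewrite (dvg_zeta z pd_deriv) (dv_zeta z) addr0 => h.
  by rewrite rmorphM fmorphV rmorph_nat rmorphB /= -h addrAC subrr add0r mulfK.
exists (v + ((c - \tr v) / m.+1%:R)%:M).
by rewrite mzD {1}yE eE -scalemx1 mzZ mz1.
Qed.

End Vector.
End ProjectiveRegularity.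

(** * The k-form of the matrix algebra *)

Section Algebra.
Variables (k : fieldType) (K : closedFieldType) (KK : fieldType).
Variables (iota : {rmorphism k -> K}) (cst : {rmorphism K -> KK}) (m : nat).
Local Notation pev := (mmap cst).
Variables (z : 'I_m -> KK) (pd : 'I_m -> KK -> KK).
Hypothesis z_gen : generates cst z.
Hypothesis z_free : forall A, pev z A = 0 -> A = 0.
Hypothesis pd_deriv : forall j, deriv cst (pd j).
Hypothesis pdz : forall j i, pd j (z i) = (i == j)%:R.
Hypothesis m_gt1 : (1 < m)%N.
Hypothesis p_neq0 : m.+1%:R != 0 :> K.

Local Notation mz := (mz cst z).
Local Notation dv := (dv z pd).
Local Notation dvg := (dvg z pd).
Local Notation zeta := (zeta z).
Local Notation Mp := 'M[K]_m.+1.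

Lemma p_neq0' : m.+1%:R != 0 :> KK.
Proof. by rewrite -(rmorph_nat cst) fmorph_eq0. Qed.

Lemma mz_inj : injective mz.
Proof.
suff h v : mz v = 0 -> v = 0.
  move=> v w e; apply/eqP; rewrite -subr_eq0; apply/eqP/h.
  by rewrite mzD -scaleN1r mzZ rmorphN1 scaleN1r e subrr.
move=> v0; apply/matrixP => i b; rewrite [RHS]mxE.
have c0 j : v i (lift ord0 j) = 0.
  apply: (fmorph_inj cst); rewrite -(pd_mz pd_deriv pdz) v0 mxE rmorph0.
  by rewrite (deriv0 (pd_deriv j)).
case: (unliftP ord0 b) => [j|] ->; first exact: c0.
have : mz v i 0 = 0 by rewrite v0 mxE.
rewrite mzE big1 ?addr0 => [/eqP|j _]; last by rewrite c0 rmorph0 mul0r.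
by rewrite fmorph_eq0 => /eqP.
Qed.

(* A family of matrices behaving like [E_0, .., E_m] under [v |-> v zeta] is the
   product of a fixed column by the unit rows. *)
Lemma constant_column0 (N : 'I_m.+1 -> Mp) :
  (forall l, mz (N l) = zeta l 0 *: mz (N ord0)) ->
  forall l, N l = col ord0 (N ord0) *m delta_mx 0 l.
Proof.
move=> h; have c0 s j : N ord0 s (lift ord0 j) = 0.
  have [l nl] : exists l : 'I_m, l != j.
    have [e|] := eqVneq (Ordinal (ltnW m_gt1)) j; last by eexists; eassumption.
    by exists (Ordinal m_gt1); rewrite -e.
  (* Apply two distinct partial derivatives to N_(l+1) zeta = z_l N_0 zeta: the left side is affine
     and vanishes, and the right side leaves the coefficient of N_0 at z_j. *)
  have := congr1 (fun u : 'cV_m.+1 => pd l (pd j (u s 0))) (h (lift ord0 l)).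
  rewrite /= [X in _ = pd l (pd j X)]mxE zetaS (derivM (pd_deriv j)) pdz (negbTE nl) mul0r add0r.
  rewrite !(pd_mz pd_deriv pdz) (derivC (pd_deriv l)) (derivM (pd_deriv l)) pdz eqxx.
  by rewrite (derivC (pd_deriv l)) mulr0 addr0 mul1r => /esym/eqP; rewrite fmorph_eq0 => /eqP.
have z0 : mz (N ord0) = map_mx cst (col ord0 (N ord0)).
  apply/matrixP => s b; rewrite ord1 mzE big1 ?addr0 => [|j _]; first by rewrite !mxE.
  by rewrite c0 rmorph0 mul0r.
move=> l; apply: mz_inj; rewrite h z0.
apply/matrixP => s b; rewrite !ord1 [RHS]mxE (bigD1 l) //= big1 ?addr0.
  by rewrite !mxE big_ord1 !mxE !eqxx mulr1 mulrC.
by move=> i nl; rewrite !mxE big_ord1 !mxE (negbTE nl) andbF mulr0 rmorph0 mul0r.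
Qed.

(** Recombining the N_j with the inverse of [b] replaces the frame b zeta by zeta and reduces to
    [constant_column0]. *)
Lemma constant_column (b : Mp) (N : 'I_m.+1 -> Mp) : b \in unitmx ->
  (forall j, mz b 0 0 *: mz (N j) = mz b j 0 *: mz (N ord0)) ->
  exists w : 'cV_m.+1, forall j, N j = w *m row j b.
Proof.
move=> ub h; pose b' := invmx b.
have nb0 : mz b 0 0 != 0.
  apply/eqP => e; have : row 0 b = 0.
    apply/rowP => j; rewrite !mxE.
    pose v := \matrix_(i, j) (if i == 0 then b 0 j else 0) : Mp.
    have : mz v = 0.
      apply/matrixP => i c; rewrite ord1 [RHS]mxE.
      have [->|ni] := eqVneq i 0.
        rewrite -[RHS]e !mxE; apply: eq_bigr => l _; by rewrite !mxE eqxx.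
      by rewrite mxE big1 // => l _; rewrite !mxE (negbTE ni) rmorph0 mul0r.
    by rewrite -(mz0 cst z) => /mz_inj /matrixP /(_ 0 j); rewrite !mxE eqxx.
  move=> r0; have : row 0 (b *m b') = 0 by rewrite row_mul r0 mul0mx.
  rewrite mulmxV // row1 => /rowP /(_ 0); rewrite !mxE !eqxx => /eqP.
  by rewrite oner_eq0.
pose N' l := \sum_j b' l j *: N j.
have hN' l : mz (N' l) = (zeta l 0 / mz b 0 0) *: mz (N ord0).
  have e : zeta l 0 = \sum_j cst (b' l j) * mz b j 0.
    have -> : zeta = map_mx cst b' *m mz b by rewrite -mzM mulVmx // mz1.
    by rewrite mxE; apply: eq_bigr => j _; rewrite mxE.
  rewrite mz_sum e mulr_suml scaler_suml; apply: eq_bigr => j _.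
  have e' : mz (N j) = (mz b j 0 / mz b 0 0) *: mz (N ord0).
    by apply: (scalerI nb0); rewrite h scalerA mulrC divfK.
  by rewrite mzZ e' scalerA mulrA.
have hN'0 l : mz (N' l) = zeta l 0 *: mz (N' ord0).
  by rewrite !hN' zeta0 scalerA; congr (_ *: _); ring.
exists (col ord0 (N' ord0)) => j.
have -> : N j = \sum_l b j l *: N' l.
  transitivity (\sum_l \sum_i (b j l * b' l i) *: N i).
    rewrite exchange_big /= (bigD1 j) //= -scaler_suml [X in _ + X]big1 => [|i ni].
      have : (b *m b') j j = 1 by rewrite mulmxV // mxE eqxx.
      by rewrite mxE => ->; rewrite scale1r addr0.
    have : (b *m b') j i = 0 by rewrite mulmxV // mxE eq_sym (negbTE ni).
    by rewrite mxE -scaler_suml => ->; rewrite scale0r.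
  by apply: eq_bigr => l _; rewrite scaler_sumr; apply: eq_bigr => i _; rewrite scalerA.
rewrite [row j b](matrix_sum_delta) big_ord1 mulmx_sumr; apply: eq_bigr => l _.
by rewrite (constant_column0 hN'0) -scalemxAr !mxE.
Qed.

Section RationalStructure.
Variable K0 : KK -> Prop.
Hypothesis K0k : forall c, K0 (cst (iota c)).
Hypothesis K0D : forall a b, K0 a -> K0 b -> K0 (a + b).
Hypothesis K0M : forall a b, K0 a -> K0 b -> K0 (a * b).
Hypothesis K0V : forall a, K0 a -> K0 a^-1.
Hypothesis disj : forall e, kfree iota e -> forall r : nat -> KK, (forall i, K0 (r i)) ->
  \sum_(i < size e) cst e`_i * r i = 0 -> forall i, (i < size e)%N -> r i = 0.
Variables (n : nat) (xi : 'I_n -> KK).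
Hypothesis xi_gen : generates cst xi.
Hypothesis xi_K0 : forall t, K0 (xi t).

Lemma K0_0 : K0 0. Proof. by rewrite -(rmorph0 cst) -(rmorph0 iota). Qed.
Lemma K0N a : K0 a -> K0 (- a).
Proof. by rewrite -mulN1r -(rmorphN1 cst) -(rmorphN1 iota); apply: K0M. Qed.

Lemma K0_pev q : K0 (pev xi (map_mpoly iota q)).
Proof.
elim/mpoly_ring_ind: q => [c|i|p q hp hq|p q hp hq].
- by rewrite map_mpolyC mmapC; apply: K0k.
- by rewrite map_mpolyX mmapXU; apply: xi_K0.
- by rewrite !rmorphD; apply: K0D.
- by rewrite !rmorphM; apply: K0M.
Qed.

Lemma pev_pspan e (q : {mpoly K[n]}) : pspan iota e q ->
  exists r : nat -> KK, (forall i, K0 (r i)) /\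
    pev xi q = \sum_(i < size e) cst e`_i * r i.
Proof.
move=> [qq ->]; exists (fun i => pev xi (map_mpoly iota (qq i))); split.
  by move=> i; apply: K0_pev.
by rewrite rmorph_sum; apply: eq_bigr => i _ /=; rewrite mmapZ.
Qed.

Lemma dv_eq0_K0 y : (forall r, K0 r -> dv y r = 0) -> forall r, dv y r = 0.
Proof.
move=> h; apply: (deriv_ext xi_gen (dv_deriv z pd_deriv y) (deriv_zero cst)) => t.
exact: h.
Qed.

(* The homogeneous vector fields defined over the function field [K0] of the k-form. *)
Definition J0 (y : 'cV[KK]_m.+1) := (forall r, K0 r -> K0 (dv y r)) /\ K0 (dvg y).

Lemma J0D y y' : J0 y -> J0 y' -> J0 (y + y').
Proof.
move=> [h1 h2] [h1' h2']; split => [r Kr|]; first by rewrite dvD; apply: K0D; auto.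
by rewrite (dvgD z pd_deriv); apply: K0D.
Qed.
Lemma J0Z a y : K0 a -> J0 y -> J0 (a *: y).
Proof.
move=> Ka [h1 h2]; split => [r Kr|]; first by rewrite dvZ; apply: K0M; auto.
by rewrite (dvgZ z pd_deriv); apply: K0D; [apply: K0M | apply: h1].
Qed.
Lemma J0_0 : J0 0.
Proof.
split => [r _|]; first by rewrite dv0; apply: K0_0.
rewrite (dvg0 z pd_deriv); exact: K0_0.
Qed.
Lemma J0_sum (I : Type) (s : seq I) (P : pred I) F :
  (forall i, P i -> J0 (F i)) -> J0 (\sum_(i <- s | P i) F i).
Proof. by move=> h; elim/big_ind: _ => //; [apply: J0_0 | apply: J0D]. Qed.

Lemma J0_disj e : kfree iota e -> forall y : nat -> 'cV_m.+1, (forall i, J0 (y i)) ->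
  \sum_(i < size e) cst e`_i *: y i = 0 -> forall i, (i < size e)%N -> y i = 0.
Proof.
move=> fe y hy s0 i lt; have d0 r : dv (y i) r = 0.
  apply: dv_eq0_K0 => {}r Kr; apply: (disj fe (r := fun i => dv (y i) r)) => //.
    by move=> j; have [h _] := hy j; apply: h.
  have := congr1 (dv ^~ r) s0; rewrite /= dv0 dv_sum => h; rewrite -[RHS]h.
  by apply: eq_bigr => j _; rewrite dvZ.
have g0 : dvg (y i) = 0.
  apply: (disj fe (r := fun i => dvg (y i))) => //.
    by move=> j; have [_ h] := hy j.
  have := congr1 dvg s0; rewrite /= (dvg0 z pd_deriv) (dvg_sum z pd_deriv) => h; rewrite -[RHS]h.
  by apply: eq_bigr => j _; rewrite (dvgCZ z pd_deriv).
apply: (dv_inj pd_deriv pdz p_neq0') => [j|]; first by rewrite d0 dv0.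
by rewrite g0 (dvg0 z pd_deriv).
Qed.

(* Write [c = A(xi) / C(xi)] and expand [A] and [C] over a k-free family: only
   the independence of the family over [K0] is needed. *)
Lemma J0_ratio c y y' : J0 y -> J0 y' -> y != 0 -> c *: y = y' -> K0 c.
Proof.
move=> Jy Jy' ny e; have [A [C [nC cC]]] := xi_gen c.
have [f [ff hf]] := pspan_family (fun i : 'I_2 => if i == 0 then A else C) (@kfree1 _ _ iota).
set g := _ ++ f in ff hf.
have [a [Ka eA]] := pev_pspan (hf 0).
have [b [Kb eB]] := pev_pspan (hf 1); rewrite /= in eA eB.
have rel i : (i < size g)%N -> a i *: y - b i *: y' = 0.
  apply: (J0_disj ff (y := fun i => a i *: y - b i *: y')).
    by move=> j; apply: J0D; [apply: J0Z | rewrite -scaleNr; apply: J0Z => //; apply: K0N].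
  transitivity (pev xi A *: y - pev xi C *: y'); last first.
    by rewrite -cC -e scalerA [_ * c]mulrC subrr.
  rewrite eA eB !scaler_suml -sumrB; apply: eq_bigr => j _.
  by rewrite scalerBr !scalerA.
have [i lt nb] : exists2 i, (i < size g)%N & b i != 0.
  apply: NNPP => no; case/eqP: nC; rewrite eB big1 // => i _.
  by apply/eqP; rewrite mulf_eq0; apply/orP; right; apply/negPn/negP => nb; apply: no; exists i.
have -> : c = a i / b i.
  have : (a i - b i * c) *: y = 0 by rewrite scalerBl -scalerA e rel.
  move=> /eqP; rewrite scaler_eq0 (negbTE ny) orbF subr_eq0 => /eqP ->.
  by rewrite mulrC mulKf.
by apply: K0M => //; apply: K0V.
Qed.

(** Membership in the algebra A. *)
Definition ratmx (v : Mp) := J0 (mz v).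

Lemma ratmxD v w : ratmx v -> ratmx w -> ratmx (v + w).
Proof. by rewrite /ratmx mzD; apply: J0D. Qed.
Lemma ratmxZ c v : ratmx v -> ratmx (iota c *: v).
Proof. by rewrite /ratmx mzZ; apply: J0Z. Qed.
Lemma ratmx0 : ratmx 0. Proof. by rewrite /ratmx mz0; apply: J0_0. Qed.
Lemma ratmx1 : ratmx 1%:M.
Proof.
rewrite /ratmx mz1; split => [r _|].
  by rewrite (dv_zeta z pd); apply: K0_0.
by rewrite (dvg_zeta z pd_deriv) -(rmorph_nat cst) -(rmorph_nat iota).
Qed.
Lemma ratmxN v : ratmx v -> ratmx (- v).
Proof. by rewrite -scaleN1r -(rmorphN1 iota); apply: ratmxZ. Qed.
Lemma ratmx_sum (I : Type) (s : seq I) (P : pred I) F :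
  (forall i, P i -> ratmx (F i)) -> ratmx (\sum_(i <- s | P i) F i).
Proof. by move=> h; elim/big_ind: _ => //; [apply: ratmx0 | apply: ratmxD]. Qed.

Lemma ratmx_disj e : kfree iota e -> forall v : nat -> Mp, (forall i, ratmx (v i)) ->
  \sum_(i < size e) e`_i *: v i = 0 -> forall i, (i < size e)%N -> v i = 0.
Proof.
move=> fe v hv s0 i lt; apply: mz_inj; rewrite mz0.
apply: (J0_disj fe (y := fun i => mz (v i))) => //.
rewrite -[RHS](mz0 cst z) -[X in mz X]s0 mz_sum; apply: eq_bigr => j _; by rewrite mzZ.
Qed.

Definition ratspan e v := exists a : nat -> Mp,
  (forall i, ratmx (a i)) /\ v = \sum_(i < size e) e`_i *: a i.

Lemma ratspan_cat e e' v : ratspan e v -> ratspan (e ++ e') v.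
Proof.
move=> [a [ra ->]]; exists (fun i => if (i < size e)%N then a i else 0); split.
  by move=> i; case: ifP => _ //; apply: ratmx0.
rewrite size_cat big_split_ord /= [X in _ + X]big1 ?addr0.
  by apply: eq_bigr => i _; rewrite nth_cat ltn_ord.
by move=> i _; rewrite ltnNge leq_addr scaler0.
Qed.

Hypothesis rat_gen : forall v, exists N (c : 'I_N -> K) (a : 'I_N -> Mp),
  (forall i, ratmx (a i)) /\ v = \sum_i c i *: a i.

Lemma ratspan_extend e (l : seq Mp) : kfree iota e ->
  exists e', kfree iota (e ++ e') /\ forall v, v \in l -> ratspan (e ++ e') v.
Proof.
elim: l e => [|v l IH] e fe; first by exists [::]; rewrite cats0.
have [e1 [fe1 h1]] := IH _ fe.
have [N [c [a [ra vE]]]] := rat_gen v.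
have [e2 [fe2 h2]] := kfree_extend [seq c i | i <- enum 'I_N] fe1.
exists (e1 ++ e2); rewrite catA; split => // w.
rewrite inE => /orP [/eqP ->|/h1]; last exact: ratspan_cat.
have hc i : exists d : nat -> k, c i = \sum_(j < size ((e ++ e1) ++ e2)) iota (d j) * ((e ++ e1) ++ e2)`_j.
  by apply: h2; apply: map_f; rewrite mem_enum.
have [d dE] := functional_choice _ hc.
exists (fun j => \sum_i iota (d i j) *: a i); split.
  by move=> j; apply: ratmx_sum => i _; apply: ratmxZ.
rewrite vE (eq_bigr (fun i => \sum_(j < size ((e ++ e1) ++ e2)) ((e ++ e1) ++ e2)`_j *: (iota (d i j) *: a i))).
  by rewrite exchange_big; apply: eq_bigr => j _; rewrite scaler_sumr.
by move=> i _; rewrite dE scaler_suml; apply: eq_bigr => j _; rewrite scalerA mulrC.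
Qed.

Definition lspan (l : seq Mp) v := exists g : nat -> K, v = \sum_(i < size l) g i *: l`_i.

Lemma lspan_catl l l' v : lspan l v -> lspan (l ++ l') v.
Proof.
move=> [g ->]; exists (fun i => if (i < size l)%N then g i else 0).
rewrite size_cat big_split_ord /= [X in _ + X]big1 ?addr0.
  by apply: eq_bigr => i _; rewrite ltn_ord nth_cat ltn_ord.
by move=> i _; rewrite ltnNge leq_addr scale0r.
Qed.

Lemma lspan_catr l l' v : lspan l v -> lspan (l' ++ l) v.
Proof.
move=> [g ->]; exists (fun i => if (i < size l')%N then 0 else g (i - size l')%N).
rewrite size_cat big_split_ord /= [X in _ = X + _]big1 ?add0r.
  by apply: eq_bigr => i _; rewrite nth_cat ltnNge leq_addr /= addKn.
by move=> i _; rewrite ltn_ord scale0r.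
Qed.

Lemma rat_spanning_list : exists l : seq Mp,
  (forall x, x \in l -> ratmx x) /\ forall v, lspan l v.
Proof.
have h (L : seq Mp) : exists l : seq Mp, (forall x, x \in l -> ratmx x) /\
    forall v, v \in L -> lspan l v.
  elim: L => [|v L [l [rl hl]]]; first by exists [::].
  have [N [c [a [ra vE]]]] := rat_gen v.
  exists ([seq a i | i <- enum 'I_N] ++ l); split.
    by move=> x; rewrite mem_cat => /orP [/mapP [i _ ->]|/rl].
  move=> w; rewrite inE => /orP [/eqP ->|/hl]; last exact: lspan_catr.
  apply: lspan_catl.
  exists (fun j => if insub j is Some i then c i else 0).
  rewrite vE size_map size_enum_ord; apply: eq_bigr => i _.
  by rewrite valK (nth_map i) ?size_enum_ord // nth_ord_enum.
have [l [rl hl]] := h [seq delta_mx u.1 u.2 | u : 'I_m.+1 * 'I_m.+1].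
exists l; split => // v; rewrite (matrix_sum_delta v).
have l0 : lspan l 0 by exists (fun=> 0); rewrite big1 // => i _; rewrite scale0r.
have lD a b : lspan l a -> lspan l b -> lspan l (a + b).
  move=> [g ->] [g' ->]; exists (fun i => g i + g' i); rewrite -big_split.
  by apply: eq_bigr => i _; rewrite scalerDl.
elim/big_ind: _ => // i _; elim/big_ind: _ => // j _.
have [g ->] : lspan l (delta_mx i j) by apply: hl; apply: (map_f (fun u => delta_mx u.1 u.2) (mem_enum _ (i, j))).
exists (fun s => v i j * g s); rewrite scaler_sumr.
by apply: eq_bigr => s _; rewrite scalerA.
Qed.

Lemma common_denominator N (c : 'I_N -> KK) : exists C (A : 'I_N -> {mpoly K[n]}),
  pev xi C != 0 /\ forall s, c s * pev xi C = pev xi (A s).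
Proof.
have h s : exists u : {mpoly K[n]} * {mpoly K[n]},
    pev xi u.2 != 0 /\ c s * pev xi u.2 = pev xi u.1.
  by have [A [B [nB e]]] := xi_gen (c s); exists (A, B).
have [u hu] := functional_choice _ h.
exists (\prod_s (u s).2), (fun s => (u s).1 * \prod_(t | t != s) (u t).2); split.
  rewrite rmorph_prod; apply/prodf_neq0 => s _; by case: (hu s).
move=> s; rewrite (bigD1 s) //= !rmorphM /= mulrA; congr (_ * _).
by case: (hu s).
Qed.

(** The products of v with a spanning list are expanded over one k-free family. Each component
    respects all KK-linear relations between the columns, hence is left multiplication by a matrix,
    and evaluating at the identity identifies that matrix. *)
Lemma ratmxM v w : ratmx v -> ratmx w -> ratmx (v *m w).
Proof.
move=> rv rw; have [l0 [rl0 hl0]] := rat_spanning_list.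
(* With 1 and w in front, v and v w are the products at positions 0 and 1. *)
pose l := 1%:M :: w :: l0.
have rl s : (s < size l)%N -> ratmx l`_s.
  case: s => [|[|s]] //= lt; first exact: ratmx1.
  by apply: rl0; apply: mem_nth.
have hl x : lspan l x by apply: (@lspan_catr l0 [:: 1%:M; w]).
have [e' [fe he]] := ratspan_extend [seq v *m x | x <- l] (@kfree1 _ _ iota).
set e := _ ++ e' in fe he.
have [u hu] : exists u : 'I_(size l) -> nat -> Mp, forall s,
    (forall b, ratmx (u s b)) /\ v *m l`_s = \sum_(b < size e) e`_b *: u s b.
  apply: (functional_choice (fun (s : 'I_(size l)) (us : nat -> Mp) => (forall b, ratmx (us b)) /\
    v *m l`_s = \sum_(b < size e) e`_b *: us b)) => s.
  by apply: he; apply: map_f; apply: mem_nth.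
(* The coefficients of the relation are expanded over [f] and the products over [e]; [J0_disj] is
   applied once for each family. *)
have rel (c : 'I_(size l) -> KK) : \sum_s c s *: mz l`_s = 0 ->
    forall b, (b < size e)%N -> \sum_s c s *: mz (u s b) = 0.
  move=> c0 b ltb; have [C [A [nC cA]]] := common_denominator c.
  have [f [ff hf]] := @pspan_family _ _ iota _ [::] _ A (fun _ _ _ => ltac:(by [])).
  rewrite /= in ff hf.
  have [a ha] := functional_choice _ (fun s => pev_pspan (hf s)).
  have r1 g : (g < size f)%N -> \sum_s a s g *: mz l`_s = 0.
    apply: (J0_disj ff (y := fun g => \sum_s a s g *: mz l`_s)) => [i|].
      apply: J0_sum => s _; apply: J0Z; first by case: (ha s).
      exact: rl.
    transitivity (\sum_s pev xi (A s) *: mz l`_s).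
      under eq_bigr => i _ do rewrite scaler_sumr.
      rewrite exchange_big; apply: eq_bigr => s _; case: (ha s) => _ ->.
      by rewrite scaler_suml; apply: eq_bigr => i _; rewrite scalerA.
    rewrite (eq_bigr (fun s => pev xi C *: (c s *: mz l`_s))).
      by rewrite -scaler_sumr c0 scaler0.
    by move=> s _; rewrite -cA scalerA mulrC.
  have r2 g : (g < size f)%N -> \sum_s a s g *: mz (u s b) = 0.
    move=> ltg; apply: (J0_disj fe (y := fun b => \sum_s a s g *: mz (u s b))) b ltb => [i|].
      apply: J0_sum => s _; apply: J0Z; first by case: (ha s).
      by case: (hu s) => h _; apply: h.
    transitivity (map_mx cst v *m \sum_s a s g *: mz l`_s); last by rewrite r1 ?mulmx0.
    rewrite mulmx_sumr; under eq_bigr => i _ do rewrite scaler_sumr.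
    rewrite exchange_big; apply: eq_bigr => s _; rewrite -scalemxAr -mzM.
    case: (hu s) => _ ->; rewrite mz_sum scaler_sumr; apply: eq_bigr => i _.
    by rewrite mzZ !scalerA mulrC.
  apply: (scalerI nC); rewrite scaler0 scaler_sumr.
  transitivity (\sum_(g < size f) cst f`_g *: \sum_s a s g *: mz (u s b)).
    under [RHS]eq_bigr => i _ do rewrite scaler_sumr.
    rewrite exchange_big; apply: eq_bigr => s _; rewrite scalerA mulrC cA.
    case: (ha s) => _ ->; rewrite scaler_suml; apply: eq_bigr => i _.
    by rewrite scalerA.
  by rewrite big1 // => g _; rewrite r2 ?scaler0.
(* The relations between matrix units, E_ij zeta = zeta_j E_i0 zeta, give through [constant_column0]
   a matrix B whose left multiplication is the b-th component; taking t = 0 in [uB], where the list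
   entry is 1, shows that B is [u ord0 b]. *)
have key s (b : 'I_(size e)) : u s b = u ord0 b *m l`_s.
  have [g hg] : exists g : 'I_m.+1 * 'I_m.+1 -> nat -> K, forall ij,
      delta_mx ij.1 ij.2 = \sum_(i < size l) g ij i *: l`_i.
    exact: (functional_choice _ (fun ij => hl (delta_mx ij.1 ij.2))).
  pose L i j := \sum_(s < size l) g (i, j) s *: u s b.
  have LE i j : mz (L i j) = \sum_(s < size l) cst (g (i, j) s) *: mz (u s b).
    by rewrite mz_sum; apply: eq_bigr => t _; rewrite mzZ.
  have Lz i j : mz (L i j) = zeta j 0 *: mz (L i ord0).
    apply/eqP; rewrite -subr_eq0 !LE scaler_sumr -sumrB; apply/eqP.
    have := rel (fun t => cst (g (i, j) t) - zeta j 0 * cst (g (i, ord0) t)).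
    have -> : \sum_(t < size l) (cst (g (i, j) t) - zeta j 0 * cst (g (i, ord0) t)) *: mz l`_t
       = mz (delta_mx i j) - zeta j 0 *: mz (delta_mx i ord0).
      rewrite (hg (i, j)) (hg (i, ord0)) !mz_sum scaler_sumr -sumrB; apply: eq_bigr => t _.
      by rewrite !mzZ scalerBl scalerA.
    rewrite !mz_delta zeta0 scale1r subrr => /(_ erefl b (ltn_ord b)) h.
    by rewrite -[RHS]h; apply: eq_bigr => t _; rewrite scalerBl scalerA.
  pose B := \sum_i col ord0 (L i ord0) *m delta_mx (0 : 'I_1) i.
  have LB i j : L i j = B *m delta_mx i j.
    rewrite (constant_column0 (Lz i)) mulmx_suml (bigD1 i) //= -mulmxA.
    rewrite mul_delta_mx big1 ?addr0 // => t nt.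
    by rewrite -mulmxA mul_delta_mx_cond (negbTE nt) mulr0n mulmx0.
  have uB t : u t b = B *m l`_t.
    set x := l`_t; apply: mz_inj; apply/eqP; rewrite -subr_eq0; apply/eqP.
    have -> : B *m x = \sum_i \sum_j x i j *: L i j.
      rewrite {1}(matrix_sum_delta x) mulmx_sumr; apply: eq_bigr => i _.
      by rewrite mulmx_sumr; apply: eq_bigr => j _; rewrite LB -scalemxAr.
    have := rel (fun r : 'I_(size l) => (r == t)%:R - cst (\sum_i \sum_j x i j * g (i, j) r)).
    have dsum (F : 'I_(size l) -> 'cV[KK]_m.+1) : \sum_r (r == t)%:R *: F r = F t.
      rewrite (bigD1 t) //= eqxx scale1r big1 ?addr0 // => r nr.
      by rewrite (negbTE nr) scale0r.
    have wsum (F : 'I_(size l) -> Mp) :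
       \sum_(r < size l) cst (\sum_i \sum_j x i j * g (i, j) r) *: mz (F r) =
       mz (\sum_i \sum_j x i j *: \sum_(r < size l) g (i, j) r *: F r).
      under eq_bigr => r _ do rewrite -mzZ.
      rewrite -mz_sum; congr (mz _).
      under [RHS]eq_bigr => i _.
        under eq_bigr => j _ do rewrite scaler_sumr.
        rewrite exchange_big; over.
      rewrite exchange_big; apply: eq_bigr => r _ /=; rewrite scaler_suml.
      apply: eq_bigr => i _; rewrite scaler_suml; apply: eq_bigr => j _.
      by rewrite scalerA.
    under eq_bigr => r _ do rewrite scalerBl.
    rewrite sumrB dsum wsum.
    have -> : \sum_i \sum_j x i j *: (\sum_(r < size l) g (i, j) r *: l`_r) = x.
      rewrite [RHS](matrix_sum_delta x); apply: eq_bigr => i _; apply: eq_bigr => j _.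
      by rewrite -(hg (i, j)).
    rewrite subrr => /(_ erefl b (ltn_ord b)).
    under eq_bigr => r _ do rewrite scalerBl.
    by rewrite sumrB (dsum (fun r => mz (u r b))) (wsum (fun r => u r b)).
  by rewrite !uB /= mulmx1.
(* As v is already in A and [e] starts with 1, independence leaves only the first coordinate. *)
have u0 (b : nat) : (b < size e)%N -> u ord0 b = if b == 0%N then v else 0.
  move=> ltb; apply/eqP; rewrite -subr_eq0; apply/eqP.
  apply: (ratmx_disj fe (v := fun b => u ord0 b - if b == 0%N then v else 0)) b ltb => [i|].
    apply: ratmxD; first by case: (hu ord0).
    by apply: ratmxN; case: eqP => _ //; apply: ratmx0.
  under eq_bigr => i _ do rewrite scalerBr.
  rewrite sumrB; case: (hu ord0) => _ <-; rewrite /= mulmx1 big_ord_recl /= scale1r.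
  by rewrite big1 ?addr0 ?subrr // => i _; rewrite scaler0.
pose s1 : 'I_(size l) := Ordinal (isT : (1 < size l)%N).
case: (hu s1) => ru1; have -> : l`_s1 = w by [].
rewrite big_ord_recl big1 ?addr0 => [->|i _].
  by rewrite /= scale1r; apply: ru1.
rewrite (key s1 (lift ord0 i)) u0 // mul0mx scaler0 //.
Qed.

End RationalStructure.
End Algebra.

(** * Matrices representing automorphisms *)

Lemma central_scalar (K : fieldType) n (X : 'M[K]_n.+1) :
  (forall v, X *m v = v *m X) -> X = (X 0 0)%:M.
Proof.
move=> h; have hh i j : X *m delta_mx i j = delta_mx i j *m X by apply: h.
have e a i j b : X a i *+ (j == b) = X j b *+ (a == i).
  have := congr1 (fun M : 'M_n.+1 => M a b) (hh i j); rewrite /= !mxE.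
  rewrite (bigD1 i) //= big1 => [|l nl]; last by rewrite !mxE (negbTE nl) mulr0.
  rewrite (bigD1 j) //= big1 => [|l nl]; last by rewrite !mxE (negbTE nl) andbF mul0r.
  by rewrite !mxE !eqxx /= andbT !addr0 mulr_natr mulr_natl eq_sym.
apply/matrixP => a i; rewrite !mxE; have := e a i 0 0; rewrite eqxx => <- //.
Qed.

Section Automorphism.
Variables (k : fieldType) (K : closedFieldType) (KK : fieldType).
Variables (iota : {rmorphism k -> K}) (cst : {rmorphism K -> KK}) (m : nat).
Local Notation pev := (mmap cst).
Variables (z : 'I_m -> KK) (pd : 'I_m -> KK -> KK).
Hypothesis z_gen : generates cst z.
Hypothesis z_free : forall A, pev z A = 0 -> A = 0.
Hypothesis pd_deriv : forall j, deriv cst (pd j).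
Hypothesis pdz : forall j i, pd j (z i) = (i == j)%:R.
Hypothesis m_gt1 : (1 < m)%N.
Hypothesis p_neq0 : m.+1%:R != 0 :> K.

Local Notation mz := (mz cst z).
Local Notation dv := (dv z pd).
Local Notation dvg := (dvg z pd).
Local Notation zeta := (zeta z).
Local Notation Mp := 'M[K]_m.+1.
Local Notation mz_inj := (mz_inj pd_deriv pdz).
Local Notation constant_column := (constant_column pd_deriv pdz m_gt1).
Local Notation dv_inj := (dv_inj pd_deriv pdz (p_neq0' cst p_neq0)).

(* The condition says that [s (z j) = (a zeta)_j / (a zeta)_0]. *)
Definition represents (s : KK -> KK) (a : Mp) :=
  forall j, mz a j 0 = s (zeta j 0) * mz a 0 0.

(** The rows of [a'], each placed as first row of an otherwise zero matrix, satisfy the hypothesis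
    of [constant_column] for the frame [a]; the first entry of the resulting column is the
    scalar. *)
Lemma represents_uniq s a a' : a \in unitmx -> represents s a -> represents s a' ->
  exists c, a' = c *: a.
Proof.
move=> ua ra ra'; pose N j : Mp := \matrix_(r, t) (if r == 0 then a' j t else 0).
have mN j r : mz (N j) r 0 = if r == 0 then mz a' j 0 else 0.
  rewrite !mxE; case: eqP => [->|nr].
    by apply: eq_bigr => l _; rewrite !mxE.
  by rewrite big1 // => l _; rewrite !mxE (introF eqP nr) rmorph0 mul0r.
have [|w hw] := constant_column (N := N) ua.
  move=> j; apply/matrixP => r t; rewrite ord1 [LHS]mxE [RHS]mxE !mN.
  case: eqP => _; last by rewrite !mulr0.
  by rewrite (ra j) (ra' j) /=; ring.
exists (w 0 0); apply/matrixP => j t; have := congr1 (fun M : Mp => M 0 t) (hw j).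
by rewrite !mxE eqxx big_ord1 !mxE.
Qed.

Section Semilinear.
Variables (s t : {rmorphism KK -> KK}).
Hypotheses (sK : cancel s t) (tK : cancel t s).
Hypothesis s_cst : forall c, s (cst c) = cst c.
Hypothesis t_cst : forall c, t (cst c) = cst c.
Hypothesis s_reg : forall d, deriv cst d -> regder cst z d -> regder cst z (fun r => s (d (t r))).

Lemma deriv_conj d : deriv cst d -> deriv cst (fun r => s (d (t r))).
Proof.
move=> hd; split=> [x y|x y|c].
- by rewrite rmorphD (derivD hd) rmorphD.
- by rewrite rmorphM (derivM hd) rmorphD !rmorphM /= !tK.
- by rewrite t_cst (derivC hd) rmorph0.
Qed.

(** Conjugation of the induced field by s, whose inverse is t. The condition on the divergence fixes
    the multiple of zeta that the field does not see. *)
Definition transport (y y' : 'cV[KK]_m.+1) :=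
  (forall r, dv y' r = s (dv y (t r))) /\ dvg y' = s (dvg y).

Lemma transport_exists y : exists y', transport y y'.
Proof.
exact: (dv_surj z_gen pd_deriv pdz (p_neq0' cst p_neq0) (s (dvg y)) (deriv_conj (dv_deriv z pd_deriv y))).
Qed.

Lemma transport_uniq y y1 y2 : transport y y1 -> transport y y2 -> y1 = y2.
Proof.
by move=> [h1 g1] [h2 g2]; apply: dv_inj => [j|]; rewrite ?h1 ?h2 ?g1 ?g2.
Qed.

Lemma transportD y1 y2 y1' y2' : transport y1 y1' -> transport y2 y2' ->
  transport (y1 + y2) (y1' + y2').
Proof.
move=> [h1 g1] [h2 g2]; split => [r|]; first by rewrite !dvD h1 h2 [RHS]rmorphD.
by rewrite !(dvgD z pd_deriv) g1 g2 [RHS]rmorphD.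
Qed.

Lemma transportZ a y y' : transport y y' -> transport (a *: y) (s a *: y').
Proof.
move=> [h g]; split => [r|]; first by rewrite !dvZ h [RHS]rmorphM.
by rewrite !(dvgZ z pd_deriv) h g sK [RHS]rmorphD [X in _ = X + _]rmorphM.
Qed.

Lemma transport_zeta : transport zeta zeta.
Proof.
split => [r|]; first by rewrite !(dv_zeta z pd) rmorph0.
by rewrite (dvg_zeta z pd_deriv) rmorph_nat.
Qed.

Lemma transport_mz v : exists w, transport (mz v) (mz w).
Proof.
have [y hy] := transport_exists (mz v); case: (hy) => h g.
have [||w yE] := regular_vector_field z_free pd_deriv pdz m_gt1 p_neq0 (y := y) (c := \tr v).
- move=> x r c nx xr; rewrite h.
  exact: (s_reg (dv_deriv z pd_deriv (mz v)) (regder_mz z_free pd_deriv pdz v) nx xr).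
- by rewrite g (dvg_mz pd_deriv pdz) s_cst.
by exists w; rewrite -yE.
Qed.

(* Transporting the relations [zeta_j E_i0 zeta = E_ij zeta] along [s] yields [b]. *)
Lemma represented : exists b (th : Mp -> Mp), [/\ b \in unitmx, represents s b,
  forall v, transport (mz v) (mz (th v)) & forall v, b *m th v = v *m b].
Proof.
have [th hth] := functional_choice _ transport_mz.
have thD v w : th (v + w) = th v + th w.
  apply: mz_inj; apply: transport_uniq (hth _) _; rewrite !mzD.
  exact: transportD.
have thZ c v : th (c *: v) = c *: th v.
  apply: mz_inj; apply: transport_uniq (hth _) _; rewrite !mzZ -{2}(s_cst c).
  exact: transportZ.
have th0 : th 0 = 0 by rewrite -[X in th X](scale0r 0) thZ scale0r.
have th1 : th 1%:M = 1%:M.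
  by apply: mz_inj; apply: transport_uniq (hth _) _; rewrite mz1; apply: transport_zeta.
have thS (I : finType) (F : I -> Mp) : th (\sum_i F i) = \sum_i th (F i).
  exact: (big_morph th thD th0).
have rel i j : mz (th (delta_mx i j)) = s (zeta j 0) *: mz (th (delta_mx i ord0)).
  apply: transport_uniq (hth _) _.
  have -> : mz (delta_mx i j) = zeta j 0 *: mz (delta_mx i ord0).
    by rewrite !mz_delta zeta0 scale1r.
  exact: transportZ.
have sum1 : (1%:M : Mp) = \sum_i delta_mx i i.
  rewrite [LHS]matrix_sum_delta; apply: eq_bigr => i _.
  rewrite (bigD1 i) //= mxE eqxx scale1r big1 ?addr0 // => j nj.
  by rewrite mxE eq_sym (negbTE nj) scale0r.
have [i0 [a na]] : exists i a, mz (th (delta_mx i ord0)) a 0 != 0.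
  apply: NNPP => no; have z0 i : mz (th (delta_mx i ord0)) = 0.
    apply/matrixP => a c; rewrite ord1 [RHS]mxE; apply/eqP/negPn/negP => n.
    by apply: no; exists i, a.
  have : mz (th 1%:M) = 0.
    by rewrite sum1 thS mz_sum big1 // => i _; rewrite rel z0 scaler0.
  rewrite th1 mz1 => /matrixP /(_ ord0 0); rewrite zeta0 mxE => /eqP.
  by rewrite oner_eq0.
pose b : Mp := \matrix_(j, l) th (delta_mx i0 j) a l.
have mb j : mz b j 0 = mz (th (delta_mx i0 j)) a 0.
  by rewrite !mxE; apply: eq_bigr => l _; rewrite !mxE.
have rb : represents s b.
  by move=> j; rewrite !mb rel [LHS]mxE.
have ub : b \in unitmx.
  rewrite -row_free_unit -kermx_eq0; apply/rowV0P => c /sub_kermxP cb.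
  pose C : Mp := \matrix_(i, j) (if i == 0 then c 0 j else 0).
  have C0 : C = 0.
    apply: mz_inj; rewrite mz0; apply/matrixP => i d; rewrite ord1 [RHS]mxE.
    have [->|ni] := eqVneq i 0; last first.
      by rewrite mxE big1 // => l _; rewrite !mxE (negbTE ni) rmorph0 mul0r.
    apply: (fmorph_inj s); rewrite rmorph0 mxE rmorph_sum.
    apply: (mulIf na); rewrite mul0r mulr_suml.
    transitivity ((map_mx cst (c *m b) *m zeta) 0 0); last first.
      by rewrite cb map_mx0 mul0mx mxE.
    rewrite map_mxM -mulmxA [RHS]mxE; apply: eq_bigr => l _.
    have -> : map_mx cst C 0 l = cst (c 0 l) by rewrite !mxE eqxx.
    have -> : map_mx cst c 0 l = cst (c 0 l) by rewrite !mxE.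
    by rewrite rmorphM /= s_cst -mulrA -mb -(rb l).
  apply/rowP => j; have /matrixP /(_ 0 j) := C0.
  by rewrite !mxE eqxx.
exists b, th; split => //.
have cc i : exists w : 'cV_m.+1, forall j, th (delta_mx i j) = w *m row j b.
  apply: constant_column => // j; rewrite rel scalerA; congr (_ *: _).
  by rewrite (rb j) mulrC.
have [w hw] := functional_choice _ cc.
pose W := \sum_i w i *m delta_mx (0 : 'I_1) i.
have thE v : th v = W *m v *m b.
  rewrite {1}(matrix_sum_delta v) thS {2}(matrix_sum_delta v) mulmx_sumr mulmx_suml.
  apply: eq_bigr => i _; rewrite thS mulmx_sumr mulmx_suml.
  apply: eq_bigr => j _; rewrite thZ hw -scalemxAr -scalemxAl; congr (_ *: _).
  rewrite /W mulmx_suml (bigD1 i) //= -(mulmxA (w i)) mul_delta_mx big1 ?addr0.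
    by rewrite -mulmxA -rowE.
  by move=> l nl; rewrite -mulmxA mul_delta_mx_cond (negbTE nl) mulr0n mulmx0.
have Wb : b *m W = 1%:M.
  by apply: mulmx1C; rewrite -th1 thE mulmx1.
by move=> v; rewrite thE !mulmxA Wb mul1mx.
Qed.

Section Rational.
Variable K0 : KK -> Prop.
Hypothesis K0k : forall c, K0 (cst (iota c)).
Hypothesis K0D : forall a b, K0 a -> K0 b -> K0 (a + b).
Hypothesis K0M : forall a b, K0 a -> K0 b -> K0 (a * b).
Hypothesis disj : forall e, kfree iota e -> forall r : nat -> KK, (forall i, K0 (r i)) ->
  \sum_(i < size e) cst e`_i * r i = 0 -> forall i, (i < size e)%N -> r i = 0.
Variables (n : nat) (xi : 'I_n -> KK).
Hypothesis xi_gen : generates cst xi.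
Hypothesis xi_K0 : forall t, K0 (xi t).
Local Notation ratmx := (ratmx cst z pd K0).
Hypothesis ratM : forall v w, ratmx v -> ratmx w -> ratmx (v *m w).
Hypothesis rat_gen : forall v, exists N (c : 'I_N -> K) (a : 'I_N -> Mp),
  (forall i, ratmx (a i)) /\ v = \sum_i c i *: a i.
Hypotheses (K0s : forall r, K0 r -> K0 (s r)) (K0t : forall r, K0 r -> K0 (t r)).

(** Expand b over a k-free family. The intertwining relation b th(v) = v b splits into components
    for v in A, because [th] preserves A. A nonzero component a_i thus intertwines as well, so a_i
    times the inverse of b is central and a_i is a scalar multiple of b. *)
Lemma represented_rational : exists a, [/\ a \in unitmx, ratmx a & represents s a].
Proof.
have [b [th [ub rb tth bth]]] := represented.
have thE v : th v = invmx b *m v *m b by rewrite -mulmxA -bth mulKmx.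
have rth v : ratmx v -> ratmx (th v).
  move=> [h g]; have [h' g'] := tth v; split; last by rewrite g'; apply: K0s.
  by move=> r Kr; rewrite h'; apply: K0s; apply: h; apply: K0t.
have kf0 : kfree iota [::] by [].
have [e [fe he]] := ratspan_extend pd_deriv K0k K0D K0M rat_gen [:: b] kf0.
rewrite /= in fe he; have [|a [ra bE]] := he b; first by rewrite inE.
have comm0 i v : (i < size e)%N -> ratmx v -> a i *m th v = v *m a i.
  move=> lt rv; apply/eqP; rewrite -subr_eq0; apply/eqP.
  apply: (ratmx_disj pd_deriv pdz p_neq0 disj xi_gen xi_K0 fe
    (v := fun i => a i *m th v - v *m a i)) i lt => [i|].
    apply: (ratmxD pd_deriv K0D); first by apply: ratM => //; apply: rth.
    by apply: (ratmxN pd_deriv K0k K0D K0M); apply: ratM.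
  under eq_bigr => i _ do rewrite scalerBr scalemxAl scalemxAr.
  by rewrite sumrB -mulmx_suml -mulmx_sumr -bE bth subrr.
have comm i v : (i < size e)%N -> a i *m th v = v *m a i.
  move=> lt; have [N [c [w [rw ->]]]] := rat_gen v.
  rewrite thE mulmx_sumr !mulmx_suml mulmx_sumr; apply: eq_bigr => j _.
  rewrite -scalemxAr -!scalemxAl -scalemxAr; congr (_ *: _).
  by rewrite -comm0 // thE.
have [i lt na] : exists2 i, (i < size e)%N & a i != 0.
  apply: NNPP => no; have b0 : b = 0.
    rewrite bE big1 // => i _; have [->|ni] := eqVneq (a i) 0; first by rewrite scaler0.
    by case: no; exists i.
  by move: ub; rewrite b0 unitmxE det0 unitr0.
have [c aE] : exists c, a i = c *: b.
  pose X := a i *m invmx b; exists (X 0 0).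
  rewrite -mul_scalar_mx -(central_scalar (X := X)) ?mulmxKV // => v.
  rewrite /X [RHS]mulmxA -(comm i v lt) thE !mulmxA.
  by rewrite mulmxK.
have nc : c != 0 by apply: contraNneq na => c0; rewrite aE c0 scale0r.
exists (a i); split => //; first by rewrite aE unitmxZ ?unitfE.
by move=> j; rewrite aE mzZ !mxE -/(mz b) mulrCA; congr (_ * _); have := rb j; rewrite !mxE.
Qed.
End Rational.
End Semilinear.

(** The order of the product is opposite to that of the composite, which cancels the contravariance
    of pullback. *)
Lemma represents_comp (s1 s2 : {rmorphism KK -> KK}) a1 a2 :
  (forall c, s2 (cst c) = cst c) ->
  represents s1 a1 -> represents s2 a2 -> represents (s2 \o s1) (a1 *m a2).
Proof.
move=> s2c r1 r2.
have e j : mz (a1 *m a2) j 0 = s2 (mz a1 j 0) * mz a2 0 0.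
  rewrite mzM mxE [mz a1 j 0]mxE rmorph_sum mulr_suml; apply: eq_bigr => l _.
  have -> : map_mx cst a1 j l = cst (a1 j l) by rewrite mxE.
  by rewrite rmorphM /= s2c (r2 l) mulrA.
by move=> j; rewrite !e (r1 j) rmorphM /= mulrA.
Qed.

Lemma represents_id_scalar (s : {rmorphism KK -> KK}) c : c != 0 ->
  represents s c%:M -> forall j, s (z j) = z j.
Proof.
move=> nc rc j; have := rc (lift ord0 j).
rewrite -scalemx1 mzZ mz1 [LHS]mxE [X in _ = _ * X]mxE zeta0 zetaS mulr1 mulrC.
by move/mulIf => <- //; rewrite fmorph_eq0.
Qed.

End Automorphism.

(** * Points of projective space *)

Local Open Scope quotient_scope.

(** * The rational function field with its partial derivatives *)

Section RationalFunctions.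
Variables (K : closedFieldType) (m : nat).
Local Notation KK := {fraction {mpoly K[m]}}.

Definition ratcst : {rmorphism K -> KK} := (@tofrac {mpoly K[m]} \o @mpolyC m K)%FUN.
Definition ratvar (j : 'I_m) : KK := tofrac 'X_j.

Lemma mmap_ratvar A : mmap ratcst ratvar A = tofrac A.
Proof.
have e : mmap (@mpolyC m K) (fun i => 'X_i) A = A.
  rewrite [RHS]mpolyE; apply: eq_bigr => t _; by rewrite mmap1_id mul_mpolyC.
by rewrite -[in RHS]e (mmap_comp (@mpolyC m K) (@tofrac {mpoly K[m]})).
Qed.

Lemma ratvar_free A : mmap ratcst ratvar A = 0 -> A = 0.
Proof. by rewrite mmap_ratvar => /eqP; rewrite tofrac_eq0 => /eqP. Qed.

Lemma ratvar_gen : generates ratcst ratvar.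
Proof.
move=> r; suff [A [B [nB e]]] : exists A B : {mpoly K[m]}, B != 0 /\ r * tofrac B = tofrac A.
  by exists A, B; rewrite !mmap_ratvar tofrac_eq0.
elim/quotW: r => u.
exists (frac u).1, (frac u).2; split; first exact: denom_ratioP.
change (FracField.mul (\pi_(FracField.type _) u) (FracField.tofrac (frac u).2) = FracField.tofrac (frac u).1).
rewrite !piE; apply/eqmodP; rewrite /= FracField.equivfE !numden_Ratio ?mulf_neq0 ?oner_eq0 ?denom_ratioP //.
by rewrite !mulr1 mulrC.
Qed.

Lemma ratvar_deriv : exists pd : 'I_m -> KK -> KK,
  (forall j, deriv ratcst (pd j)) /\ forall j i, pd j (ratvar i) = (i == j)%:R.
Proof.
have h j : exists d, deriv ratcst d /\ forall i, d (ratvar i) = (i == j)%:R.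
  apply: (deriv_extend ratvar_gen) => q /ratvar_free ->.
  by apply: big1 => t _; rewrite mderiv0 rmorph0 mul0r.
have [pd hpd] := functional_choice _ h.
by exists pd; split => j; case: (hpd j).
Qed.
End RationalFunctions.

Local Close Scope quotient_scope.

(** * Points as lines, values of functions, generic properties *)

Section Points.
Variables (K : closedFieldType) (m : nat).
Definition ppt := {l : {vspace 'rV[K]_m.+1} | \dim l == 1%N}.
Definition vec (l : ppt) (j : 'I_m.+1) : K := vpick (val l) 0 j.

Lemma vec_nz l : nzpt (vec l).
Proof.
apply: NNPP => no; have : vpick (val l) = 0.
  apply/rowP => j; rewrite mxE; apply/eqP/negPn/negP => n; by apply: no; exists j.
move=> /eqP; rewrite vpick0 => /eqP l0; have := valP l.
by rewrite /= l0 dimv0.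
Qed.

Lemma mkpt x : nzpt x -> exists l c, c != 0 /\ forall j, vec l j = c * x j.
Proof.
move=> [j0 n0]; pose v := \row_j x j.
have nv : v != 0.
  by apply: contraNneq n0 => /rowP /(_ j0); rewrite !mxE => ->.
have dv1 : \dim <[v]>%VS == 1%N by rewrite dim_vline nv.
pose l : ppt := exist _ <[v]>%VS dv1; exists l.
have /vlineP [c cE] := memv_pick <[v]>%VS.
exists c; split.
  apply: contraNneq nv => c0; rewrite -memv0 -(eqP (_ : <[v]>%VS == 0%VS)) ?memv_line //.
  by rewrite -vpick0 cE c0 scale0r.
by move=> j; rewrite /vec /= cE !mxE.
Qed.

Lemma vec_inj l l' c : c != 0 -> (forall j, vec l j = c * vec l' j) -> l = l'.
Proof.
move=> nc h; have line (u : ppt) : val u = <[vpick (val u)]>%VS.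
  apply/esym/eqP; rewrite eqEdim -memvE memv_pick dim_vline vpick0.
  have := valP u => /= /eqP ->; case: eqP => // e.
  by have := valP u; rewrite /= e dimv0.
apply: val_inj; rewrite (line l) (line l').
have -> : vpick (val l) = c *: vpick (val l') by apply/rowP => j; rewrite mxE; apply: h.
apply/eqP; rewrite eqEdim -memvE memvZ ?memv_line // !dim_vline scaler_eq0 (negbTE nc) /=.
by [].
Qed.

Variables (KK : fieldType) (cst : {rmorphism K -> KK}) (z : 'I_m -> KK).
Local Notation pev := (mmap cst).
Hypothesis z_free : forall A, pev z A = 0 -> A = 0.
Hypothesis z_gen : generates cst z.

Definition Rl (l : ppt) := rloc cst z (vec l).

Lemma Rl_place l : exists i, vec l i != 0 /\
  (compat cst (pz z i) (pn (vec l) i) /\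
   forall r c, Rl l r c <-> loc cst (pz z i) (pn (vec l) i) r c).
Proof.
have [i ni] := vec_nz l; exists i; split => //; split; first exact: (pz_compat z_free).
move=> r c; split; first exact: (rlocP z_free).
exact: rlocI.
Qed.

Lemma Rl_uniq l r c c' : Rl l r c -> Rl l r c' -> c = c'.
Proof.
have [i [ni [co iffR]]] := Rl_place l.
by move=> /iffR h /iffR h'; apply: (loc_uniq co h h').
Qed.
Lemma Rl_cst l c : Rl l (cst c) c.
Proof. by have [i [ni [co iffR]]] := Rl_place l; apply/iffR; apply: loc_cst. Qed.
Lemma RlD l r c r' c' : Rl l r c -> Rl l r' c' -> Rl l (r + r') (c + c').
Proof.
have [i [ni [co iffR]]] := Rl_place l.
by move=> /iffR h /iffR h'; apply/iffR; apply: locD.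
Qed.
Lemma RlM l r c r' c' : Rl l r c -> Rl l r' c' -> Rl l (r * r') (c * c').
Proof.
have [i [ni [co iffR]]] := Rl_place l.
by move=> /iffR h /iffR h'; apply/iffR; apply: locM.
Qed.
Lemma RlB l r c r' c' : Rl l r c -> Rl l r' c' -> Rl l (r - r') (c - c').
Proof.
have [i [ni [co iffR]]] := Rl_place l.
by move=> /iffR h /iffR h'; apply/iffR; apply: locB.
Qed.
Lemma Rl_neq0 l r c : Rl l r c -> c != 0 -> r != 0.
Proof.
have [i [ni [co iffR]]] := Rl_place l.
by move=> /iffR h; apply: (loc_neq0 co).
Qed.
Lemma RlF l r c r' c' : Rl l r c -> Rl l r' c' -> c' != 0 -> Rl l (r / r') (c / c').
Proof.
have [i [ni [co iffR]]] := Rl_place l.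
by move=> /iffR h /iffR h' n; apply/iffR; apply: (locF co).
Qed.
Lemma Rl_pz l i j : vec l i != 0 -> Rl l (pz z i j) (pn (vec l) i j).
Proof. by move=> ni; exists i; split => //; apply: locX. Qed.
Lemma Rl_subst l n (eta : 'I_n -> KK) y (q : {mpoly K[n]}) :
  (forall t, Rl l (eta t) (y t)) -> Rl l (pev eta q) q.@[y].
Proof.
have [i [ni [co iffR]]] := Rl_place l => h.
by apply/iffR; apply: (loc_subst (y' := y)) => // t; apply/iffR.
Qed.
Lemma Rl_compat l n (eta : 'I_n -> KK) y :
  (forall t, Rl l (eta t) (y t)) -> compat cst eta y.
Proof.
have [i [ni [co iffR]]] := Rl_place l => h.
by apply: (compat_subst co) => t; apply/iffR.
Qed.
Lemma Rl_trans l n (eta : 'I_n -> KK) y r c :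
  (forall t, Rl l (eta t) (y t)) -> loc cst eta y r c -> Rl l r c.
Proof.
have [i [ni [co iffR]]] := Rl_place l => h hr.
by apply/iffR; apply: (loc_trans co) hr => t; apply/iffR.
Qed.

(** Values are unique, so equal ratios make the representatives proportional. The coordinate i of
    [l] cannot vanish, as a ratio and its inverse would then have values with product 0. *)
Lemma pt_eq l l' i : vec l' i != 0 -> (forall j, Rl l (pz z i j) (pn (vec l') i j)) -> l = l'.
Proof.
move=> ni h; have [j nj] := vec_nz l.
have n := zeta_neq0 z_free.
have nli : vec l i != 0.
  have := RlM (h j) (Rl_pz i nj); rewrite /pz mulrA divfK // divff // => h1.
  have /(Rl_uniq h1) : Rl l 1 1 by rewrite -{1}(rmorph1 cst); apply: Rl_cst.
  rewrite /pn mulrA => e; apply/eqP => e0; move/eqP: e.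
  by rewrite e0 mulr0 mul0r eq_sym oner_eq0.
apply: (@vec_inj _ _ (vec l i / vec l' i)); first by rewrite mulf_neq0 ?invr_neq0.
move=> t; have := Rl_uniq (Rl_pz t nli) (h t); rewrite /pn => e.
by rewrite -[LHS](divfK nli) e; ring.
Qed.

(* [gnr Q]: the property [Q] holds on a nonempty open set. *)
Definition gnr (Q : ppt -> Prop) := exists2 B : {mpoly K[m]}, B != 0 &
  forall l, vec l ord0 != 0 -> B.@[fun j => vec l (lift ord0 j) / vec l ord0] != 0 -> Q l.

Lemma gnr_mono Q Q' : (forall l, Q l -> Q' l) -> gnr Q -> gnr Q'.
Proof. by move=> h [B nB hB]; exists B => // l n0 nl; apply: h; apply: hB. Qed.

Lemma gnr_and Q Q' : gnr Q -> gnr Q' -> gnr (fun l => Q l /\ Q' l).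
Proof.
move=> [B nB hB] [B' nB' hB']; exists (B * B'); first by rewrite mulf_neq0.
move=> l n0; rewrite mevalM mulf_eq0 negb_or => /andP [n n'].
by split; [apply: hB | apply: hB'].
Qed.

Lemma gnr_ex Q : gnr Q -> exists l, Q l.
Proof.
move=> [B nB hB]; have [u nu] := mpoly_nonroot nB.
pose x i := if unlift ord0 i is Some j then u j else 1.
have [|l [c [nc lE]]] := @mkpt x.
  by exists ord0; rewrite /x unlift_none oner_neq0.
have l0 : vec l ord0 = c by rewrite lE /x unlift_none mulr1.
exists l; apply: hB; first by rewrite l0.
have e : (fun j => vec l (lift ord0 j) / vec l ord0) =1 u.
  by move=> j; rewrite l0 lE /x liftK mulrAC divff // mul1r.
by rewrite (meval_eq _ e).
Qed.

Lemma gnr_true Q : (forall l, Q l) -> gnr Q.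
Proof. by move=> h; exists 1 => [|l _ _]; [rewrite oner_neq0 | apply: h]. Qed.

Lemma gnr_vec i : gnr (fun l => vec l i != 0).
Proof.
case: (unliftP ord0 i) => [j|] ->; last by exists 1; rewrite ?oner_neq0.
exists 'X_j => [|l n0]; first by rewrite -msize_poly_eq0 msizeX.
by rewrite mevalXU => n; apply: contraNneq n => ->; rewrite mul0r.
Qed.

Lemma Rl_aff l : vec l ord0 != 0 -> forall j, Rl l (z j) (vec l (lift ord0 j) / vec l ord0).
Proof.
move=> n0 j; have := Rl_pz (lift ord0 j) n0.
by rewrite /pz zeta0 divr1 zetaS.
Qed.

Lemma gnr_val r : gnr (fun l => exists c, Rl l r c).
Proof.
have [A [B [nB rB]]] := z_gen r.
exists B; first by apply: contraNneq nB => ->; rewrite rmorph0.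
move=> l n0 nl; have -> : r = pev z A / pev z B by rewrite -rB mulfK.
by eexists; apply: RlF nl; apply: Rl_subst; apply: Rl_aff.
Qed.

Lemma gnr_val_neq0 r : r != 0 -> gnr (fun l => exists2 c, c != 0 & Rl l r c).
Proof.
move=> nr; have := gnr_and (gnr_val r) (gnr_val r^-1); apply: gnr_mono => l [[c hc] [d hd]].
exists c => //; have := RlM hc hd; rewrite mulfV // => h1.
have /(Rl_uniq h1) : Rl l 1 1 by rewrite -{1}(rmorph1 cst); apply: Rl_cst.
by move=> e; apply: contra_eqN e => /eqP ->; rewrite mul0r eq_sym oner_eq0.
Qed.

Lemma gnr_eq r r' : gnr (fun l => exists c, Rl l r c /\ Rl l r' c) -> r = r'.
Proof.
move=> h; apply/eqP; rewrite -subr_eq0; apply/negPn/negP => /gnr_val_neq0 h'.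
have [l [[c [hr hr']] [d nd hd]]] := gnr_ex (gnr_and h h').
by move/eqP: nd; apply; rewrite (Rl_uniq hd (RlB hr hr')) subrr.
Qed.

Lemma regder_pts d : (forall l r c, Rl l r c -> exists c', Rl l (d r) c') -> regder cst z d.
Proof.
move=> h x r c nx; have [l [a [na lE]]] := mkpt nx.
case: (nx) => i ni; have nl : vec l i != 0 by rewrite lE mulf_neq0.
have e : pn x i =1 pn (vec l) i.
  by move=> j; rewrite /pn !lE; field; rewrite na ni.
move=> /(rloc_eq z_free ni nl e) /h [c' hc']; exists c'.
by apply: (rloc_eq z_free nl ni) hc' => j; rewrite e.
Qed.

Lemma regder_Rl d l r c : regder cst z d -> Rl l r c -> exists c', Rl l (d r) c'.
Proof. by move=> h; apply: h; apply: vec_nz. Qed.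
End Points.

(** * Charts at the generic point *)

Lemma ev_idfun (K : closedFieldType) n (q : {mpoly K[n]}) (x : 'rV[K]_n) :
  ev (idfun : {rmorphism K -> K}) q x = q.@[fun t => x 0 t].
Proof.
rewrite /ev; congr (_.@[_]); apply/mpolyP => t; by rewrite mcoeff_map_mpoly.
Qed.

Section Geometry.
Variables (k : fieldType) (K : closedFieldType) (iota : {rmorphism k -> K}) (m : nat).
Variables (X : atlas K) (f : pt X -> ppt K m) (g : ppt K m -> pt X).
Hypothesis Xvar : is_variety iota X.
Hypothesis f_mor : @is_morphism K K idfun X (projective_space K m) f.
Hypothesis g_mor : @is_morphism K K idfun (projective_space K m) X g.
Hypotheses (fK : cancel f g) (gK : cancel g f).
Variables (KK : fieldType) (cst : {rmorphism K -> KK}) (z : 'I_m -> KK).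
Local Notation pev := (mmap cst).
Hypothesis z_free : forall A, pev z A = 0 -> A = 0.
Hypothesis z_gen : generates cst z.
Local Notation Rl := (Rl cst z).
Local Notation gnr := (@gnr K m).
Local Notation mi := (map_mpoly iota).

(* [cx i x] and [xi i] are the coordinates in chart [i] of the point [x] and of the generic
   point of [X]. *)
Definition cx i (x : pt X) : 'I_(chart_dim i) -> K := fun t => chart i x 0 t.
Arguments cx : clear implicits.

Lemma pchartE i (l : ppt K m) t :
  chart (a := projective_space K m) i l 0 t = pn (vec l) i (lift i t).
Proof. by rewrite /= !mxE mulrC. Qed.

Lemma Rl_quot l n (eta : 'I_n -> KK) y (a h : {mpoly K[n]}) :
  (forall t, Rl l (eta t) (y t)) -> h.@[y] != 0 ->
  Rl l (pev eta a / pev eta h) (a.@[y] / h.@[y]).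
Proof. by move=> hy nh; apply: (RlF z_free) => //; apply: (Rl_subst z_free). Qed.

Lemma gnr_nonzero n (eta : 'I_n -> KK) (y : ppt K m -> 'I_n -> K) h :
  gnr (fun l => forall t, Rl l (eta t) (y l t)) -> pev eta h != 0 ->
  gnr (fun l => h.@[y l] != 0).
Proof.
move=> hy /(gnr_val_neq0 z_free z_gen) hh.
apply: gnr_mono (gnr_and hy hh) => l [hl [c nc hc]].
by rewrite (Rl_uniq z_free (Rl_subst z_free h hl) hc).
Qed.

(** Regularity of [g] expresses some chart j as rational functions near f x, and the transition map
    leads from chart j to chart i. The same formulas hold wherever the two denominators do not
    vanish. *)
Lemma chart_coords_near i x : chart_dom i x -> exists xi : 'I_(chart_dim i) -> KK,
  (forall t, Rl (f x) (xi t) (cx i x t)) /\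
  gnr (fun l => chart_dom i (g l) /\ forall t, Rl l (xi t) (cx i (g l) t)).
Proof.
move=> dix; have [il [j [dil [a [h [nh hy]]]]]] := g_mor (f x).
pose eta (t : 'I_m) := pz z il (lift il t).
have etaR l : vec l il != 0 -> forall t, Rl l (eta t) (pn (vec l) il (lift il t)).
  by move=> n t; apply: Rl_pz.
pose Y (l : ppt K m) (t : 'I_m) := pn (vec l) il (lift il t).
have evY l (q : {mpoly K[m]}) : @ev K K idfun _ q (chart (a := projective_space K m) il l) = q.@[Y l].
  by rewrite ev_idfun; apply: meval_eq => t; rewrite pchartE.
have dil' : vec (f x) il != 0 by [].
have nh' : h.@[Y (f x)] != 0 by rewrite -evY.
have djx : chart_dom j x by have [] := hy _ dil nh; rewrite fK.
pose xj t := pev eta (a t) / pev eta h.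
have xjR l : vec l il != 0 -> h.@[Y l] != 0 ->
    chart_dom j (g l) /\ forall t, Rl l (xj t) (cx j (g l) t).
  move=> nl nhl; have [|dj e] := hy l nl; first by rewrite evY.
  split => // t; rewrite /cx e !evY; apply: Rl_quot => //; exact: etaR.
have [a' [h' [nh'' hy']]] := variety_glue Xvar djx dix.
pose xi t := pev xj (mi (a' t)) / pev xj (mi h').
have xiR l : vec l il != 0 -> h.@[Y l] != 0 -> (mi h').@[cx j (g l)] != 0 ->
    chart_dom i (g l) /\ forall t, Rl l (xi t) (cx i (g l) t).
  move=> nl nhl nhl'; have [dj hj] := xjR l nl nhl.
  have [di e] := hy' _ dj nhl'.
  by split => // t; rewrite /cx e; apply: Rl_quot.
exists xi; split.
  by move=> t; have [|_] := xiR _ dil' nh'; rewrite ?fK // => /(_ t); rewrite fK.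
have g1 : gnr (fun l => vec l il != 0) := gnr_vec K il.
have etaY : gnr (fun l => forall t, Rl l (eta t) (Y l t)).
  by apply: gnr_mono g1 => l nl t; apply: etaR.
have nh0 : pev eta h != 0 by apply: (Rl_neq0 z_free (Rl_subst z_free h (etaR _ dil'))).
have g2 := gnr_nonzero etaY nh0.
have g12 := gnr_and g1 g2.
have g3 : gnr (fun l => forall t, Rl l (xj t) (cx j (g l) t)).
  by apply: gnr_mono g12 => l [nl nhl]; have [] := xjR l nl nhl.
have nh1 : pev xj (mi h') != 0.
  have [_ hx] := xjR _ dil' nh'; rewrite fK in hx.
  exact: (Rl_neq0 z_free (Rl_subst z_free (mi h') hx)).
apply: gnr_mono (gnr_and g12 (gnr_nonzero g3 nh1)) => l [[nl nhl] nhl'].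
exact: xiR.
Qed.

(** The expressions found near two points agree generically, hence are equal, so one family serves
    the whole chart. *)
Lemma generic_chart_exists i : exists xi : 'I_(chart_dim i) -> KK,
  forall x, chart_dom i x -> forall t, Rl (f x) (xi t) (cx i x t).
Proof.
case: (classic (exists x, chart_dom i x)) => [[x0 d0]|no]; last first.
  by exists (fun=> 0) => x dx; case: no; exists x.
have [xi [hx gx]] := chart_coords_near d0; exists xi => x dx t.
have [xi' [hx' gx']] := chart_coords_near dx.
suff -> : xi t = xi' t by [].
apply: (gnr_eq z_free z_gen); apply: gnr_mono (gnr_and gx gx') => l [[_ h] [_ h']].
by exists (cx i (g l) t); split.
Qed.

Lemma gnr_dom i x : chart_dom i x -> gnr (fun l => chart_dom i (g l)).
Proof.
by move=> dx; have [xi [_ gx]] := chart_coords_near dx; apply: gnr_mono gx => l [].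
Qed.

Variable xi : forall i, 'I_(chart_dim (a := X) i) -> KK.
Arguments xi : clear implicits.
Hypothesis xiP : forall i x, chart_dom i x -> forall t, Rl (f x) (xi i t) (cx i x t).

Lemma xiPg i l : chart_dom i (g l) -> forall t, Rl l (xi i t) (cx i (g l) t).
Proof. by move=> /xiP; rewrite gK. Qed.

Lemma xi_compat i x : chart_dom i x -> compat cst (xi i) (cx i x).
Proof. by move=> /xiP h; apply: (Rl_compat z_free h). Qed.

Lemma xi_vanish i q : (forall x, chart_dom i x -> q.@[cx i x] = 0) ->
  (exists x, chart_dom i x) -> pev (xi i) q = 0.
Proof.
move=> h [x dx]; apply: (gnr_eq z_free z_gen); apply: gnr_mono (gnr_dom dx) => l dl.
exists 0; split; last by rewrite -(rmorph0 cst); apply: Rl_cst.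
by rewrite -(h _ dl); apply: (Rl_subst z_free); apply: xiPg.
Qed.

Lemma xi_quot i x (a h : {mpoly K[_]}) r (c : pt X -> K) :
  chart_dom i x -> h.@[cx i x] != 0 ->
  (forall y, chart_dom i y -> h.@[cx i y] != 0 -> Rl (f y) r (c y) /\ c y = a.@[cx i y] / h.@[cx i y]) ->
  r = pev (xi i) a / pev (xi i) h.
Proof.
move=> dx nh e; apply: (gnr_eq z_free z_gen).
have nh' : pev (xi i) h != 0 := pev_neq0 (xi_compat dx) nh.
have g1 := gnr_dom dx.
have g2 : gnr (fun l => h.@[cx i (g l)] != 0).
  by apply: gnr_nonzero nh'; apply: gnr_mono g1 => l dl; apply: xiPg.
apply: gnr_mono (gnr_and g1 g2) => l [dl nl]; exists (c (g l)).
have [h1 h2] := e _ dl nl; rewrite gK in h1; split => //.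
by rewrite h2; apply: Rl_quot => //; apply: xiPg.
Qed.

Lemma xi_glue i j x : chart_dom i x -> chart_dom j x ->
  exists (a : 'I_(chart_dim j) -> {mpoly k[chart_dim i]}) (h : {mpoly k[chart_dim i]}),
  [/\ (mi h).@[cx i x] != 0, forall t, xi j t = pev (xi i) (mi (a t)) / pev (xi i) (mi h)
    & forall t, cx j x t = (mi (a t)).@[cx i x] / (mi h).@[cx i x]].
Proof.
move=> di dj; have [a [h [nh hy]]] := variety_glue Xvar di dj.
exists a, h; split => // t; last by have [_ e] := hy _ di nh; apply: e.
apply: (xi_quot (c := fun y => cx j y t) di nh) => y dy ny.
have [djy e] := hy _ dy ny; split; first exact: xiP.
exact: e.
Qed.

(** The projective coordinates are rational in some chart because [f] is a morphism; a transition
    map carries this to the given chart. *)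
Lemma Rl_chart i x r c : chart_dom i x -> Rl (f x) r c -> loc cst (xi i) (cx i x) r c.
Proof.
move=> di; have [i' [l [di' [a [h [nh hy]]]]]] := f_mor x.
have nh' : h.@[cx i' x] != 0 by rewrite -ev_idfun.
have [nl e0] := hy _ di' nh.
have hp t : pz z l (lift l t) = pev (xi i') (a t) / pev (xi i') h.
  apply: (xi_quot (c := fun y => pn (vec (f y)) l (lift l t)) di' nh') => y dy ny.
  have [|nly e] := hy _ dy; first by rewrite ev_idfun.
  split; first exact: Rl_pz.
  by have := e t; rewrite pchartE !ev_idfun.
have hpl j : loc cst (xi i') (cx i' x) (pz z l j) (pn (vec (f x)) l j).
  case: (unliftP l j) => [t|] ->.
    rewrite hp; have := e0 t; rewrite pchartE !ev_idfun => ->.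
    by apply: (locF (xi_compat di')) => //; apply: loc_pev.
  rewrite /pz /pn !divff ?(zeta_neq0 z_free) // -(rmorph1 cst).
  exact: loc_cst.
move=> /(rlocP z_free nl) /(loc_trans (xi_compat di') hpl).
apply: (loc_trans (xi_compat di)) => t.
have [a' [h' [nh2 -> ->]]] := xi_glue di di'.
by apply: (locF (xi_compat di)) => //; apply: loc_pev.
Qed.

Lemma xi_generates i : (exists x, chart_dom i x) -> generates cst (xi i).
Proof.
move=> [x dx] r; have [l [[c hr] dl]] := gnr_ex (gnr_and (gnr_val z_free z_gen r) (gnr_dom dx)).
have [|A [B [nB rB _]]] := @Rl_chart i (g l) r c dl; first by rewrite gK.
by exists A, B; split => //; exact: (pev_neq0 (xi_compat dl) nB).
Qed.

(** Polynomials vanishing on the chart kill [xi], so a specialization satisfies all equations of the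
    image, which is closed. *)
Lemma compat_chart i y : (exists x, chart_dom i x) -> compat cst (xi i) y ->
  exists2 x, chart_dom i x & forall t, cx i x t = y t.
Proof.
move=> ne co; have [zc _] := variety_affine Xvar i.
have [|x [dx e]] := zc (\row_t y t).
  move=> q hq; rewrite /ev (meval_eq (v2 := y)) => [|t]; last by rewrite mxE.
  by apply: co; apply: xi_vanish => // x dx; apply: hq; exists x.
by exists x => // t; rewrite /cx e mxE.
Qed.

Lemma chart_global i r : (exists x, chart_dom i x) ->
  (forall x, chart_dom i x -> exists c, Rl (f x) r c) -> exists A, r = pev (xi i) A.
Proof.
move=> ne h; apply: loc_global => y /(compat_chart ne) [x dx e].
have [c /(Rl_chart dx) [A [B [nB rB cB]]]] := h x dx; exists c, A, B.
by rewrite !(meval_eq _ (fun t => esym (e t))).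
Qed.

(* The function field over [k]; it does not depend on the chart. *)
Definition krat i r := exists a b : {mpoly k[chart_dim i]},
  pev (xi i) (mi b) != 0 /\ r * pev (xi i) (mi b) = pev (xi i) (mi a).
Arguments krat : clear implicits.

Lemma krat_pev i q : krat i (pev (xi i) (mi q)).
Proof. by exists q, 1; rewrite !rmorph1 mulr1 oner_neq0. Qed.
Lemma kratC i c : krat i (cst (iota c)).
Proof. by have := @krat_pev i c%:MP; rewrite map_mpolyC mmapC. Qed.
Lemma krat_xi i t : krat i (xi i t).
Proof. by have := @krat_pev i 'X_t; rewrite map_mpolyX mmapXU. Qed.
Lemma kratD i r r' : krat i r -> krat i r' -> krat i (r + r').
Proof.
move=> [a [b [nb e]]] [a' [b' [nb' e']]]; exists (a * b' + a' * b), (b * b').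
by rewrite !rmorphD !rmorphM /= -e -e' mulf_neq0 //; split => //; ring.
Qed.
Lemma kratM i r r' : krat i r -> krat i r' -> krat i (r * r').
Proof.
move=> [a [b [nb e]]] [a' [b' [nb' e']]]; exists (a * a'), (b * b').
by rewrite !rmorphM /= -e -e' mulf_neq0 //; split => //; ring.
Qed.
Lemma kratV i r : krat i r -> krat i r^-1.
Proof.
move=> [a [b [nb e]]]; have [->|nr] := eqVneq r 0.
  by rewrite invr0 -(rmorph0 cst) -(rmorph0 iota); apply: kratC.
by exists b, a; rewrite -e mulf_neq0 // mulrA mulVf // mul1r.
Qed.
Lemma krat_subst i n (eta : 'I_n -> KK) q : (forall t, krat i (eta t)) -> krat i (pev eta (mi q)).
Proof.
move=> h; elim/mpoly_ring_ind: q => [c|t|p q hp hq|p q hp hq].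
- by rewrite map_mpolyC mmapC; apply: kratC.
- by rewrite map_mpolyX mmapXU; apply: h.
- by rewrite !rmorphD; apply: kratD.
- by rewrite !rmorphM; apply: kratM.
Qed.

Lemma krat_chart i j r : (exists x, chart_dom i x) -> (exists x, chart_dom j x) ->
  krat i r -> krat j r.
Proof.
move=> [x dx] [y dy] [a [b [nb e]]].
have [l [di dj]] := gnr_ex (gnr_and (gnr_dom dx) (gnr_dom dy)).
have [a' [h' [_ ei _]]] := xi_glue dj di.
have hx t : krat j (xi i t).
  by rewrite ei; apply: kratM; [|apply: kratV]; apply: krat_pev.
have -> : r = pev (xi i) (mi a) / pev (xi i) (mi b) by rewrite -e mulfK.
by apply: kratM; [|apply: kratV]; apply: krat_subst.
Qed.

Lemma pspan_free n e (p : nat -> {mpoly k[n]}) : kfree iota e ->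
  \sum_(j < size e) e`_j *: mi (p j) = 0 -> forall j, (j < size e)%N -> p j = 0.
Proof.
move=> fe e0 j lt; apply/mpolyP => t; rewrite mcoeff0.
apply: (fe (fun j => (p j)@_t)) => //; have := congr1 (mcoeff t) e0.
rewrite mcoeff0 raddf_sum => h; rewrite -[RHS]h; apply: eq_bigr => i _ /=.
by rewrite mcoeffZ mcoeff_map_mpoly mulrC.
Qed.

(* Linear disjointness of [K] and the function field over [k]. *)
Lemma krat_disj i : (exists x, chart_dom i x) -> forall e, kfree iota e ->
  forall r : nat -> KK, (forall j, krat i (r j)) ->
  \sum_(j < size e) cst e`_j * r j = 0 -> forall j, (j < size e)%N -> r j = 0.
Proof.
move=> ne e fe r kr s0.
have h j : exists u : {mpoly k[chart_dim i]} * {mpoly k[chart_dim i]},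
    pev (xi i) (mi u.2) != 0 /\ r j * pev (xi i) (mi u.2) = pev (xi i) (mi u.1).
  by have [a [b [nb eb]]] := kr j; exists (a, b).
have [u hu] := functional_choice _ h.
pose D := \prod_(j < size e) (u j).2.
have nD : pev (xi i) (mi D) != 0.
  by rewrite !rmorph_prod; apply/prodf_neq0 => j _; case: (hu j).
pose a (j : nat) : {mpoly k[chart_dim i]} :=
  if insub j is Some j' then (u j).1 * \prod_(l < size e | l != j') (u l).2 else 0.
have ra (j : 'I_(size e)) : r j * pev (xi i) (mi D) = pev (xi i) (mi (a j)).
  rewrite /a valK /D (bigD1 j) //= !rmorphM /= mulrA; congr (_ * _).
  by case: (hu j).
suff a0 : forall j, (j < size e)%N -> pev (xi i) (mi (a j)) = 0.
  move=> j lt; have := ra (Ordinal lt); rewrite /= a0 // => /eqP.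
  by rewrite mulf_eq0 (negbTE nD) orbF => /eqP.
pose q := \sum_(j < size e) e`_j *: mi (a j).
have q0 : pev (xi i) q = 0.
  transitivity ((\sum_(j < size e) cst e`_j * r j) * pev (xi i) (mi D)); last by rewrite s0 mul0r.
  rewrite rmorph_sum mulr_suml.
  by apply: eq_bigr => j _ /=; rewrite mmapZ -mulrA ra.
(* Geometric reducedness enters here: q, vanishing on the chart, is a combination of polynomials
   over k that vanish there. *)
have [_ gen] := variety_affine Xvar i.
have [|s [svan qE]] := gen q.
  by move=> v [x [dx <-]]; apply: (xi_compat dx).
have sv u' : u' \in s -> pev (xi i) (mi u'.2) = 0.
  move=> us; apply: xi_vanish => // x dx; apply: (svan _ us); by exists x.
have [e' [fe' he']] := pspan_extend [seq existT _ _ u'.1 | u' <- s] fe.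
have hw (u' : {mpoly K[chart_dim i]} * {mpoly k[chart_dim i]}) : exists w : nat -> {mpoly k[chart_dim i]},
    u' \in s -> u'.1 = \sum_(j < size (e ++ e')) (e ++ e')`_j *: mi (w j).
  case: (boolP (u' \in s)) => [us|_]; last by exists (fun=> 0).
  have [|w wE] := he' _ u'.1; last by exists w.
  clear -us; elim: s us => //= v s IH; rewrite inE => /orP [/eqP ->|/IH]; by [left|right].
have [w hw'] := functional_choice _ hw.
pose a' j := if (j < size e)%N then a j else 0.
(* After expanding the multipliers over an enlargement of [e], comparison of coefficients writes
   each a_j as a combination, over k, of the vanishing polynomials. *)
have diff0 : \sum_(j < size (e ++ e')) (e ++ e')`_j *: mi (a' j - \sum_(u' <- s) w u' j * u'.2) = 0.
  under eq_bigr => j _ do rewrite rmorphB scalerBr.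
  rewrite sumrB.
  have -> : \sum_(j < size (e ++ e')) (e ++ e')`_j *: mi (a' j) = q.
    rewrite size_cat big_split_ord /= [X in _ + X]big1 ?addr0.
      by apply: eq_bigr => j _; rewrite nth_cat /a' ltn_ord.
    by move=> j _; rewrite /a' ltnNge leq_addr rmorph0 scaler0.
  rewrite qE; apply/eqP; rewrite subr_eq0; apply/eqP.
  under [RHS]eq_bigr => j _ do rewrite rmorph_sum scaler_sumr.
  rewrite exchange_big; apply: eq_big_seq => u' us /=.
  rewrite {1}(hw' _ us) mulr_suml; apply: eq_bigr => j _.
  by rewrite rmorphM scalerAl.
move=> j lt; have := pspan_free (p := fun j => a' j - \sum_(u' <- s) w u' j * u'.2) fe' diff0 (j := j).
rewrite size_cat (leq_trans lt) ?leq_addr // => /(_ isT) /eqP.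
rewrite subr_eq0 /a' lt => /eqP ->.
rewrite (rmorph_sum (map_mpoly iota)) (rmorph_sum (mmap cst (xi i))) big_seq big1 // => u' us.
by rewrite /= !rmorphM /= (sv _ us) mulr0.
Qed.

End Geometry.

Arguments cx {K X} i x t.
Arguments krat {k K} iota {X KK} cst xi i r.

(** * The k-form spans the matrix algebra *)

Lemma map_mpoly_deriv (k K : fieldType) (iota : {rmorphism k -> K}) n (q : {mpoly k[n]}) t :
  (map_mpoly iota q)^`M(t) = map_mpoly iota q^`M(t).
Proof.
apply/mpolyP => M; rewrite mcoeff_map_mpoly !mcoeff_mderiv mcoeff_map_mpoly.
by rewrite raddfMn.
Qed.

Section Form.
Variables (k : fieldType) (K : closedFieldType) (iota : {rmorphism k -> K}) (m : nat).
Variables (X : atlas K) (f : pt X -> ppt K m) (g : ppt K m -> pt X).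
Hypothesis Xvar : is_variety iota X.
Hypothesis f_mor : @is_morphism K K idfun X (projective_space K m) f.
Hypothesis g_mor : @is_morphism K K idfun (projective_space K m) X g.
Hypotheses (fK : cancel f g) (gK : cancel g f).
Variables (KK : fieldType) (cst : {rmorphism K -> KK}) (z : 'I_m -> KK).
Local Notation pev := (mmap cst).
Hypothesis z_free : forall A, pev z A = 0 -> A = 0.
Hypothesis z_gen : generates cst z.
Local Notation Rl := (Rl cst z).
Local Notation gnr := (@gnr K m).
Local Notation mi := (map_mpoly iota).
Variable xi : forall i, 'I_(chart_dim (a := X) i) -> KK.
Arguments xi : clear implicits.
Hypothesis xiP : forall i x, chart_dom i x -> forall t, Rl (f x) (xi i t) (cx i x t).
Variable i0 : 'I_(chart_num X).
Hypothesis ne0 : exists x, chart_dom i0 x.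
Local Notation K0 := (krat iota cst xi i0).

Variable pd : 'I_m -> KK -> KK.
Hypothesis pd_deriv : forall j, deriv cst (pd j).
Hypothesis pdz : forall j i, pd j (z i) = (i == j)%:R.
Hypothesis m_gt1 : (1 < m)%N.
Hypothesis p_neq0 : m.+1%:R != 0 :> K.
Local Notation mz := (mz cst z).
Local Notation dv := (dv z pd).
Local Notation dvg := (dvg z pd).

Let gen0 : generates cst (xi i0) := xi_generates Xvar f_mor g_mor fK gK z_free z_gen xiP ne0.
Let disj := krat_disj Xvar g_mor fK gK z_free z_gen xiP ne0.
Let K0C c : K0 (cst (iota c)) := @kratC _ _ _ _ _ _ xi i0 c.
Let K0D r r' : K0 r -> K0 r' -> K0 (r + r') := @kratD _ _ _ _ _ _ xi i0 r r'.
Let K0M r r' : K0 r -> K0 r' -> K0 (r * r') := @kratM _ _ _ _ _ _ xi i0 r r'.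
Let K0V r : K0 r -> K0 r^-1 := @kratV _ _ _ _ _ _ xi i0 r.
Let K0p q : K0 (pev (xi i0) (mi q)) := @krat_pev _ _ _ _ _ _ xi i0 q.
Let K0N r : K0 r -> K0 (- r).
Proof. by rewrite -mulN1r -(rmorphN1 cst) -(rmorphN1 iota); apply: K0M. Qed.
Let K0_0 : K0 0. Proof. by rewrite -(rmorph0 cst) -(rmorph0 iota). Qed.

Let deriv_K0 d : deriv cst d -> (forall t, K0 (d (xi i0 t))) -> forall r, K0 r -> K0 (d r).
Proof.
move=> hd h r [a [b [nb e]]].
have hp q : K0 (d (pev (xi i0) (mi q))).
  rewrite (deriv_pev hd); elim/big_ind: _ => // t _.
  by rewrite map_mpoly_deriv; apply: K0M.
have -> : r = pev (xi i0) (mi a) / pev (xi i0) (mi b) by rewrite -e mulfK.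
rewrite (deriv_div hd) //; apply: (K0M); last by apply: (K0V); apply: (K0M).
by apply: (K0D); [|apply: K0N]; apply: (K0M).
Qed.

(** In every chart the field of v has polynomial components. Expanding all of them, and the trace,
    over one k-free family splits the field into derivations defined over k; each is regular
    everywhere, hence comes from a matrix, and lies in A by construction. *)
Lemma rational_generation (v : 'M[K]_m.+1) :
  exists N (c : 'I_N -> K) (a : 'I_N -> 'M[K]_m.+1),
    (forall i, ratmx cst z pd K0 (a i)) /\ v = \sum_i c i *: a i.
Proof.
pose d := dv (mz v).
have hd : deriv cst d := dv_deriv z pd_deriv (mz v).
have dreg : regder cst z d := regder_mz z_free pd_deriv pdz v.
have hq i t : exists q, (exists x, chart_dom i x) -> d (xi i t) = pev (xi i) q.
  case: (classic (exists x, chart_dom i x)) => [ne|no]; last by exists 0.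
  have [|q e] := chart_global (r := d (xi i t)) Xvar f_mor g_mor fK gK z_free z_gen xiP ne; last by exists q.
  by move=> x dx; apply: (regder_Rl dreg (xiP dx t)).
pose q i t := proj1_sig (constructive_indefinite_description _ (hq i t)).
have qE i t : (exists x, chart_dom i x) -> d (xi i t) = pev (xi i) (q i t).
  exact: (proj2_sig (constructive_indefinite_description _ (hq i t))).
pose Li i := [seq existT (fun n => {mpoly K[n]}) _ (q i t) | t <- enum 'I_(chart_dim i)].
pose L := existT (fun n => {mpoly K[n]}) 0%N (\tr v)%:MP :: flatten [seq Li i | i <- enum 'I_(chart_num X)].
have kf0 : kfree iota [::] by [].
have [e [fe he]] := pspan_extend L kf0; rewrite /= in fe he.
(* The coordinates of the trace prescribe the divergences of the pieces. *)
have [s sE] : exists s : nat -> k, \tr v = \sum_(b < size e) e`_b * iota (s b).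
  have [|w wE] := he 0%N (\tr v)%:MP; first by left.
  exists (fun b => (w b)@_0); have := congr1 (mcoeff 0) wE.
  rewrite mcoeffC eqxx mulr1 raddf_sum => ->; apply: eq_bigr => b _ /=.
  by rewrite mcoeffZ mcoeff_map_mpoly.
have hqq i t : pspan iota e (q i t).
  apply: he; right; elim: (enum 'I_(chart_num X)) (mem_enum predT i) => //= j l IH.
  rewrite inE => /orP [/eqP <-|/IH h]; apply/List.in_or_app; [left|by right].
  rewrite /Li; elim: (enum 'I_(chart_dim i)) (mem_enum predT t) => //= t' l' IH'.
  by rewrite inE => /orP [/eqP <-|/IH' h]; [left|right].
pose qq i t := proj1_sig (constructive_indefinite_description _ (hqq i t)).
have qqE i t : q i t = \sum_(b < size e) e`_b *: mi (qq i t b).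
  exact: (proj2_sig (constructive_indefinite_description _ (hqq i t))).
have dE i t : (exists x, chart_dom i x) ->
    d (xi i t) = \sum_(b < size e) cst e`_b * pev (xi i) (mi (qq i t b)).
  move=> ne; rewrite qE // qqE rmorph_sum; apply: eq_bigr => b _ /=; by rewrite mmapZ.
(* A derivation with these values exists once they respect all relations between the coordinates:
   relations over k are handled by independence over K0, and a relation over K is split into
   relations over k. *)
have hdel b : exists del, deriv cst del /\ ((b < size e)%N ->
    forall t, del (xi i0 t) = pev (xi i0) (mi (qq i0 t b))).
  case: (ltnP b (size e)) => [lt|_]; last by exists (fun=> 0); split; first exact: deriv_zero.
  have relk Q : pev (xi i0) (mi Q) = 0 ->
      \sum_t pev (xi i0) (mi Q)^`M(t) * pev (xi i0) (mi (qq i0 t b)) = 0.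
    move=> Q0; apply: (disj fe (r := fun b => \sum_t pev (xi i0) (mi Q)^`M(t) * pev (xi i0) (mi (qq i0 t b)))) b lt.
      move=> j; elim/big_ind: _ => // t _.
      by rewrite map_mpoly_deriv; apply: (K0M).
    transitivity (d (pev (xi i0) (mi Q))); last by rewrite Q0 (deriv0 hd).
    rewrite (deriv_pev hd).
    under eq_bigr => j _ do rewrite mulr_sumr.
    rewrite exchange_big; apply: eq_bigr => t _ /=.
    by rewrite dE // mulr_sumr; apply: eq_bigr => j _; rewrite mulrCA.
  have [|del [h1 h2]] := deriv_extend (r := fun t => pev (xi i0) (mi (qq i0 t b))) gen0; last by exists del.
  move=> Q Q0; have [e1 [fe1 he1]] := pspan_family (fun _ : 'I_1 => Q) kf0.
  have [w wE] := he1 ord0; rewrite /= in fe1 wE.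
  have w0 j : (j < size e1)%N -> pev (xi i0) (mi (w j)) = 0.
    apply: (disj fe1 (r := fun j => pev (xi i0) (mi (w j)))) => //.
    by rewrite -[RHS]Q0 wE rmorph_sum; apply: eq_bigr => i _ /=; rewrite mmapZ.
  rewrite wE.
  transitivity (\sum_(j < size e1) cst e1`_j *
     \sum_t pev (xi i0) (mi (w j))^`M(t) * pev (xi i0) (mi (qq i0 t b))).
    under [RHS]eq_bigr => j _ do rewrite mulr_sumr.
    rewrite exchange_big; apply: eq_bigr => t _ /=.
    rewrite (raddf_sum (mderiv t)) (rmorph_sum (mmap cst (xi i0))) mulr_suml.
    by apply: eq_bigr => j _ /=; rewrite mderivZ mmapZ mulrA.
  by rewrite big1 // => j _; rewrite relk ?mulr0 // w0.
have [del hdel'] := functional_choice _ hdel.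
have ddel b : deriv cst (del b) by case: (hdel' b).
have delE b : (b < size e)%N -> forall t, del b (xi i0 t) = pev (xi i0) (mi (qq i0 t b)).
  by case: (hdel' b).
have delK0 b : (b < size e)%N -> forall r, K0 r -> K0 (del b r).
  by move=> lt; apply: (deriv_K0 (ddel b)) => t; rewrite delE.
have dsum : d =1 (fun r => \sum_(b < size e) cst e`_b * del b r).
  apply: (deriv_ext gen0 hd).
    by apply: deriv_big => b _; apply: deriv_scale.
  by move=> t; rewrite dE //; apply: eq_bigr => b _; rewrite delE.
(* The derivations were built in the chart [i0]; uniqueness of coordinates over [e] shows that they
   have the expected values in all charts. *)
have delxi i b t : (exists x, chart_dom i x) -> (b < size e)%N ->
    del b (xi i t) = pev (xi i) (mi (qq i t b)).
  move=> ne lt; have K0i r : krat iota cst xi i r -> K0 r.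
    exact: (krat_chart Xvar g_mor fK gK z_free z_gen xiP ne ne0).
  apply/eqP; rewrite -subr_eq0; apply/eqP.
  pose rr b := if (b < size e)%N then del b (xi i t) - pev (xi i) (mi (qq i t b)) else 0.
  suff h : rr b = 0 by move: h; rewrite /rr lt.
  apply: (disj fe (r := rr)) b lt.
    move=> j; rewrite /rr; case: ifP => // lt; apply: (K0D); first by apply: delK0 => //; apply: K0i; apply: krat_xi.
    by apply: K0N; apply: K0i; apply: krat_pev.
  rewrite /rr; under eq_bigr => j _ do rewrite ltn_ord mulrBr.
  by rewrite sumrB -dsum -dE // subrr.
(* In any chart the derivation maps polynomials in the coordinates to polynomials, so the quotient
   rule preserves local rings. *)
have delreg b : (b < size e)%N -> regder cst z (del b).
  move=> lt; apply: (regder_pts z_free) => l r c hr.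
  have [i di] := variety_cover Xvar (g l).
  have ne : exists x, chart_dom i x by exists (g l).
  have := Rl_chart (r := r) (c := c) Xvar f_mor g_mor fK gK z_free z_gen xiP di.
  rewrite gK => /(_ hr) [A [B [nB rB _]]].
  have xil : forall t, Rl l (xi i t) (cx i (g l) t).
    by move=> t; have := xiP di t; rewrite gK.
  have nB' := pev_neq0 (Rl_compat z_free xil) nB.
  have -> : r = pev (xi i) A / pev (xi i) B by rewrite -rB mulfK.
  have hdp Q : exists Q', del b (pev (xi i) Q) = pev (xi i) Q'.
    exists (\sum_t Q^`M(t) * mi (qq i t b)).
    rewrite (deriv_pev (ddel b)) rmorph_sum; apply: eq_bigr => t _.
    by rewrite rmorphM /= delxi.
  rewrite (deriv_div (ddel b)) //; have [A' ->] := hdp A; have [B' ->] := hdp B.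
  rewrite -!rmorphM -rmorphB -rmorphXn.
  eexists; apply: (Rl_quot z_free); first exact: xil.
  by rewrite rmorphXn expf_eq0.
have hy b : exists a : 'M[K]_m.+1, (b < size e)%N ->
    (forall r, dv (mz a) r = del b r) /\ dvg (mz a) = cst (iota (s b)).
  case: (ltnP b (size e)) => [lt|_]; last by exists 0.
  have [y [h1 h2]] := dv_surj z_gen pd_deriv pdz (p_neq0' cst p_neq0) (cst (iota (s b))) (ddel b).
  have [|a aE] := regular_vector_field z_free pd_deriv pdz m_gt1 p_neq0 (y := y) _ h2.
    by move=> x r c nx hr; rewrite h1; apply: (delreg b lt x r c nx hr).
  by exists a => _; rewrite -aE.
have [a ha] := functional_choice _ hy.
exists (size e), (fun b => e`_b), (fun b => a b); split.
  move=> b; have [h1 h2] := ha b (ltn_ord b); split; last by rewrite h2; apply: K0C.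
  by move=> r Kr; rewrite h1; apply: delK0.
apply: (mz_inj pd_deriv pdz); apply: (dv_inj pd_deriv pdz (p_neq0' cst p_neq0)).
  move=> j; rewrite mz_sum dv_sum; have := dsum (z j); rewrite /d => ->.
  by apply: eq_bigr => b _; rewrite mzZ dvZ; have [-> _] := ha b (ltn_ord b).
rewrite (dvg_mz pd_deriv pdz) mz_sum (dvg_sum z pd_deriv) sE rmorph_sum.
apply: eq_bigr => b _; rewrite mzZ (dvgCZ z pd_deriv).
by have [_ ->] := ha b (ltn_ord b); rewrite /= rmorphM.
Qed.

End Form.

(** * Pullback along automorphisms *)

Lemma rmorphism_of (R S : nzRingType) (s0 : R -> S) :
  (forall x y, s0 (x - y) = s0 x - s0 y) -> s0 1 = 1 ->
  (forall x y, s0 (x * y) = s0 x * s0 y) ->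
  exists s : {rmorphism R -> S}, s =1 s0.
Proof.
move=> hB h1 hM.
pose a := GRing.isZmodMorphism.Build R S s0 hB.
pose b := GRing.isMonoidMorphism.Build R S s0 (h1, hM).
pose s : {rmorphism R -> S} := HB.pack s0 a b.
by exists s.
Qed.

Section Pullback.
Variables (k : fieldType) (K : closedFieldType) (iota : {rmorphism k -> K}) (m : nat).
Variables (X : atlas K) (f : pt X -> ppt K m) (g : ppt K m -> pt X).
Hypothesis Xvar : is_variety iota X.
Hypothesis f_mor : @is_morphism K K idfun X (projective_space K m) f.
Hypothesis g_mor : @is_morphism K K idfun (projective_space K m) X g.
Hypotheses (fK : cancel f g) (gK : cancel g f).
Variables (KK : fieldType) (cst : {rmorphism K -> KK}) (z : 'I_m -> KK).
Local Notation pev := (mmap cst).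
Hypothesis z_free : forall A, pev z A = 0 -> A = 0.
Hypothesis z_gen : generates cst z.
Local Notation Rl := (Rl cst z).
Local Notation gnr := (@gnr K m).
Local Notation mi := (map_mpoly iota).
Variable xi : forall i, 'I_(chart_dim (a := X) i) -> KK.
Arguments xi : clear implicits.
Hypothesis xiP : forall i x, chart_dom i x -> forall t, Rl (f x) (xi i t) (cx i x t).
Local Notation krat := (krat iota cst xi).

Let xiPg i l : chart_dom i (g l) -> forall t, Rl l (xi i t) (cx i (g l) t).
Proof. by move=> /xiP; rewrite gK. Qed.
Let gnr_dom' i x : chart_dom i x -> gnr (fun l => chart_dom i (g l)).
Proof. exact: (gnr_dom Xvar g_mor fK z_free z_gen). Qed.

Section OneMap.
Variables (phi phi' : pt X -> pt X).
Hypothesis phi_mor : is_morphism iota phi.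
Hypotheses (phiK : cancel phi phi') (phi'K : cancel phi' phi).
Definition pmap (l : ppt K m) : ppt K m := f (phi (g l)).

(* On an open set, [r'] is the composite of [r] with the map [phi]. *)
Definition pulls r r' := gnr (fun l => exists c, Rl (pmap l) r c /\ Rl l r' c).

Lemma pulls_uniq r r1 r2 : pulls r r1 -> pulls r r2 -> r1 = r2.
Proof.
move=> h1 h2; apply: (gnr_eq z_free z_gen).
apply: gnr_mono (gnr_and h1 h2) => l [[c [hc h1']] [c' [hc' h2']]].
by exists c; split => //; rewrite (Rl_uniq z_free hc hc').
Qed.

Lemma pull_coords l : exists i1 i2 (eta : 'I_(chart_dim i2) -> KK),
  [/\ chart_dom i1 (g l), chart_dom i2 (phi (g l)),
      forall t, Rl l (eta t) (cx i2 (phi (g l)) t),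
      gnr (fun l' => chart_dom i2 (phi (g l')) /\ forall t, Rl l' (eta t) (cx i2 (phi (g l')) t))
    & forall t, krat i1 (eta t)].
Proof.
have [i1 [i2 [d1 [a [h [nh hy]]]]]] := phi_mor (g l).
pose eta t := pev (xi i1) (mi (a t)) / pev (xi i1) (mi h).
have hR l' : chart_dom i1 (g l') -> (mi h).@[cx i1 (g l')] != 0 ->
    chart_dom i2 (phi (g l')) /\ forall t, Rl l' (eta t) (cx i2 (phi (g l')) t).
  move=> d1' nh'; have [d2 e] := hy _ d1' nh'; split => // t.
  by rewrite /cx e; apply: (Rl_quot z_free); first exact: xiPg.
have [d2 h0] := hR l d1 nh.
exists i1, i2, eta; split => //; last first.
  by move=> t; apply: kratM; [|apply: kratV]; apply: krat_pev.
have g1 := gnr_dom' d1.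
have nh' : pev (xi i1) (mi h) != 0.
  exact: (pev_neq0 (Rl_compat z_free (xiPg d1)) nh).
have g2 : gnr (fun l' => (mi h).@[cx i1 (g l')] != 0).
  by apply: (gnr_nonzero z_free z_gen) nh'; apply: gnr_mono g1 => l' dl; apply: xiPg.
by apply: gnr_mono (gnr_and g1 g2) => l' [d n]; apply: hR.
Qed.

Lemma pull_local l r c : Rl (pmap l) r c -> exists r', Rl l r' c /\ pulls r r'.
Proof.
have [i1 [i2 [eta [d1 d2 hl hg _]]]] := pull_coords l.
move=> /(Rl_chart Xvar f_mor g_mor fK gK z_free z_gen xiP d2) [A [B [nB rB cB]]].
have neB : pev eta B != 0 := pev_neq0 (Rl_compat z_free hl) nB.
exists (pev eta A / pev eta B); split.
  have -> : c = A.@[cx i2 (phi (g l))] / B.@[cx i2 (phi (g l))] by rewrite -cB mulfK.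
  exact: (Rl_quot z_free).
have g2 : gnr (fun l' => B.@[cx i2 (phi (g l'))] != 0).
  by apply: (gnr_nonzero z_free z_gen) neB; apply: gnr_mono hg => l' [].
have nxB : pev (xi i2) B != 0.
  exact: (pev_neq0 (Rl_compat z_free (xiP d2)) nB).
have -> : r = pev (xi i2) A / pev (xi i2) B by rewrite -rB mulfK.
apply: gnr_mono (gnr_and hg g2) => l' [[d h] n].
exists (A.@[cx i2 (phi (g l'))] / B.@[cx i2 (phi (g l'))]).
by split; apply: (Rl_quot z_free) => //; apply: xiP.
Qed.

Let pmap' l := f (phi' (g l)).
Let pmap'K l : pmap (pmap' l) = l.
Proof. by rewrite /pmap /pmap' fK phi'K gK. Qed.

Lemma pull_exists r : exists r', pulls r r'.
Proof.
have [l [c hc]] := gnr_ex (gnr_val z_free z_gen r).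
have [|r' [_ h]] := @pull_local (pmap' l) r c; first by rewrite pmap'K.
by exists r'.
Qed.

Lemma pulls_Rl l r r' c : pulls r r' -> Rl (pmap l) r c -> Rl l r' c.
Proof. by move=> h /pull_local [r1 [h1 /(pulls_uniq h) ->]]. Qed.

Lemma affine_pt l : (forall j, exists c, Rl l (z j) c) -> vec l ord0 != 0.
Proof.
move=> h; have [i ni] := vec_nz l.
case: (unliftP ord0 i) ni => [j|] -> // nj.
have [c hc] := h j; have := Rl_pz cst z ord0 nj.
move=> /(RlM z_free hc); rewrite /pz zeta0 zetaS div1r mulfV ?(z_neq0 z_free) // => h1.
have /(Rl_uniq z_free h1) : Rl l 1 1 by rewrite -{1}(rmorph1 cst); apply: Rl_cst.
move=> e; apply/eqP => e0; move/eqP: e.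
by rewrite /pn e0 mul0r mulr0 eq_sym oner_eq0.
Qed.

(** The equation of the open set is pulled back. The result is nonzero because it takes a nonzero
    value at a preimage, which exists as [pmap] is onto; one must also stay where the image lies in
    the affine chart. *)
Lemma gnr_pmap Q : gnr Q -> gnr (fun l => Q (pmap l)).
Proof.
move=> [B nB hB]; pose b := pev z B.
have nb : b != 0 by apply: contraNneq nB => /z_free ->.
have hz : forall j, exists r', pulls (z j) r' by move=> j; apply: pull_exists.
have [b' hb'] := pull_exists b.
have nb' : b' != 0.
  have [l [c nc hc]] := gnr_ex (gnr_val_neq0 z_free z_gen nb).
  apply: (Rl_neq0 z_free (l := pmap' l) (c := c)) => //.
  by apply: (pulls_Rl hb'); rewrite pmap'K.
have gz : gnr (fun l => forall j, exists c, Rl (pmap l) (z j) c).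
  have hh (s : seq 'I_m) : gnr (fun l => forall j, j \in s -> exists c, Rl (pmap l) (z j) c).
    elim: s => [|j s IH]; first by apply: gnr_true.
    have [r' hr'] := hz j.
    apply: gnr_mono (gnr_and hr' IH) => l [[c [hc _]] h] j'.
    by rewrite inE => /orP [/eqP ->|/h //]; exists c.
  by apply: gnr_mono (hh (enum 'I_m)) => l h j; apply: h; rewrite mem_enum.
apply: gnr_mono (gnr_and gz (gnr_and hb' (gnr_val_neq0 z_free z_gen nb'))).
move=> l [/affine_pt n0 [[c [hc hc']] [d nd hd]]].
apply: hB => //.
have -> : B.@[fun j => vec (pmap l) (lift ord0 j) / vec (pmap l) ord0] = d.
  rewrite (Rl_uniq z_free hd hc').
  by apply: (Rl_uniq z_free _ hc); apply: (Rl_subst z_free); apply: Rl_aff.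
by [].
Qed.

Lemma pulls_cst c : pulls (cst c) (cst c).
Proof. by apply: gnr_true => l; exists c; split; apply: (Rl_cst z_free). Qed.

Lemma pulls_krat i r r' : (exists x, chart_dom i x) -> krat i r -> pulls r r' -> krat i r'.
Proof.
move=> ne kr hr; have [l _] := gnr_ex (gnr_true (Q := fun _ : ppt K m => True) (fun _ => I)).
have [i1 [i2 [eta [d1 d2 hl hg hk]]]] := pull_coords l.
have ne1 : exists x, chart_dom i1 x by exists (g l).
have ne2 : exists x, chart_dom i2 x by exists (phi (g l)).
have [a [b [nb e]]] := krat_chart Xvar g_mor fK gK z_free z_gen xiP ne ne2 kr.
have gb : gnr (fun l' => (mi b).@[cx i2 (g l')] != 0).
  by apply: (gnr_nonzero z_free z_gen) nb; apply: gnr_mono (gnr_dom' d2) => l' dl; apply: xiPg.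
have gb' := gnr_pmap gb.
have h : pulls r (pev eta (mi a) / pev eta (mi b)).
  apply: gnr_mono (gnr_and hg gb') => l' [[d h]]; rewrite /pmap fK => n.
  exists ((mi a).@[cx i2 (phi (g l'))] / (mi b).@[cx i2 (phi (g l'))]); split.
    have -> : r = pev (xi i2) (mi a) / pev (xi i2) (mi b) by rewrite -e mulfK.
    by apply: (Rl_quot z_free) => //; apply: xiP.
  exact: (Rl_quot z_free).
rewrite (pulls_uniq hr h).
apply: (krat_chart Xvar g_mor fK gK z_free z_gen xiP ne1 ne).
by apply: kratM; [|apply: kratV]; apply: krat_subst.
Qed.

Lemma pullback_exists : exists s : {rmorphism KK -> KK}, forall r, pulls r (s r).
Proof.
have [s0 h0] := functional_choice _ pull_exists.
have [| | |s sE] := @rmorphism_of KK KK s0.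
- move=> x y; apply: pulls_uniq (h0 _) _.
  apply: gnr_mono (gnr_and (h0 x) (h0 y)) => l [[c [h1 h2]] [c' [h1' h2']]].
  by exists (c - c'); split; apply: (RlB z_free).
- by apply: pulls_uniq (h0 _) _; rewrite -(rmorph1 cst); apply: pulls_cst.
- move=> x y; apply: pulls_uniq (h0 _) _.
  apply: gnr_mono (gnr_and (h0 x) (h0 y)) => l [[c [h1 h2]] [c' [h1' h2']]].
  by exists (c * c'); split; apply: (RlM z_free).
by exists s => r; rewrite sE; apply: h0.
Qed.

End OneMap.

Lemma pulls_comp phi1 phi2 r r1 r2 r12 :
  is_morphism iota phi2 -> (exists phi2', cancel phi2 phi2' /\ cancel phi2' phi2) ->
  pulls phi1 r r1 -> pulls phi2 r1 r2 -> pulls (phi1 \o phi2) r r12 -> r12 = r2.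
Proof.
move=> mor2 [phi2' [K2 K2']] h1 h2 h12; apply: (gnr_eq z_free z_gen).
have h1' := gnr_pmap mor2 K2' h1.
apply: gnr_mono (gnr_and h1' (gnr_and h2 h12)) => l.
rewrite /pmap /= => [] [[c [hc hc']] [[d [hd hd']] [e [he he']]]].
rewrite fK in hc; exists e; split => //.
by rewrite (Rl_uniq z_free he hc) (Rl_uniq z_free hc' hd).
Qed.

Lemma pulls_id r : pulls id r r.
Proof.
apply: gnr_mono (gnr_val z_free z_gen r) => l [c hc]; exists c; split => //.
by rewrite /pmap gK.
Qed.

(** Fixing constants and the z_j, the pullback is the identity of KK, so a point and its image give
    every function the same value and [pt_eq] applies. *)
Lemma pulls_faithful phi : is_morphism iota phi ->
  (exists phi', cancel phi phi' /\ cancel phi' phi) ->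
  (forall j, pulls phi (z j) (z j)) -> forall x, phi x = x.
Proof.
move=> mor [phi' [K1 K2]] h x.
have [s hs] := pullback_exists mor K2.
have sc c : s (cst c) = cst c by apply: pulls_uniq (hs _) (pulls_cst _ _).
have sz j : s (z j) = z j by apply: pulls_uniq (hs _) (h j).
have se r : s r = r.
  have [A [B [nB e]]] := z_gen r.
  have sp q : s (pev z q) = pev z q.
    rewrite mmap_comp; apply: mmap_eq => [c|j] /=; [exact: sc | exact: sz].
  have -> : r = pev z A / pev z B by rewrite -e mulfK.
  by rewrite fmorph_div !sp.
pose l := f x; have pl : pmap phi l = f (phi x) by rewrite /pmap /l fK.
suff e : l = pmap phi l by rewrite -[phi x]fK -pl -e /l fK.
have [i ni] := vec_nz (pmap phi l).
apply: (pt_eq z_free ni) => j; rewrite -[pz z i j]se.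
by apply: (pulls_Rl mor (hs _)); apply: Rl_pz.
Qed.

Lemma pulls_regder phi phi' (s t : {rmorphism KK -> KK}) :
  is_morphism iota phi -> is_morphism iota phi' -> cancel phi phi' -> cancel phi' phi ->
  (forall r, pulls phi r (s r)) -> (forall r, pulls phi' r (t r)) ->
  forall d, regder cst z d -> regder cst z (fun r => s (d (t r))).
Proof.
move=> mor mor' K1 K2 hs ht d hd; apply: (regder_pts z_free) => l r c hr.
have h1 : Rl (pmap phi l) (t r) c.
  by apply: (pulls_Rl mor' (ht r)); rewrite /pmap fK K1 gK.
have [c' h2] := regder_Rl hd h1; exists c'.
exact: (pulls_Rl mor (hs _)).
Qed.

End Pullback.

(** * Triviality from a rational frame *)

Section Collineation.
Variables (K : closedFieldType) (m : nat).
Implicit Types (l : ppt K m) (M : 'M[K]_m.+1).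

Definition mxpt M l (j : 'I_m.+1) : K := \sum_t M j t * vec l t.

Lemma mxpt_nz M l : M \in unitmx -> nzpt (mxpt M l).
Proof.
move=> uM; apply: NNPP => no; have [i ni] := vec_nz l.
have c0 : M *m (\col_t vec l t) = 0.
  apply/matrixP => j b; rewrite !mxE; apply/eqP/negPn/negP => n; apply: no; exists j.
  apply: contraNneq n => e; apply/eqP; rewrite -[RHS]e.
  by apply: eq_bigr => t _; rewrite mxE.
have : invmx M *m (M *m (\col_t vec l t)) = 0 by rewrite c0 mulmx0.
rewrite mulKmx // => /matrixP /(_ i 0); rewrite !mxE => e.
by rewrite e eqxx in ni.
Qed.

Lemma collineation_exists M : M \in unitmx -> exists L : ppt K m -> ppt K m,
  forall l, exists2 c, c != 0 & forall j, vec (L l) j = c * mxpt M l j.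
Proof.
move=> uM; apply: (functional_choice (fun l l' => exists2 c, c != 0 & forall j, vec l' j = c * mxpt M l j)).
by move=> l; have [l' [c [nc h]]] := mkpt (mxpt_nz l uM); exists l', c.
Qed.

Lemma collineationK M L L' : M \in unitmx ->
  (forall l, exists2 c, c != 0 & forall j, vec (L l) j = c * mxpt M l j) ->
  (forall l, exists2 c, c != 0 & forall j, vec (L' l) j = c * mxpt (invmx M) l j) ->
  cancel L L'.
Proof.
move=> uM hL hL' l; have [c nc h] := hL l; have [c' nc' h'] := hL' (L l).
apply: (@vec_inj _ _ _ _ (c' * c)); first by rewrite mulf_neq0.
move=> j; rewrite h' -mulrA; congr (_ * _).
rewrite /mxpt; under eq_bigr => t _ do rewrite h mulrCA mulr_sumr.
rewrite -mulr_sumr exchange_big /=; congr (_ * _).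
transitivity (\sum_s (invmx M *m M) j s * vec l s).
  apply: eq_bigr => s _; rewrite mxE mulr_suml; apply: eq_bigr => t _.
  by rewrite mulrA.
rewrite mulVmx // (bigD1 j) //= mxE eqxx mul1r big1 ?addr0 // => s ns.
by rewrite mxE eq_sym (negbTE ns) mul0r.
Qed.
End Collineation.

Section Trivialization.
Variables (k : fieldType) (K : closedFieldType) (iota : {rmorphism k -> K}) (m : nat).
Variables (X : atlas K) (f : pt X -> ppt K m) (g : ppt K m -> pt X).
Hypothesis Xvar : is_variety iota X.
Hypothesis f_mor : @is_morphism K K idfun X (projective_space K m) f.
Hypothesis g_mor : @is_morphism K K idfun (projective_space K m) X g.
Hypotheses (fK : cancel f g) (gK : cancel g f).
Variables (KK : fieldType) (cst : {rmorphism K -> KK}) (z : 'I_m -> KK).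
Local Notation pev := (mmap cst).
Hypothesis z_free : forall A, pev z A = 0 -> A = 0.
Hypothesis z_gen : generates cst z.
Local Notation Rl := (Rl cst z).
Local Notation mi := (map_mpoly iota).
Variable xi : forall i, 'I_(chart_dim (a := X) i) -> KK.
Arguments xi : clear implicits.
Hypothesis xiP : forall i x, chart_dom i x -> forall t, Rl (f x) (xi i t) (cx i x t).
Variable i0 : 'I_(chart_num X).
Hypothesis ne0 : exists x, chart_dom i0 x.
Local Notation K0 := (krat iota cst xi i0).

Let disj := krat_disj Xvar g_mor fK gK z_free z_gen xiP ne0.

(** A common denominator over K that is nonzero at [y] is expanded over a k-free family.
    Independence over K0 makes each coefficient a denominator over k, and at least one coefficient
    is nonzero at [y]. *)
Lemma K0_local n (eta : 'I_n -> KK) y N (r : 'I_N -> KK) (c : 'I_N -> K) :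
  (forall t, K0 (eta t)) -> compat cst eta y -> (forall j, K0 (r j)) ->
  (forall j, loc cst eta y (r j) (c j)) ->
  exists (a : 'I_N -> {mpoly k[n]}) (h : {mpoly k[n]}), (mi h).@[y] != 0 /\
    forall j, r j * pev eta (mi h) = pev eta (mi (a j)).
Proof.
move=> Keta co Kr hr.
have hu j : exists u : {mpoly K[n]} * {mpoly K[n]},
    u.2.@[y] != 0 /\ r j * pev eta u.2 = pev eta u.1.
  by have [A [B [nB e _]]] := hr j; exists (A, B).
have [u uP] := functional_choice _ hu.
pose C := \prod_j (u j).2; pose A j := (u j).1 * \prod_(l | l != j) (u l).2.
have nC : C.@[y] != 0.
  rewrite rmorph_prod; apply/prodf_neq0 => j _; by case: (uP j).
have rC j : r j * pev eta C = pev eta (A j).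
  rewrite /C /A (bigD1 j) //= !rmorphM /= mulrA; congr (_ * _); by case: (uP j).
have kf0 : kfree iota [::] by [].
have [e [fe he]] := pspan_family
  (fun j : 'I_N.+1 => if unlift ord0 j is Some j' then A j' else C) kf0.
rewrite /= in fe he.
have [w wE] := he ord0; rewrite unlift_none in wE.
have hA j : exists a : nat -> {mpoly k[n]}, A j = \sum_(b < size e) e`_b *: mi (a b).
  by have := he (lift ord0 j); rewrite liftK.
have [a aE] := functional_choice _ hA.
have Kp q : K0 (pev eta (mi q)) by apply: krat_subst.
have rel j b : (b < size e)%N -> r j * pev eta (mi (w b)) = pev eta (mi (a j b)).
  move=> lt; apply/eqP; rewrite -subr_eq0; apply/eqP.
  apply: (disj fe (r := fun b => r j * pev eta (mi (w b)) - pev eta (mi (a j b)))) b lt.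
    move=> b; apply: kratD; first by apply: kratM.
    by rewrite -mulN1r -(rmorphN1 cst) -(rmorphN1 iota); apply: kratM => //; apply: kratC.
  under eq_bigr => b _ do rewrite mulrBr mulrCA.
  rewrite sumrB -mulr_sumr; apply/eqP; rewrite subr_eq0; apply/eqP.
  transitivity (r j * pev eta C).
    rewrite wE (rmorph_sum (mmap cst eta)); congr (_ * _); apply: eq_bigr => b _ /=.
    by rewrite mmapZ.
  rewrite rC aE (rmorph_sum (mmap cst eta)); apply: eq_bigr => b _ /=.
  by rewrite mmapZ.
have [b lt nb] : exists2 b, (b < size e)%N & (mi (w b)).@[y] != 0.
  apply: NNPP => no; case/eqP: nC; rewrite wE rmorph_sum big1 // => b _ /=.
  rewrite mevalZ; have [->|nb] := eqVneq (mi (w b)).@[y] 0; first by rewrite mulr0.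
  by case: no; exists b.
by exists (fun j => a j b), (w b); split => // j; apply: rel.
Qed.

Variable rho : 'M[K]_m.+1.
Hypothesis urho : rho \in unitmx.
Hypothesis p_neq : exists pd : 'I_m -> KK -> KK,
  (forall j, deriv cst (pd j)) /\ forall j i, pd j (z i) = (i == j)%:R.
Definition zr (j : 'I_m.+1) : KK := \sum_t cst (rho j t) * zeta z t 0.
Hypothesis zr_K0 : forall j, K0 (zr j / zr ord0).

Variables L L' : ppt K m -> ppt K m.
Hypothesis LE : forall l, exists2 c, c != 0 & forall j, vec (L l) j = c * mxpt rho l j.
Hypothesis L'E : forall l, exists2 c, c != 0 & forall j, vec (L' l) j = c * mxpt (invmx rho) l j.

Let LK : cancel L L'. Proof. exact: collineationK urho LE L'E. Qed.
Let L'K : cancel L' L.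
Proof. by apply: collineationK L'E _; rewrite ?unitmx_inv ?invmxK. Qed.

Lemma zr_val l a i j : vec l a != 0 -> vec (L l) i != 0 ->
  [/\ Rl l (zr j / zeta z a 0) (mxpt rho l j / vec l a), mxpt rho l i != 0 &
    mxpt rho l j / mxpt rho l i = pn (vec (L l)) i j].
Proof.
move=> na ni; have [c nc h] := LE l.
have nm : mxpt rho l i != 0 by move: ni; rewrite h mulf_eq0 negb_or => /andP [].
split => //; last by rewrite /pn !h; field; rewrite nc nm.
rewrite /zr /mxpt !mulr_suml; elim/big_rec2: _ => [|t c' r _ IH].
  by rewrite -(rmorph0 cst); apply: (Rl_cst z_free).
apply: (RlD z_free) => //; rewrite -!mulrA; apply: (RlM z_free); first exact: (Rl_cst z_free).
exact: Rl_pz.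
Qed.

Lemma zr_neq0 j : zr j != 0.
Proof.
have [l hl] := gnr_ex (gnr_vec K (ord0 : 'I_m.+1)).
apply/eqP => e; have u0 : row j rho = 0.
  apply/rowP => t; rewrite !mxE.
  have [pd [pd_d pdz]] := p_neq.
  pose v : 'M[K]_m.+1 := \matrix_(i, s) rho j s.
  have : mz cst z v = 0.
    apply/matrixP => i b; rewrite [RHS]mxE -[RHS]e /zr ord1 mxE.
    by apply: eq_bigr => s _; rewrite !mxE.
  rewrite -(mz0 cst z) => /(mz_inj pd_d pdz) /matrixP /(_ 0 t); by rewrite !mxE.
have : row j (rho *m invmx rho) = 0 by rewrite row_mul u0 mul0mx.
rewrite mulmxV // row1 => /rowP /(_ j); rewrite !mxE !eqxx => /eqP.
by rewrite oner_eq0.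
Qed.

(** Affine coordinates of the generic point after the collineation [rho]; unlike [pz], they lie in
    K0. *)
Definition pzr i j := zr j / zr i.

Lemma pzr_K0 i j : K0 (pzr i j).
Proof.
have -> : pzr i j = (zr j / zr ord0) * (zr i / zr ord0)^-1.
  by rewrite /pzr; field; rewrite !zr_neq0.
by apply: kratM => //; apply: kratV.
Qed.

Lemma pzr_val l i j : vec (L l) i != 0 -> Rl l (pzr i j) (pn (vec (L l)) i j).
Proof.
move=> ni; have [a na] := vec_nz l.
have [hj _ <-] := zr_val j na ni; have [hi ni' _] := zr_val i na ni.
have -> : pzr i j = (zr j / zeta z a 0) / (zr i / zeta z a 0).
  by rewrite /pzr; field; rewrite !zr_neq0 (zeta_neq0 z_free).
have -> : mxpt rho l j / mxpt rho l i = (mxpt rho l j / vec l a) / (mxpt rho l i / vec l a).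
  by field; rewrite na ni'.
by apply: (RlF z_free) => //; rewrite mulf_neq0 ?invr_neq0.
Qed.

Lemma pzr_dom l i c : (forall j, Rl l (pzr i j) (c j)) -> vec (L l) i != 0.
Proof.
move=> h; have [i' ni'] := vec_nz (L l).
have := RlM z_free (h i') (pzr_val i ni').
rewrite /pzr mulrA divfK ?zr_neq0 // divff ?zr_neq0 // => h1.
have /(Rl_uniq z_free h1) : Rl l 1 1 by rewrite -{1}(rmorph1 cst); apply: (Rl_cst z_free).
rewrite /pn mulrA => e; apply/eqP => e0; move/eqP: e.
by rewrite e0 mulr0 mul0r eq_sym oner_eq0.
Qed.

Lemma to_projective_morphism :
  @is_morphism k K iota X (projective_space K m) (fun x => L (f x)).
Proof.
move=> x; have [i di] := variety_cover Xvar x.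
have [il nl] := vec_nz (L (f x)).
have ne : exists x, chart_dom i x by exists x.
have toK0 r : krat iota cst xi i r -> K0 r.
  exact: (krat_chart Xvar g_mor fK gK z_free z_gen xiP ne ne0).
have [|||j|a [h [nh e]]] := @K0_local _ (xi i) (cx i x) _ (pzr il) (pn (vec (L (f x))) il).
- by move=> t; apply: toK0; apply: krat_xi.
- exact: (Rl_compat z_free (xiP di)).
- exact: pzr_K0.
- by apply: (Rl_chart Xvar f_mor g_mor fK gK z_free z_gen xiP di); apply: pzr_val.
exists i, il; split => //; exists (fun t => a (lift il t)), h; split => // y dy ny.
have xiy := xiP dy.
have hv j : Rl (f y) (pzr il j) ((mi (a j)).@[cx i y] / (mi h).@[cx i y]).
  have nh' := pev_neq0 (Rl_compat z_free xiy) ny.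
  have -> : pzr il j = pev (xi i) (mi (a j)) / pev (xi i) (mi h) by rewrite -e mulfK.
  exact: (Rl_quot z_free).
have ny' := pzr_dom hv; split => // t; rewrite pchartE.
exact: (Rl_uniq z_free (pzr_val _ ny') (hv _)).
Qed.

Lemma from_projective_morphism :
  @is_morphism k K iota (projective_space K m) X (fun l => g (L' l)).
Proof.
move=> l'; pose l := L' l'; have Ll : L l = l' by rewrite /l L'K.
have [i di] := variety_cover Xvar (g l).
have ne : exists x, chart_dom i x by exists (g l).
have toK0 r : krat iota cst xi i r -> K0 r.
  exact: (krat_chart Xvar g_mor fK gK z_free z_gen xiP ne ne0).
have [il nl] := vec_nz l'.
pose eta (t : 'I_m) := pzr il (lift il t).
have etav l2 : vec (L l2) il != 0 -> forall t, Rl l2 (eta t) (pn (vec (L l2)) il (lift il t)).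
  by move=> n t; apply: pzr_val.
have nLl : vec (L l) il != 0 by rewrite Ll.
pose y := fun t => pn (vec l') il (lift il t).
have etal t : Rl l (eta t) (y t) by have := etav l nLl t; rewrite Ll.
have co : compat cst eta y := Rl_compat z_free etal.
have hpz s : loc cst eta y (zeta z s 0 / zr il) (mxpt (invmx rho) l' s / vec l' il).
  have -> : zeta z s 0 / zr il = \sum_j cst (invmx rho s j) * pzr il j.
    have e : zeta z = map_mx cst (invmx rho) *m (mz cst z rho) by rewrite -mzM mulVmx // mz1.
    rewrite {1}e mxE mulr_suml; apply: eq_bigr => j _; rewrite mxE /pzr mulrA.
    by congr (_ * _ / _); rewrite mxE; apply: eq_bigr => t _; rewrite mxE.
  rewrite /mxpt mulr_suml; elim/big_rec2: _ => [|j c' r _ IH].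
    by rewrite -(rmorph0 cst); apply: loc_cst.
  apply: locD => //; rewrite -mulrA; apply: locM; first exact: loc_cst.
  rewrite -/(pn (vec l') il j).
  case: (unliftP il j) => [t|] ->; first exact: locX.
  rewrite /pzr /pn !divff ?zr_neq0 // -{1}(rmorph1 cst); exact: loc_cst.
have hxi t : loc cst eta y (xi i t) (cx i (g l) t).
  have [a na] := vec_nz l.
  have := xiP di t; rewrite gK => /(rlocP z_free na).
  apply: (loc_trans co) => s.
  have [c nc h] := L'E l'.
  have nm : mxpt (invmx rho) l' a != 0.
    by move: na; rewrite /l h mulf_eq0 negb_or => /andP [].
  have -> : pz z a s = (zeta z s 0 / zr il) / (zeta z a 0 / zr il).
    by rewrite /pz; field; rewrite zr_neq0 (zeta_neq0 z_free).
  have -> : pn (vec l) a s = (mxpt (invmx rho) l' s / vec l' il) / (mxpt (invmx rho) l' a / vec l' il).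
    by rewrite /pn /l !h; field; rewrite nm nc nl.
  by apply: (locF co) => //; rewrite mulf_neq0 ?invr_neq0.
have [||a [h [nh e]]] := @K0_local _ eta y _ (xi i) (cx i (g l)) _ co _ hxi.
- by move=> t; apply: pzr_K0.
- by move=> t; apply: toK0; apply: krat_xi.
exists il, i; split => //; exists a, h; split.
  by rewrite /ev (meval_eq (v2 := y)) => // t; rewrite pchartE.
move=> l2 dl2 nh2; pose Y t := chart (a := projective_space K m) il l2 0 t.
pose l3 := L' l2; have Ll3 : L l3 = l2 by rewrite /l3 L'K.
have eta3 t : Rl l3 (eta t) (Y t).
  by have := etav l3; rewrite Ll3 => /(_ dl2 t); rewrite /Y pchartE.
have nhK := pev_neq0 (Rl_compat z_free eta3) nh2.
pose y2 t := (mi (a t)).@[Y] / (mi h).@[Y].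
have xi3 t : Rl l3 (xi i t) (y2 t).
  have -> : xi i t = pev eta (mi (a t)) / pev eta (mi h) by rewrite -e mulfK.
  exact: (Rl_quot z_free).
(* Regularity demands that the image of every such l2 lie in chart i. The values [y2] specialize
   [xi], hence are the coordinates of a point x2, and comparing projective coordinates identifies f
   x2 with l3. *)
have [x2 dx2 ex2] := compat_chart Xvar g_mor fK gK z_free z_gen xiP ne (Rl_compat z_free xi3).
have fx2 : l3 = f x2.
  have [b nb] := vec_nz (f x2).
  apply: (pt_eq z_free nb) => j.
  have xi3' t : Rl l3 (xi i t) (cx i x2 t) by rewrite ex2.
  apply: (Rl_trans z_free xi3').
  by apply: (Rl_chart Xvar f_mor g_mor fK gK z_free z_gen xiP dx2); apply: Rl_pz.
have gx2 : g (L' l2) = x2 by rewrite -/l3 fx2 fK.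
rewrite gx2; split => // t; exact: ex2.
Qed.

Lemma trivialization : isomorphic iota X (projective_space K m).
Proof.
exists (fun x => L (f x)), (fun l => g (L' l)); split.
- exact: to_projective_morphism.
- exact: from_projective_morphism.
- by move=> x; rewrite LK fK.
- by move=> l; rewrite gK L'K.
Qed.
End Trivialization.

(** * The k-form is a division algebra *)

(** A sum of blocks is enlarged greedily: a block not contained in S meets it trivially, so every
    step adds exactly d to the dimension. *)
Lemma dim_dvd_of_blocks (K : fieldType) (V : vectType K) (Uf Q : {vspace V} -> Prop) d :
  Q 0%VS -> (forall S U, Q S -> Uf U -> Q (S + U)%VS) ->
  (forall U, Uf U -> \dim U = d) ->
  (forall S U, Q S -> Uf U -> (S :&: U)%VS <> 0%VS -> (U <= S)%VS) ->
  (forall S : {vspace V}, (forall U, Uf U -> (U <= S)%VS) -> S = fullv) ->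
  (d %| \dim {:V})%N.
Proof.
move=> Q0 QD Ud h2 h3.
suff h c S : (\dim {:V} - \dim S <= c)%N -> Q S -> (d %| \dim S)%N -> (d %| \dim {:V})%N.
  by apply: (h _ 0%VS (leqnn _)) => //; rewrite dimv0 dvdn0.
elim: c S => [|c IH] S lt QS dS.
  have -> // : {:V}%VS = S.
  by symmetry; apply/eqP; rewrite eqEdim subvf -subn_eq0 -leqn0.
case: (classic (forall U, Uf U -> (U <= S)%VS)) => [/h3 e|]; first by rewrite -e.
move=> /not_all_ex_not [U hU]; have [UU nS] := imply_to_and _ _ hU.
have i0 : (S :&: U)%VS = 0%VS by apply: NNPP => /(h2 _ _ QS UU).
have dD : \dim (S + U) = (\dim S + d)%N by rewrite dimv_disjoint_sum // (Ud _ UU).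
apply: (IH (S + U)%VS); last by rewrite dD dvdn_add.
  have d0 : (0 < d)%N.
    by rewrite -(Ud _ UU) lt0n dimv_eq0; apply: contra_notN nS => /eqP ->; apply: sub0v.
  have := dimvS (subvf (S + U)); rewrite dD; lia.
exact: QD.
Qed.

Section Form.
Variables (k : fieldType) (K : closedFieldType) (iota : {rmorphism k -> K}) (m : nat).
Local Notation Mp := 'M[K]_m.+1.
Variable A : Mp -> Prop.
Hypothesis AD : forall v w, A v -> A w -> A (v + w).
Hypothesis AZ : forall c v, A v -> A (iota c *: v).
Hypothesis A1 : A 1%:M.
Hypothesis AM : forall v w, A v -> A w -> A (v *m w).
Hypothesis Adisj : forall e, kfree iota e -> forall v : nat -> Mp, (forall i, A (v i)) ->
  \sum_(i < size e) e`_i *: v i = 0 -> forall i, (i < size e)%N -> v i = 0.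
Hypothesis Agen : forall v : Mp, exists N (c : 'I_N -> K) (a : 'I_N -> Mp),
  (forall i, A (a i)) /\ v = \sum_i c i *: a i.

Lemma A0 : A 0. Proof. by rewrite -(scale0r 1%:M) -(rmorph0 iota); apply: AZ. Qed.
Lemma AN v : A v -> A (- v).
Proof. by rewrite -scaleN1r -(rmorphN1 iota); apply: AZ. Qed.
Lemma A_sum (I : Type) (s : seq I) (P : pred I) F :
  (forall i, P i -> A (F i)) -> A (\sum_(i <- s | P i) F i).
Proof. by move=> h; elim/big_ind: _ => //; apply: A0. Qed.
Lemma AX v i : A v -> A (v ^+ i).
Proof. by move=> Av; elim: i => [|i IH]; rewrite ?expr0 ?exprS //; apply: AM. Qed.
Lemma A_horner (q : {poly k}) a : A a -> A (horner_mx a (map_poly iota q)).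
Proof.
move=> Aa; elim/poly_ind: q => [|q c IH]; first by rewrite !rmorph0; apply: A0.
rewrite rmorphD rmorphM /= map_polyX map_polyC /= rmorphD rmorphM /= horner_mx_X horner_mx_C.
by apply: AD; [apply: AM | rewrite -scalemx1; apply: AZ].
Qed.

Definition spans (P : Mp -> Prop) v := exists N (c : 'I_N -> K) (a : 'I_N -> Mp),
  (forall i, P (a i)) /\ v = \sum_i c i *: a i.

Definition ksub (P : Mp -> Prop) :=
  [/\ P 0, forall v w, P v -> P w -> P (v + w), forall c v, P v -> P (iota c *: v)
    & forall v, P v -> A v].

Lemma ksub_sum P (I : Type) (s : seq I) (R : pred I) F : ksub P ->
  (forall i, R i -> P (F i)) -> P (\sum_(i <- s | R i) F i).
Proof. by case=> h0 hD _ _ h; elim/big_ind: _. Qed.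

Lemma spans_coord e P N (c : 'I_N -> K) (a : 'I_N -> Mp) : ksub P ->
  (forall i, P (a i)) -> (forall i, kspan iota e (c i)) ->
  exists b : nat -> Mp, (forall j, P (b j)) /\ \sum_i c i *: a i = \sum_(j < size e) e`_j *: b j.
Proof.
move=> kP Pa ce; have [g hg] := functional_choice (fun (i : 'I_N) (g : nat -> k) =>
  c i = \sum_(j < size e) iota (g j) * e`_j) ce.
exists (fun j => \sum_i iota (g i j) *: a i); split.
  by move=> j; apply: ksub_sum => // i _; case: kP => _ _ hZ _; apply: hZ.
under eq_bigr => i _ do rewrite hg scaler_suml.
rewrite exchange_big; apply: eq_bigr => j _; rewrite scaler_sumr.
by apply: eq_bigr => i _; rewrite scalerA mulrC.
Qed.

Lemma spans_expand P v e : ksub P -> spans P v -> kfree iota e ->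
  exists e' (b : nat -> Mp), [/\ kfree iota (e ++ e'), forall j, P (b j) &
    v = \sum_(j < size (e ++ e')) (e ++ e')`_j *: b j].
Proof.
move=> kP [N [c [a [Pa ->]]]] fe.
have [e' [fe' h]] := kfree_extend [seq c i | i <- enum 'I_N] fe.
have [|b [Pb hb]] := spans_coord (e := e ++ e') (c := c) kP Pa.
  by move=> i; apply: h; apply: map_f; rewrite mem_enum.
by exists e', b.
Qed.

(** Over one k-free family the two expansions of v have the same coordinates, and these lie in both
    P and Q. *)
Lemma spans_meet P Q v : ksub P -> ksub Q -> spans P v -> spans Q v -> v != 0 ->
  exists w, [/\ P w, Q w & w != 0].
Proof.
move=> kP kQ [N [c [a [Pa vE]]]] [N' [c' [a' [Qa' vE']]]] nv.
have f0 : kfree iota [::] by [].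
have [e [fe h]] := kfree_extend ([seq c i | i <- enum 'I_N] ++ [seq c' i | i <- enum 'I_N']) f0.
rewrite /= in fe h.
have [|b [Pb bE]] := spans_coord (e := e) (c := c) kP Pa.
  by move=> i; apply: h; rewrite mem_cat map_f ?mem_enum.
have [|b' [Pb' bE']] := spans_coord (e := e) (c := c') kQ Qa'.
  by move=> i; apply: h; rewrite mem_cat map_f ?mem_enum ?orbT.
have [i nb] : exists i : 'I_(size e), b i != 0.
  apply: NNPP => no; move/eqP: nv; apply; rewrite vE bE big1 // => j _.
  have [-> |n] := eqVneq (b j) 0; first by rewrite scaler0.
  by case: no; exists j.
exists (b i); split=> //; have -> // : b i = b' i.
apply/eqP; rewrite -subr_eq0; apply/eqP.
apply: (Adisj fe (v := fun i => b i - b' i)) (ltn_ord i) => [j|].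
  case: kP kQ => _ _ _ PA [_ _ _ QA].
  by apply: AD; [apply: PA | apply: AN; apply: QA].
under eq_bigr => j _ do rewrite scalerBr.
by rewrite sumrB -bE -bE' -vE -vE' subrr.
Qed.

(** Expand the sum over a free family starting with 1, with coordinates in the k-span of the a_i.
    The sum is itself in A, so it equals its first coordinate. *)
Lemma A_descent N (c : 'I_N -> K) (a : 'I_N -> Mp) : (forall i, A (a i)) ->
  A (\sum_i c i *: a i) -> exists d, \sum_i c i *: a i = \sum_i iota (d i) *: a i.
Proof.
move=> Aa As; pose P v := exists d, v = \sum_i iota (d i) *: a i.
have kP : ksub P.
  split.
  - by exists (fun=> 0); rewrite big1 // => i _; rewrite rmorph0 scale0r.
  - move=> _ _ [d ->] [d' ->]; exists (fun i => d i + d' i); rewrite -big_split.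
    by apply: eq_bigr => i _; rewrite rmorphD scalerDl.
  - move=> b _ [d ->]; exists (fun i => b * d i); rewrite scaler_sumr.
    by apply: eq_bigr => i _; rewrite scalerA rmorphM.
  - by move=> _ [d ->]; apply: A_sum => i _; apply: AZ.
have sP : spans P (\sum_i c i *: a i).
  exists N, c, a; split=> // i; exists (fun j => (j == i)%:R).
  rewrite (bigD1 i) //= eqxx rmorph1 scale1r big1 ?addr0 // => j /negbTE ->.
  by rewrite rmorph0 scale0r.
have [e [b [fe Pb vE]]] := spans_expand kP sP (@kfree1 _ _ iota).
suff -> : \sum_i c i *: a i = b 0%N by apply: Pb.
apply/eqP; rewrite -subr_eq0; apply/eqP.
pose v j := if j is 0 then \sum_i c i *: a i - b 0%N else - b j.
apply: (Adisj fe (v := v)) (ltn0Sn _).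
  by move=> [|j]; [apply: AD => //|]; apply: AN; case: kP => _ _ _; apply.
rewrite big_ord_recl /= scale1r vE big_ord_recl /= scale1r.
rewrite [X in X - _]addrC addrK -big_split big1 // => j _ /=.
by rewrite scalerN subrr.
Qed.

Lemma A_scalar c v : A v -> v != 0 -> A (c *: v) -> exists d, c = iota d.
Proof.
move=> Av nv Acv; have [||d] := @A_descent 1 (fun=> c) (fun=> v) => //; rewrite ?big_ord1 //.
move=> /eqP; rewrite -subr_eq0 -scalerBl scaler_eq0 (negbTE nv) orbF subr_eq0 => /eqP ->.
by exists (d 0).
Qed.

(* [L] is a subalgebra defined over k; the blocks are the left L-modules [L b]. *)
Section Blocks.
Variables (L : {vspace Mp}) (B : Mp -> Prop) (d : nat).
Local Notation block b := (linfun (mulmxr b : Mp -> Mp) @: L)%VS.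
Hypothesis L1 : 1%:M \in L.
Hypothesis LM : forall x y, x \in L -> y \in L -> x *m y \in L.
Hypothesis Lgen : forall x, x \in L -> spans (fun v => A v /\ v \in L) x.
Hypothesis BA : forall b, B b -> A b.
Hypothesis Bd : forall b, B b -> \dim (block b) = d.
Hypothesis BL : forall b x, B b -> x \in L -> A x -> x *m b != 0 -> B (x *m b).
Hypothesis Bfull : forall S : {vspace Mp}, (forall b, B b -> (block b <= S)%VS) -> S = fullv.

Lemma mem_block b v : reflect (exists2 x, x \in L & v = x *m b) (v \in block b).
Proof.
apply: (iffP memv_imgP) => -[x Lx ->]; exists x => //; by rewrite lfunE.
Qed.

(** The admissible S are stable under L and spanned by elements of A. If S meets L b, then
    [spans_meet] yields a nonzero w = x b of A in S; L w lies in L b and has the same dimension, so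
    S contains L b. *)
Lemma block_dim_dvd : (d %| m.+1 * m.+1)%N.
Proof.
have -> : (m.+1 * m.+1)%N = \dim {:Mp} by rewrite dimvf.
pose Q (S : {vspace Mp}) := (forall x v, x \in L -> v \in S -> x *m v \in S) /\
  forall v, v \in S -> spans (fun w => A w /\ w \in S) v.
apply: (@dim_dvd_of_blocks _ _ (fun U => exists2 b, B b & U = block b) Q).
- split=> [x v _|v]; rewrite memv0 => /eqP ->; first by rewrite mulmx0 mem0v.
  by exists 0%N, (fun=> 0), (fun=> 0); split=> [[]//|]; rewrite big_ord0.
- move=> S _ [S1 S2] [b Bb ->]; split.
    move=> x _ Lx /memv_addP [v1 v1S [_ /mem_block [y Ly ->] ->]].
    by rewrite mulmxDr memv_add ?S1 //; apply/mem_block; exists (x *m y); rewrite ?LM // mulmxA.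
  move=> _ /memv_addP [v1 /S2 [N1 [c1 [a1 [h1 ->]]]] [_ /mem_block [y /Lgen [N2 [c2 [a2 [h2 ->]]]] ->] ->]].
  exists (N1 + N2)%N, (fun i => match split i with inl i => c1 i | inr i => c2 i end).
  exists (fun i => match split i with inl i => a1 i | inr i => a2 i *m b end); split.
    move=> i; case: (split i) => j.
      by have [? ?] := h1 j; split=> //; apply: subvP (addvSl _ _) _ _.
    have [? ?] := h2 j; split; first by apply: AM => //; apply: BA.
    apply: (subvP (addvSr _ _)); apply/mem_block; by exists (a2 j).
  rewrite big_split_ord mulmx_suml /=; congr (_ + _); apply: eq_bigr => i _.
    by rewrite (unsplitK (inl _ i)).
  by rewrite (unsplitK (inr _ i)) scalemxAl.
- by move=> _ [b Bb ->]; apply: Bd.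
- move=> S _ [S1 S2] [b Bb ->] /eqP; rewrite -vpick0; set v := vpick _ => nv.
  have := memv_pick (S :&: block b)%VS; rewrite memv_cap => /andP [vS /mem_block [y Ly vE]].
  pose P w := A w /\ w \in S; pose P' w := exists x, [/\ A x, x \in L & w = x *m b].
  have [|||||w [[Aw wS] [x [Ax Lx wE]] nw]] := @spans_meet P P' v => //.
  + split=> [|u w [? ?] [? ?]|c u [? ?]|u []] //; split; rewrite ?mem0v //; first exact: A0.
    - exact: AD.
    - exact: memvD.
    - exact: AZ.
    exact: memvZ.
  + split.
    - by exists 0; rewrite mul0mx mem0v; split=> //; apply: A0.
    - move=> _ _ [x [? ? ->]] [x' [? ? ->]]; exists (x + x'); rewrite mulmxDl memvD //.
      by split=> //; apply: AD.
    - move=> c _ [x [? ? ->]]; exists (iota c *: x); rewrite scalemxAl memvZ //.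
      by split=> //; apply: AZ.
    - by move=> _ [x [? ? ->]]; apply: AM => //; apply: BA.
  + exact: S2.
  + have [N [c [a [h yE]]]] := Lgen Ly; exists N, c, (fun i => a i *m b); split.
      by move=> i; have [? ?] := h i; exists (a i).
    rewrite /v vE yE mulmx_suml; apply: eq_bigr => i _; by rewrite scalemxAl.
  have Bw : B w by rewrite wE; apply: BL => //; rewrite -wE.
  have sub : (block w <= block b)%VS.
    apply/subvP => _ /mem_block [t Lt ->]; apply/mem_block; exists (t *m x); first exact: LM.
    by rewrite wE mulmxA.
  have <- : block w = block b by apply/eqP; rewrite eqEdim sub (Bd Bw) (Bd Bb) leqnn.
  by apply/subvP => _ /mem_block [t Lt ->]; apply: S1.
- by move=> S h; apply: Bfull => b Bb; apply: h; exists b.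
Qed.
End Blocks.

Lemma dim_left_ideal (b : Mp) : \dim (linfun (mulmxr b : Mp -> Mp) @: fullv) = (m.+1 * \rank b)%N.
Proof.
pose f := linfun (mulmxr (row_base b) : 'M[K]_(m.+1, \rank b) -> Mp).
have -> : (linfun (mulmxr b : Mp -> Mp) @: fullv = f @: fullv)%VS.
  apply/vspaceP => v; apply/memv_imgP/memv_imgP => -[x _ ->]; rewrite lfunE /=.
    exists (x *m col_base b); first exact: memvf.
    by rewrite lfunE /= -mulmxA mulmx_base.
  have /submxP [D hD] : (x *m row_base b <= b)%MS.
    by rewrite (submx_trans (submxMl _ _)) // eq_row_base.
  by exists D; [apply: memvf | rewrite lfunE].
rewrite limg_dim_eq; first by rewrite dimvf.
apply/eqP; rewrite capfv; apply/lker0P => x y; rewrite !lfunE /= => e.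
have fr : row_free (row_base b) by rewrite row_base_free.
exact: (row_free_inj fr e).
Qed.

Lemma row_space_basis (P : 'rV[K]_m.+1 -> Prop) :
  (forall j, exists N (c : 'I_N -> K) (w : 'I_N -> 'rV_m.+1),
     (forall i, P (w i)) /\ delta_mx 0 j = \sum_i c i *: w i) ->
  exists2 rho : Mp, rho \in unitmx & forall j, P (row j rho).
Proof.
move=> Pgen; suff h t : (t <= m.+1)%N ->
    exists R : 'M[K]_(t, m.+1), row_free R /\ forall j, P (row j R).
  by have [rho [fr hr]] := h m.+1 (leqnn _); exists rho; rewrite -?row_free_unit.
elim: t => [|t IH] lt.
  by exists 0; split=> [|[]//]; rewrite /row_free mxrank0.
have [R [fR PR]] := IH (ltnW lt).
have [j nj] : exists j, ~~ ((delta_mx 0 j : 'rV_m.+1) <= R)%MS.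
  apply: NNPP => no; have : row_full R.
    rewrite -sub1mx; apply/row_subP => j; rewrite row1; apply/negPn/negP => h.
    by apply: no; exists j.
  by rewrite /row_full (eqP fR); lia.
have [N [c [w [Pw e]]]] := Pgen j.
have [i ni] : exists i, ~~ (w i <= R)%MS.
  apply: NNPP => no; move/negP: nj; apply; rewrite e; apply: summx_sub => i _.
  by apply: scalemx_sub; apply/negPn/negP => h; apply: no; exists i.
exists (col_mx (w i) R); split.
  rewrite /row_free eqn_leq rank_leq_row /=.
  suff : (\rank R < \rank (col_mx (w i) R))%N by rewrite (eqP fR).
  apply: rank_ltmx; rewrite /ltmx.
  have [-> ->] : (R <= col_mx (w i) R)%MS /\ ~~ (col_mx (w i) R <= R)%MS.
    by rewrite col_mx_sub submx_refl andbT; split=> //; rewrite -addsmxE addsmxSr.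
  by [].
suff h (l : 'I_(1 + t)) : P (row l (col_mx (w i) R)) by exact: h.
case: (split_ordP l) => l' ->; last by rewrite rowKd.
by rewrite rowKu ord1 row_id.
Qed.

Hypothesis p_prime : prime m.+1.
Hypothesis no_rank1 : forall (u : 'cV[K]_m.+1) (rho : Mp), rho \in unitmx -> u != 0 ->
  ~ forall j, A (u *m row j rho).

(** For r the minimal rank, the left ideals M_p(K) b with b in A of rank r have dimension p r and
    serve as blocks; so p r divides p^2. *)
Lemma A_unit a : A a -> a != 0 -> a \in unitmx.
Proof.
have [r [[b [Ab nb rb]] rmin]] : exists r, (exists b, [/\ A b, b != 0 & \rank b = r]) /\
    forall b, A b -> b != 0 -> (r <= \rank b)%N.
  have h n : forall b, A b -> b != 0 -> (\rank b <= n)%N -> exists r, (exists b, [/\ A b, b != 0 & \rank b = r]) /\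
      forall b, A b -> b != 0 -> (r <= \rank b)%N.
    elim: n => [|n IH] b Ab nb.
      by rewrite leqn0 mxrank_eq0 (negbTE nb).
    move=> le; case: (classic (forall b', A b' -> b' != 0 -> (\rank b <= \rank b')%N)) => [h|].
      by exists (\rank b); split=> //; exists b.
    move=> /not_all_ex_not [b' hb']; have [Ab' hb2] := imply_to_and _ _ hb'.
    have [nb' /negP] := imply_to_and _ _ hb2; rewrite -ltnNge => lt'.
    by apply: (IH b') => //; rewrite -ltnS; apply: leq_trans lt' le.
  by apply: (h (\rank (1%:M : Mp)) 1%:M) => //; apply: oner_neq0.
have dv : (m.+1 * r %| m.+1 * m.+1)%N.
  apply: (@block_dim_dvd fullv (fun b => [/\ A b, b != 0 & \rank b = r])).
  - by move=> x y _ _; apply: memvf.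
  - move=> x _; have [N [c [e [Ae ->]]]] := Agen x.
    by exists N, c, e; split=> // i; split=> //; apply: memvf.
  - by move=> c [].
  - by move=> c [_ _ rc]; rewrite dim_left_ideal rc.
  - move=> c x [Ac nc rc] _ Ax nxc; split=> //; first exact: AM.
    apply/eqP; rewrite eqn_leq rmin ?andbT //; last exact: AM.
    by rewrite -rc mxrankM_maxr.
  (* S contains the two-sided ideal generated by b, which is everything: v is a combination of
     elements e of A, and each b e is zero or again of minimal rank. *)
  move=> S hS; have hS' x v : x *m b *m v \in S.
    have [N [c [e [Ae ->]]]] := Agen v; rewrite mulmx_sumr memv_suml // => i _.
    rewrite -scalemxAr memvZ // -mulmxA.
    have [->|n] := eqVneq (b *m e i) 0; first by rewrite mulmx0 mem0v.
    have hB : [/\ A (b *m e i), b *m e i != 0 & \rank (b *m e i) = r].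
      split=> //; first exact: AM.
      apply/eqP; rewrite eqn_leq rmin ?andbT //; last exact: AM.
      by rewrite -rb mxrankM_maxl.
    apply: (subvP (hS _ hB)); apply/memv_imgP; exists x; first exact: memvf.
    by rewrite lfunE.
  have [i [j nij]] : exists i j, b i j != 0.
    apply: NNPP => no; move/eqP: nb; apply; apply/matrixP => i j; rewrite mxE.
    by apply/eqP/negPn/negP => h; apply: no; exists i, j.
  apply/eqP; rewrite eqEsubv subvf /=; apply/subvP => v _.
  rewrite (matrix_sum_delta v) memv_suml // => x _; rewrite memv_suml // => y _.
  rewrite memvZ //; have := hS' ((b i j)^-1 *: delta_mx x i) (delta_mx j y).
  suff -> : (b i j)^-1 *: delta_mx x i *m b *m delta_mx j y = delta_mx x y by [].
  apply/matrixP => s t; rewrite !mxE (bigD1 j) //= big1 ?addr0; last first.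
    by move=> l nl; rewrite [delta_mx j y _ _]mxE (negbTE nl) mulr0.
  rewrite !mxE (bigD1 i) //= big1 ?addr0; last first.
    by move=> l nl; rewrite !mxE (negbTE nl) andbF mulr0 mul0r.
  rewrite !mxE !eqxx /= andbT; case: (s == x); case: (t == y) => //=;
  by rewrite ?mulr1 ?mulr0 ?mul0r ?mulVf // mul0r.
rewrite dvdn_pmul2l // in dv; move=> Aa na; have [/eqP r1|/eqP rp] := orP (proj2 (primeP p_prime) _ dv).
  have [u [w bE]] : exists (u : 'cV[K]_m.+1) (w : 'rV[K]_m.+1), b = u *m w.
    move: (col_base b) (row_base b) (mulmx_base b); rewrite rb r1 => u w <-.
    by exists u, w.
  have nu : u != 0 by apply: contra_neq nb => u0; rewrite bE u0 mul0mx.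
  have [i ni] : exists i, w 0 i != 0.
    apply: NNPP => no; move/eqP: nb; apply; rewrite bE; suff -> : w = 0 by rewrite mulmx0.
    by apply/rowP => i; rewrite mxE; apply/eqP/negPn/negP => h; apply: no; exists i.
  (* Here b = u w, and u (w e) = b e lies in A for e in A; the rows w e span because w is
     nonzero. *)
  have [|rho urho /(no_rank1 urho nu) []] := @row_space_basis (fun v => A (u *m v)).
  move=> j; have [N [c [e [Ae eE]]]] := Agen ((w 0 i)^-1 *: delta_mx i j).
  exists N, c, (fun l => w *m e l); split; first by move=> l; rewrite mulmxA -bE; apply: AM.
  transitivity (w *m ((w 0 i)^-1 *: delta_mx i j)); last first.
    by rewrite eE mulmx_sumr; apply: eq_bigr => l _; rewrite scalemxAr.
  apply/rowP => s; rewrite !mxE (bigD1 i) //= big1 ?addr0; last first.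
    by move=> l nl; rewrite !mxE (negbTE nl) mulr0 mulr0.
  by rewrite !mxE !eqxx /= mulVKf //.
rewrite -row_full_unit /row_full eqn_leq rank_leq_col /= -{1}rp; exact: rmin.
Qed.

Lemma A_mul_eq0 a b : A a -> A b -> a *m b = 0 -> a = 0 \/ b = 0.
Proof.
move=> Aa Ab e; have [->|na] := eqVneq a 0; [by left | right].
by rewrite -[b](mulKmx (A_unit Aa na)) e mulmx0.
Qed.

Lemma horner_mx_wide n (a : Mp) (q : {poly K}) : (size q <= n)%N ->
  horner_mx a q = \sum_(i < n) q`_i *: a ^+ i.
Proof.
move=> le; rewrite /horner_mx /horner_morph (@horner_coef_wide _ n); last first.
  exact: leq_trans (size_poly _ _) le.
by apply: eq_bigr => i _; rewrite coef_map /= -mul_scalar_mx.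
Qed.

Definition scalar (a : Mp) := exists c, a = c%:M.

(** For L = K[a] the blocks L b, with b nonzero in A and hence invertible, all have the dimension of
    L. It divides p^2 and is at most p; dimension 1 would make a scalar. *)
Lemma powers_free a (q : {poly K}) : A a -> ~ scalar a -> (size q <= m.+1)%N ->
  horner_mx a q = 0 -> q = 0.
Proof.
move=> Aa ns; pose X := [tuple a ^+ i | i < m.+1].
have XE (i : 'I_m.+1) : X`_i = a ^+ i.
  by rewrite -tnth_nth tnth_mktuple.
have hL u : horner_mx a u \in <<X>>%VS.
  have monchi := char_poly_monic a; rewrite (divp_eq u (char_poly a)) rmorphD rmorphM /=.
  rewrite Cayley_Hamilton mulr0 add0r (@horner_mx_wide m.+1); last first.
    by rewrite -ltnS -(size_char_poly a) ltn_modp monic_neq0.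
  rewrite memv_suml // => i _; rewrite memvZ // -XE memv_span // mem_nth //.
  by rewrite size_tuple.
have Lh x : x \in <<X>>%VS -> exists u, x = horner_mx a u.
  move=> /coord_span ->; exists (\poly_(i < m.+1) (if insub i is Some j then coord X j x else 0)).
  rewrite (horner_mx_wide _ (size_poly _ _)); apply: eq_bigr => i _.
  rewrite coef_poly ltn_ord XE; case: insubP => [j _ e|]; last by rewrite ltn_ord.
  by rewrite (val_inj e).
have [dv le] : (\dim <<X>> %| m.+1 ^ 2)%N /\ (\dim <<X>> <= m.+1)%N.
  split; last by rewrite (leq_trans (dim_span _)) // size_tuple.
  rewrite expnS expn1; apply: (@block_dim_dvd <<X>>%VS (fun b => A b /\ b != 0)).
  - by move=> x y /Lh [u ->] /Lh [u' ->]; rewrite -[_ *m _]/(_ * _) -rmorphM hL.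
  - move=> x /coord_span ->; exists m.+1, (fun i => coord X i x), (fun i : 'I_m.+1 => X`_i).
    split=> // i; rewrite {1}XE; split; first exact: AX.
    by rewrite memv_span // mem_nth // size_tuple.
  - by move=> b [].
  - move=> b [Ab nb]; apply: limg_dim_eq; apply/eqP; rewrite -subv0; apply/subvP => v.
    rewrite memv_cap memv_ker lfunE /= => /andP [_ /eqP e].
    by rewrite memv0 -[v](mulmxK (A_unit Ab nb)) e mul0mx.
  - by move=> b x [Ab nb] _ Ax nx; split=> //; apply: AM.
  move=> S hS; apply/eqP; rewrite eqEsubv subvf; apply/subvP => v _.
  have [N [c [e [Ae ->]]]] := Agen v; rewrite memv_suml // => i _; rewrite memvZ //.
  have [->|n] := eqVneq (e i) 0; first exact: mem0v.
  have := hS _ (conj (Ae i) n) => /subvP; apply; apply/memv_imgP; exists 1%:M.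
    by have := hL 1; rewrite rmorph1.
  by rewrite lfunE /= mul1mx.
have [dm|dm] : \dim <<X>> = 1%N \/ \dim <<X>> = m.+1.
- move: dv le => /(dvdn_pfactor _ _ p_prime) [i _ ->] h.
  have : (i <= 1)%N by rewrite -(leq_exp2l _ _ (prime_gt1 p_prime)) expn1.
  by case: i {h} => [|[|//]] _; [left | right; rewrite expn1].
- case: ns; have le1 : (<[1%:M : Mp]> <= <<X>>)%VS by rewrite -memvE; have := hL 1; rewrite rmorph1.
  have e : <[1%:M : Mp]>%VS = <<X>>%VS.
    by apply/eqP; rewrite eqEdim le1 dm dim_vline oner_neq0.
  have := hL 'X; rewrite -e horner_mx_X => /vlineP [c ->]; exists c; by rewrite scalemx1.
- have /freeP fX : free X by rewrite /free dm size_tuple.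
move=> sq; rewrite (horner_mx_wide _ sq) => e; apply/polyP => i; rewrite coef0.
have [lt|ge] := ltnP i m.+1; last by rewrite nth_default // (leq_trans sq).
apply: (fX (fun i => q`_i) _ (Ordinal lt)); rewrite -[RHS]e; apply: eq_bigr => j _.
by rewrite XE.
Qed.

(** Cayley-Hamilton expresses a^p by lower powers, [A_descent] allows coefficients in k, and
    independence of the powers identifies the two expressions. *)
Lemma A_char_poly a : A a -> ~ scalar a -> exists q : {poly k}, char_poly a = map_poly iota q.
Proof.
move=> Aa ns; have := Cayley_Hamilton a; set chi := char_poly a.
have schi : size chi = m.+2 by rewrite size_char_poly.
have lchi : chi`_m.+1 = 1.
  by have := monicP (char_poly_monic a); rewrite lead_coefE -/chi schi.
rewrite (horner_mx_wide (n := m.+2)) ?schi // big_ord_recr /= lchi scale1r.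
move=> /eqP; rewrite addr_eq0 => /eqP e.
have [||d ed] := @A_descent m.+1 (fun i => chi`_i) (fun i : 'I_m.+1 => a ^+ i).
- by move=> i; apply: AX.
- by rewrite e; apply: AN; apply: AX.
pose D := \poly_(i < m.+1) (if insub i is Some j then d j else 0).
have De : chi - 'X^(m.+1) = map_poly iota D.
  apply/eqP; rewrite -subr_eq0; apply/eqP; apply: (powers_free Aa ns).
    apply/leq_sizeP => j; rewrite leq_eqVlt !coefB coefXn coef_map coef_poly /=.
    rewrite [(j < m.+1)%N]ltnNge => /orP [/eqP <-|lt].
      by rewrite lchi eqxx leqnn rmorph0 subrr subr0.
    by rewrite nth_default ?schi // (gtn_eqF lt) (ltnW lt) /= subr0 rmorph0 subr0.
  rewrite !rmorphB /= Cayley_Hamilton sub0r rmorphXn /= horner_mx_X.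
  rewrite (horner_mx_wide (n := m.+1)); last first.
    exact: leq_trans (size_poly _ _) (size_poly _ _).
  rewrite (eq_bigr (fun i : 'I_m.+1 => iota (d i) *: a ^+ i)).
    by rewrite -ed e opprK addNr.
  move=> i _; rewrite coef_map coef_poly ltn_ord /=.
  by case: insubP => [j _ ej|]; rewrite ?ltn_ord // (val_inj ej).
exists (D + 'X^(m.+1)); by rewrite rmorphD /= -De map_polyXn subrK.
Qed.

Lemma A_eigenvalue_rational a (v : 'rV[K]_m.+1) c : A a -> v != 0 -> v *m a = iota c *: v ->
  a = (iota c)%:M.
Proof.
move=> Aa nv e; apply/eqP; rewrite -subr_eq0; apply: contra_neqT nv => n.
have Ad : A (a - (iota c)%:M) by apply: AD => //; apply: AN; rewrite -scalemx1; apply: AZ.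
by rewrite -[v](mulmxK (A_unit Ad n)) mulmxBr e -scalemx1 -scalemxAr mulmx1 subrr mul0mx.
Qed.

Lemma common_eigenvector a b (v : 'rV[K]_m.+1) c d : A a -> A b -> v != 0 ->
  v *m a = c *: v -> v *m b = d *: v -> a *m b = b *m a.
Proof.
move=> Aa Ab nv ea eb; apply/eqP; rewrite -subr_eq0; apply/eqP.
rewrite -(scale0r 1%:M) -(rmorph0 iota) scalemx1; apply: (@A_eigenvalue_rational _ v) => //.
  by apply: AD; [apply: AM | apply: AN; apply: AM].
rewrite mulmxBr !mulmxA ea eb -!scalemxAl ea eb !scalerA mulrC subrr.
by rewrite rmorph0 scale0r.
Qed.

(** * Eigenbases, with eigenvectors as rows *)

Definition eigenbasis (P : Mp) (d : 'rV[K]_m.+1) a := P *m a = diag_mx d *m P.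

Lemma eigenbasis_row P d a i : eigenbasis P d a -> row i P *m a = d 0 i *: row i P.
Proof. by move=> e; rewrite -row_mul e row_mul row_diag_mx -scalemxAl -rowE. Qed.

(** A repeated eigenvalue would let a product of only m linear factors annihilate a. *)
Lemma eigenbasis_inj P d a : A a -> ~ scalar a -> P \in unitmx -> eigenbasis P d a ->
  injective (d 0).
Proof.
move=> Aa ns uP e i j dij; apply/eqP; apply: contraT => nij.
pose q := \prod_(l | l != j) ('X - (d 0 l)%:P).
have sq : size q = m.+1.
  by rewrite /q -big_filter size_prod_XsubC size_filter -sum1_count sum1_card cardC1 card_ord.
suff q0 : q = 0 by move: sq; rewrite q0 size_poly0.
apply: (powers_free Aa ns); rewrite ?sq //.
have -> : a = invmx P *m diag_mx d *m P by rewrite -mulmxA -e mulKmx.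
rewrite horner_mx_uconjC // horner_mx_diag.
suff -> : map_mx (horner q) d = 0 by rewrite linear0 mulmx0 mul0mx.
apply/rowP => l; rewrite !mxE /q horner_prod; apply/eqP/prodf_eq0.
have [->|nl] := eqVneq l j; first by exists i => //; rewrite !hornerE dij subrr.
by exists l => //; rewrite !hornerE subrr.
Qed.

Hypothesis p_neq0 : m.+1%:R != 0 :> K.

(** The characteristic polynomial q is separable: q' is nonzero, having p as coefficient at degree
    m, and a nonconstant common factor would split q into two factors of degree at most m, one of
    which kills a since A has no zero divisors. *)
Lemma eigenbasis_exists a : A a -> ~ scalar a ->
  exists P d, P \in unitmx /\ eigenbasis P d a.
Proof.
move=> Aa ns; have [q qE] := A_char_poly Aa ns.
have sq : size q = m.+2 by rewrite -(size_map_poly iota) -qE size_char_poly.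
have nq : q != 0 by rewrite -size_poly_eq0 sq.
have lq : q`_m.+1 = 1.
  apply: (fmorph_inj iota); rewrite rmorph1 -coef_map -qE.
  by have := monicP (char_poly_monic a); rewrite lead_coefE size_char_poly.
have cop : coprimep q q^`().
  rewrite coprimep_def; apply: contraT => ng; set g := gcdp _ _ in ng.
  have nd : q^`() != 0.
    apply/eqP => /(congr1 (fun u : {poly k} => u`_m)); rewrite coef_deriv lq coef0.
    by move=> /(congr1 iota) /eqP; rewrite rmorph_nat rmorph0 (negbTE p_neq0).
  have [h hE] := dvdpP _ _ (dvdp_gcdl q q^`()); rewrite -/g in hE.
  have ng0 : g != 0 by apply: contra_neq nq => g0; rewrite hE g0 mulr0.
  have nh0 : h != 0 by apply: contra_neq nq => h0; rewrite hE h0 mul0r.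
  have sg : (size g <= m.+1)%N.
    rewrite (leq_trans (dvdp_leq nd (dvdp_gcdr _ _))) // -ltnS -sq; exact: lt_size_deriv.
  have sh : (size h <= m.+1)%N.
    have := sq; rewrite hE size_mul //.
    have : (1 < size g)%N by rewrite ltn_neqAle eq_sym ng lt0n size_poly_eq0.
    case: (size g) => [|[|s]] // _; rewrite !addnS /= => -[<-]; exact: leq_addr.
  have := Cayley_Hamilton a; rewrite qE hE !rmorphM /= => z0.
  case: (A_mul_eq0 (A_horner h Aa) (A_horner g Aa) z0) => /(powers_free Aa ns);
    rewrite size_map_poly => /(_ _) /eqP; rewrite map_poly_eq0.
    by rewrite (negbTE nh0) => /(_ sh).
  by rewrite (negbTE ng0) => /(_ sg).
have [rs rsE] := closed_field_poly_normal (char_poly a).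
rewrite (monicP (char_poly_monic a)) scale1r in rsE.
have urs : uniq rs.
  by rewrite -separable_prod_XsubC -rsE unlock qE deriv_map coprimep_map.
have /diagonalizableP [P uP /diagonalizable_forPex [d /(simmxP uP) e]] :
    exists2 rs, uniq rs & mxminpoly a %| \prod_(x <- rs) ('X - x%:P).
  by exists rs => //; rewrite -rsE mxminpoly_dvd_char.
by exists P, d.
Qed.

Lemma commute_eigenbasis P d a b : P \in unitmx -> eigenbasis P d a -> injective (d 0) ->
  a *m b = b *m a -> exists d', eigenbasis P d' b.
Proof.
move=> uP e di ab; pose c := P *m b *m invmx P.
have cd : c *m diag_mx d = diag_mx d *m c.
  have -> : diag_mx d = P *m a *m invmx P by rewrite e mulmxK.
  by rewrite /c !mulmxA !mulmxKV // -(mulmxA P b a) -(mulmxA P a b) ab.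
exists (\row_i c i i); rewrite /eigenbasis.
have -> : P *m b = c *m P by rewrite /c mulmxKV.
congr (_ *m P); apply/matrixP => i j; rewrite !mxE.
have [->|nij] := eqVneq i j; first by rewrite mulr1n.
have := congr1 (fun M : Mp => M i j) cd; rewrite mul_mx_diag mul_diag_mx !mxE.
rewrite mulrC => /eqP; rewrite -subr_eq0 -mulrBl mulf_eq0 subr_eq0 => /orP [/eqP /di h|/eqP h].
  by rewrite h eqxx in nij.
by rewrite h mulr0n.
Qed.

Lemma eigenbasis_commute P d d' a b : P \in unitmx -> eigenbasis P d a -> eigenbasis P d' b ->
  a *m b = b *m a.
Proof.
move=> uP ea eb; apply: (can_inj (mulKmx uP)).
by rewrite !mulmxA ea eb -!mulmxA ea eb !mulmxA diag_mxC.
Qed.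

Lemma A_det a : A a -> exists c, \det a = iota c.
Proof.
move=> Aa; case: (classic (scalar a)) => [[c e]|ns].
  have [||c' c'E] := @A_scalar c 1%:M A1; [exact: oner_neq0 | by rewrite scalemx1 -e|].
  by exists (c' ^+ m.+1); rewrite e det_scalar c'E rmorphXn.
have [q qE] := A_char_poly Aa ns; exists ((-1) ^+ m.+1 * q`_0).
rewrite rmorphM rmorphXn rmorphN1 -coef_map -qE char_poly_det mulrA -exprD addnn.
by rewrite -signr_odd odd_double mul1r.
Qed.

(** The characteristic polynomial must be X^p - c, whose constant term gives c = det a for odd p. If
    c = d^p, the factors X - d and s are defined over k, and one of them would kill a. *)
Lemma A_pow_det a c d : odd m.+1 -> A a -> ~ scalar a -> a ^+ m.+1 = c%:M ->
  \det a <> iota d ^+ m.+1.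
Proof.
move=> po Aa ns ac da.
have chiE : char_poly a = 'X^(m.+1) - c%:P.
  apply/eqP; rewrite -subr_eq0; apply/eqP; apply: (powers_free Aa ns); last first.
    by rewrite !rmorphB /= Cayley_Hamilton rmorphXn /= horner_mx_X horner_mx_C ac !subrr.
  apply/leq_sizeP => j; rewrite leq_eqVlt !coefB coefXn coefC => /orP [/eqP <-|lt].
    have := monicP (char_poly_monic a); rewrite lead_coefE size_char_poly => /= ->.
    by rewrite eqxx /= subr0 subrr.
  rewrite nth_default ?size_char_poly // (gtn_eqF lt) gtn_eqF ?subrr //.
  exact: leq_trans lt.
have cE : c = iota d ^+ m.+1.
  have := char_poly_det a; rewrite chiE coefB coefXn coefC /= sub0r da.
  by rewrite -signr_odd po /= expr1 mulN1r => /oppr_inj.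
pose s := \sum_(i < m.+1) 'X^(m - i) * (iota d)%:P ^+ i : {poly K}.
have fac : 'X^(m.+1) - c%:P = ('X - (iota d)%:P) * s.
  by rewrite cE rmorphXn /= subrXX.
have sA : A (horner_mx a s).
  pose s' := \sum_(i < m.+1) 'X^(m - i) * d%:P ^+ i : {poly k}.
  have -> : s = map_poly iota s'.
    rewrite rmorph_sum; apply: eq_bigr => i _.
    by rewrite rmorphM rmorphXn /= map_polyX rmorphXn /= map_polyC.
  exact: A_horner.
have xA : A (a - (iota d)%:M) by apply: AD => //; apply: AN; rewrite -scalemx1; apply: AZ.
have ns0 : s != 0.
  apply/eqP => s0; have := size_char_poly a; by rewrite chiE fac s0 mulr0 size_poly0.
have ss : size s = m.+1.
  have := size_char_poly a; rewrite chiE fac size_mul ?polyXsubC_eq0 // size_XsubC.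
  by rewrite add2n => -[].
have [|e|e] := A_mul_eq0 xA sA.
- have := Cayley_Hamilton a; rewrite chiE fac rmorphM rmorphB /= horner_mx_X horner_mx_C.
  by [].
- by apply: ns; exists (iota d); apply/eqP; rewrite -subr_eq0 e.
by move/eqP: ns0; apply; apply: (powers_free Aa ns) e; rewrite ss.
Qed.

Lemma row_unitmx_neq0 (P : Mp) i : P \in unitmx -> row i P != 0.
Proof.
move=> uP; apply/eqP => r0.
have := mulmxK uP (delta_mx 0 i : 'rV_m.+1); rewrite -rowE r0 mul0mx.
by move/rowP/(_ i)/eqP; rewrite !mxE !eqxx /= eq_sym oner_eq0.
Qed.

Lemma eigenbasis_eigenvalue P d a (v : 'rV[K]_m.+1) c : P \in unitmx -> eigenbasis P d a ->
  v != 0 -> v *m a = c *: v -> exists2 j, (v *m invmx P) 0 j != 0 &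
  forall l, (v *m invmx P) 0 l != 0 -> d 0 l = c.
Proof.
move=> uP e nv ev; set w := v *m invmx P.
have nw : w != 0 by apply: contra_neq nv => w0; rewrite -[LHS](mulmxKV uP) -/w w0 mul0mx.
have ew : w *m diag_mx d = c *: w.
  have -> : diag_mx d = P *m a *m invmx P by rewrite e mulmxK.
  by rewrite /w !mulmxA mulmxKV // ev scalemxAl.
have [j nj] : exists j, w 0 j != 0.
  apply: NNPP => no; move/eqP: nw; apply; apply/rowP => j; rewrite [RHS]mxE.
  by apply/eqP/negPn/negP => h; apply: no; exists j.
exists j => // l nl; apply: (mulfI nl).
have := congr1 (fun M : 'rV_m.+1 => M 0 l) ew; rewrite mul_mx_diag [LHS]mxE [RHS]mxE => ->.
by rewrite mulrC.
Qed.

(** The image of an eigenvector under b is again one of a, since b a = b' b and b' is diagonal in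
    the same basis; distinct eigenvalues make it proportional to a row. *)
Lemma eigenline_permuted P d d' a b b' i : P \in unitmx -> eigenbasis P d a -> injective (d 0) ->
  b \in unitmx -> b *m a = b' *m b -> eigenbasis P d' b' ->
  exists j, exists2 c, c != 0 & row i P *m b = c *: row j P.
Proof.
move=> uP e di ub bab' e'; set v := row i P *m b.
have nv : v != 0.
  by apply: contra_neq (row_unitmx_neq0 i uP) => v0; rewrite -[LHS](mulmxK ub) -/v v0 mul0mx.
have ev : v *m a = d' 0 i *: v.
  by rewrite /v -[_ *m b *m a]mulmxA bab' mulmxA (eigenbasis_row _ e') -scalemxAl.
have [j nj h] := eigenbasis_eigenvalue uP e nv ev; set w := v *m invmx P in nj h.
exists j, (w 0 j) => //; rewrite -[LHS](mulmxKV uP) -/w rowE scalemxAl; congr (_ *m P).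
apply/rowP => l; rewrite [RHS]mxE [X in _ * X]mxE /=.
have [->|nl] := eqVneq l j; first by rewrite mulr1.
rewrite mulr0; apply/eqP; apply: contraT => nwl; case/eqP: nl; apply: di.
by rewrite h // h.
Qed.

(* An element of order prime to p permuting the p eigenlines of [a] fixes one of them. *)
Lemma normalizing_commute a b b' n : A a -> A b -> b \in unitmx -> ~ scalar a ->
  b *m a = b' *m b -> a *m b' = b' *m a ->
  coprime n m.+1 -> a *m b ^+ n = b ^+ n *m a -> a *m b = b *m a.
Proof.
move=> Aa Ab ub ns bab' ab' con abn.
have [P [d [uP e]]] := eigenbasis_exists Aa ns; have di := eigenbasis_inj Aa ns uP e.
have [d' e'] := commute_eigenbasis uP e di ab'.
have hs i := eigenline_permuted i uP e di ub bab' e'.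
have nr i := row_unitmx_neq0 i uP.
have [s0 s0P] := functional_choice (fun i j => exists2 c, c != 0 & row i P *m b = c *: row j P) hs.
have row_prop i j c c' : c != 0 -> c *: row i P = c' *: row j P -> i = j.
  move=> nc; rewrite !rowE !scalemxAl => /(can_inj (mulmxK uP)) /rowP /(_ i) /eqP.
  rewrite !mxE !eqxx mulr1.
  by have [//|] := eqVneq i j; rewrite mulr0 (negbTE nc).
have s0_inj : injective s0.
  move=> i j sij; have [c nc hc] := s0P i; have [c' nc' hc'] := s0P j.
  apply: (@row_prop _ _ c' c nc'); apply: (can_inj (mulmxK ub)).
  by rewrite -!scalemxAl hc hc' sij !scalerA mulrC.
pose s := perm s0_inj.
have sX t i : exists2 c, c != 0 & row i P *m b ^+ t = c *: row ((s ^+ t)%g i) P.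
  elim: t => [|t [c nc hc]].
    by exists 1; rewrite ?oner_eq0 // expr0 mulmx1 expg0 perm1 scale1r.
  have [c' nc' hc'] := s0P ((s ^+ t)%g i); exists (c * c'); first exact: mulf_neq0.
  rewrite exprSr mulmxA hc -scalemxAl hc' scalerA expgSr permM; congr (_ *: row _ _).
  by rewrite permE.
have fixed_commute t i : (s ^+ t)%g i = i -> a *m b ^+ t = b ^+ t *m a.
  move=> fi; have [c nc hc] := sX t i; rewrite fi in hc.
  exact: (common_eigenvector Aa (AX t Ab) (nr i) (eigenbasis_row i e) hc).
have commute_fixed t : a *m b ^+ t = b ^+ t *m a -> (s ^+ t)%g = 1%g.
  move=> /(commute_eigenbasis uP e di) [dt et]; apply/permP => i; rewrite perm1.
  have [c nc hc] := sX t i; rewrite (eigenbasis_row i et) in hc.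
  by apply/esym; apply: (@row_prop _ _ _ _ _ hc); apply: contra_neq nc => z0;
     move: hc; rewrite z0 scale0r => /esym/eqP; rewrite scaler_eq0 (negbTE (nr _)) orbF => /eqP.
suff s1 : s = 1%g by have := @fixed_commute 1%N ord0; rewrite expg1 expr1; apply; rewrite s1 perm1.
apply/eqP; rewrite -order_eq1; apply: contraT => no1.
have [q q_pr qo] : exists2 q, prime q & (q %| #[s]%g)%N.
  by exists (pdiv #[s]%g); rewrite ?pdiv_dvd // pdiv_prime // ltn_neqAle eq_sym no1 order_gt0.
have qn : (q %| n)%N by apply: dvdn_trans qo _; rewrite order_dvdn commute_fixed.
set t := (#[s]%g %/ q)%N.
have ot : #[(s ^+ t)]%g = q by rewrite orderXdiv ?dvdn_div // divnA // mulKn // order_gt0.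
have [i fi] : exists i, (s ^+ t)%g i = i.
  apply: NNPP => no; have qg : (q.-group <[s ^+ t]>)%g by rewrite /pgroup -orderE ot pnat_id.
  have := @pgroup_fix_mod _ _ _ 'P%act q <[(s ^+ t)%g]>%G [set: 'I_m.+1] qg.
  have -> : ('Fix_([set: 'I_m.+1] | 'P)(<[s ^+ t]>) = set0)%g.
    apply/setP => i; rewrite [RHS]inE; apply/negP => /setIP [_ /afixP fi]; apply: no.
    by exists i; exact: (fi _ (cycle_id _)).
  rewrite cards0 mod0n cardsT card_ord => h; have : (q %| m.+1)%N.
    by rewrite /dvdn h //; apply/subsetP => x _; rewrite !inE; apply/subsetP => y; rewrite !inE.
  rewrite dvdn_prime2 // => /eqP qp; move: con; rewrite -qp => /eqP cc.
  have : (q %| gcdn n q)%N by rewrite dvdn_gcd qn dvdnn.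
  by rewrite cc dvdn1 => /eqP q1; rewrite q1 in q_pr.
by move: ot; rewrite (commute_fixed _ (fixed_commute _ _ fi)) order1 => q1; rewrite -q1 in q_pr.
Qed.
End Form.

(** * Finite groups of projective units *)

Lemma expr_coprime_eq1 (F : fieldType) (x : F) a b : (0 < a)%N -> x ^+ a = 1 -> x ^+ b = 1 ->
  coprime a b -> x = 1.
Proof.
move=> a0 xa xb /eqP ab; have [d px _] := prim_order_exists a0 xa.
have : (d %| gcdn a b)%N by rewrite dvdn_gcd !(prim_order_dvd px) xa xb !eqxx.
rewrite ab dvdn1 => /eqP d1; rewrite d1 in px.
by rewrite -[x]expr1; exact: prim_expr_order px.
Qed.

Section Lifts.
Variables (k : fieldType) (K : closedFieldType) (iota : {rmorphism k -> K}) (m : nat).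
Local Notation Mp := 'M[K]_m.+1.
Variable A : Mp -> Prop.
Hypothesis AD : forall v w, A v -> A w -> A (v + w).
Hypothesis AZ : forall c v, A v -> A (iota c *: v).
Hypothesis A1 : A 1%:M.
Hypothesis AM : forall v w, A v -> A w -> A (v *m w).
Hypothesis Adisj : forall e, kfree iota e -> forall v : nat -> Mp, (forall i, A (v i)) ->
  \sum_(i < size e) e`_i *: v i = 0 -> forall i, (i < size e)%N -> v i = 0.
Hypothesis Agen : forall v : Mp, exists N (c : 'I_N -> K) (a : 'I_N -> Mp),
  (forall i, A (a i)) /\ v = \sum_i c i *: a i.
Hypothesis p_prime : prime m.+1.
Hypothesis no_rank1 : forall (u : 'cV[K]_m.+1) (rho : Mp), rho \in unitmx -> u != 0 ->
  ~ forall j, A (u *m row j rho).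
Hypothesis p_neq0 : m.+1%:R != 0 :> K.
Hypothesis p_odd : odd m.+1.

Local Notation A_scalar := (A_scalar AD AZ A1 Adisj).
Local Notation A_unit := (A_unit AD AZ A1 AM Adisj Agen p_prime no_rank1).
Local Notation A_char_poly := (A_char_poly AD AZ A1 AM Adisj Agen p_prime no_rank1).
Local Notation A_eigenvalue_rational := (A_eigenvalue_rational AD AZ A1 AM Adisj Agen p_prime no_rank1).
Local Notation common_eigenvector := (common_eigenvector AD AZ A1 AM Adisj Agen p_prime no_rank1).
Local Notation eigenbasis_inj := (eigenbasis_inj AD AZ A1 AM Adisj Agen p_prime no_rank1).
Local Notation eigenbasis_exists := (eigenbasis_exists AD AZ A1 AM Adisj Agen p_prime no_rank1 p_neq0).
Local Notation A_det := (A_det AD AZ A1 AM Adisj Agen p_prime no_rank1).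
Local Notation A_pow_det := (A_pow_det AD AZ A1 AM Adisj Agen p_prime no_rank1).
Local Notation normalizing_commute := (normalizing_commute AD AZ A1 AM Adisj Agen p_prime no_rank1 p_neq0).

Variables (gT : finGroupType) (r : gT -> Mp).
Hypothesis rA : forall g, A (r g).
Hypothesis ru : forall g, r g \in unitmx.
Hypothesis r_mul : forall g h, exists c, r g *m r h = c *: r (g * h)%g.
Hypothesis r_faithful : forall g, scalar (r g) -> g = 1%g.

Lemma r_neq0 g : r g != 0.
Proof. by apply: contraTneq (ru g) => ->; rewrite unitmxE det0 unitr0. Qed.

Lemma rM g h : exists2 c, c != 0 & r g *m r h = iota c *: r (g * h)%g.
Proof.
have [c e] := r_mul g h; have [|d cd] := @A_scalar c (r (g * h)%g) (rA _) (r_neq0 _).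
  by rewrite -e; apply: AM.
exists d; last by rewrite -cd.
apply/eqP => d0; move: e; rewrite cd d0 rmorph0 scale0r => e0.
by have := r_neq0 h; rewrite -[r h](mulKmx (ru g)) e0 mulmx0 eqxx.
Qed.

Lemma r_one : exists2 c, c != 0 & r 1%g = (iota c)%:M.
Proof.
have [c nc e] := rM 1 1; exists c => //; rewrite mulg1 in e.
by rewrite -[r _](mulKmx (ru 1)) e -scalemxAr mulVmx // scalemx1.
Qed.

Lemma rX g n : exists2 c, c != 0 & r g ^+ n = iota c *: r (g ^+ n)%g.
Proof.
elim: n => [|n [c nc e]].
  have [c nc e] := r_one; exists c^-1; rewrite ?invr_eq0 // expr0 expg0 e scale_scalar_mx.
  by rewrite -rmorphM mulVf // rmorph1.
have [c' nc' e'] := rM g (g ^+ n)%g; exists (c * c'); first exact: mulf_neq0.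
by rewrite exprS e -[_ * _]/(_ *m _) -scalemxAr e' scalerA rmorphM expgS.
Qed.

Lemma scalarZ c (v : Mp) : c != 0 -> scalar (c *: v) -> scalar v.
Proof.
move=> nc [d e]; exists (c^-1 * d); by rewrite -scale_scalar_mx -e scalerA mulVf ?scale1r.
Qed.

Lemma scalar_rX g n : scalar (r g ^+ n) -> (g ^+ n)%g = 1%g.
Proof.
have [c nc ->] := rX g n; move=> /scalarZ; rewrite fmorph_eq0 => /(_ nc); exact: r_faithful.
Qed.

Lemma rX_order g : exists2 c, c != 0 & r g ^+ #[g]%g = (iota c)%:M.
Proof.
have [c nc ->] := rX g #[g]%g; have [d nd e] := r_one; rewrite expg_order e.
by exists (c * d); rewrite ?mulf_neq0 // scale_scalar_mx rmorphM.
Qed.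

Lemma r_proportional g h c : r g = c *: r h -> g = h.
Proof.
move=> e; have [d nd e1] := rM g h^-1%g; have [d' nd' e2] := rM h h^-1%g.
apply/eqP; rewrite eq_mulgV1; apply/eqP; apply: r_faithful.
apply: (@scalarZ (iota d)); first by rewrite fmorph_eq0.
have [d'' _ e3] := r_one; exists (c * (iota d' * iota d'')).
by rewrite -e1 e -scalemxAl e2 mulgV e3 !scale_scalar_mx.
Qed.

(** Stronger than commuting in the group: it is this relation that is transitive away from 1 and
    controls eigenlines. *)
Definition lift_commute g h := r g *m r h = r h *m r g.
Local Notation lc := lift_commute.

Lemma lc_commute g h : lc g h -> commute g h.
Proof.
have [c nc e] := rM g h; have [d nd e'] := rM h g; rewrite /lc e e' => h1.
apply: (@r_proportional _ _ ((iota c)^-1 * iota d)).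
by rewrite -scalerA -h1 scalerA mulVf ?scale1r // fmorph_eq0.
Qed.

(** The lifts commute up to a scalar, and determinants show that its p-th power is 1. *)
Lemma commute_factor g h : commute g h ->
  exists w, w ^+ m.+1 = 1 /\ r g *m r h = w *: (r h *m r g).
Proof.
move=> gh; have [c nc e] := rM g h; have [d nd e'] := rM h g.
have eq : r g *m r h = (iota c / iota d) *: (r h *m r g).
  by rewrite e e' gh scalerA divfK // fmorph_eq0.
exists (iota c / iota d); split=> //.
have nD x : \det (r x) != 0 by rewrite -unitfE -unitmxE.
apply: (mulIf (mulf_neq0 (nD h) (nD g))).
by have := congr1 (fun v : Mp => \det v) eq; rewrite detZ !det_mulmx mul1r => <-; rewrite mulrC.
Qed.

Lemma commute_lc g h : commute g h -> coprime #[g]%g m.+1 -> lc g h.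
Proof.
move=> gh co; have [w [wp e]] := commute_factor gh.
have eX n : r g ^+ n *m r h = w ^+ n *: (r h *m r g ^+ n).
  elim: n => [|n IH]; first by rewrite !expr0 mulmx1 mul1mx scale1r.
  by rewrite exprSr -[_ * r g]/(_ *m r g) -mulmxA e -scalemxAr !mulmxA IH -scalemxAl scalerA -exprS.
have wo : w ^+ #[g]%g = 1.
  have [c nc ec] := rX_order g; have := eX #[g]%g; rewrite ec mul_scalar_mx mul_mx_scalar => /eqP.
  rewrite scalerA -subr_eq0 -scalerBl scaler_eq0 (negbTE (r_neq0 _)) orbF -{1}[iota c]mul1r -mulrBl.
  by rewrite mulf_eq0 fmorph_eq0 (negbTE nc) orbF subr_eq0 => /eqP.
by rewrite /lc e (expr_coprime_eq1 (order_gt0 g) wo wp co) scale1r.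
Qed.

Lemma not_scalar g : g != 1%g -> ~ scalar (r g).
Proof. by move=> ng /r_faithful /eqP; rewrite (negbTE ng). Qed.

Lemma lc_trans x g h : x != 1%g -> lc x g -> lc x h -> lc g h.
Proof.
move=> nx xg xh; have ns := not_scalar nx.
have [P [d [uP e]]] := eigenbasis_exists (rA x) ns; have di := eigenbasis_inj (rA x) ns uP e.
have [dg eg] := commute_eigenbasis uP e di xg.
have [dh eh] := commute_eigenbasis uP e di xh.
exact: eigenbasis_commute uP eg eh.
Qed.

(* The ratio of the eigenvalues on two common eigenlines embeds S into the
   multiplicative group of K. *)
Lemma cyclic_lc (S : {group gT}) : {in S &, forall g h, lc g h} -> cyclic S.
Proof.
move=> cS; have [->|nS] := eqVneq (S : {set gT}) 1%g; first exact: cyclic1.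
have [x Sx nx] := trivgPn _ nS; have ns := not_scalar nx.
have [P [d [uP e]]] := eigenbasis_exists (rA x) ns; have di := eigenbasis_inj (rA x) ns uP e.
have hd g : exists d', g \in S -> eigenbasis P d' (r g).
  have [Sg|nSg] := boolP (g \in S); last by exists 0.
  by have [d' e'] := commute_eigenbasis uP e di (cS _ _ Sx Sg); exists d'.
have [dd ddP] := functional_choice (fun g d' => g \in S -> eigenbasis P d' (r g)) hd.
have nd g i : g \in S -> dd g 0 i != 0.
  move=> Sg; apply: contra_neq (row_unitmx_neq0 i uP) => d0.
  by rewrite -[LHS](mulmxK (ru g)) (eigenbasis_row _ (ddP g Sg)) d0 scale0r mul0mx.
have ddM g h i c : g \in S -> h \in S -> r g *m r h = c *: r (g * h)%g ->
    dd g 0 i * dd h 0 i = c * dd (g * h)%g 0 i.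
  move=> Sg Sh ec; have := congr1 (mulmx (row i P)) ec.
  rewrite mulmxA (eigenbasis_row _ (ddP g Sg)) -scalemxAl (eigenbasis_row _ (ddP h Sh)).
  rewrite -scalemxAr (eigenbasis_row _ (ddP _ (groupM Sg Sh))) !scalerA => /eqP.
  by rewrite -subr_eq0 -scalerBl scaler_eq0 (negbTE (row_unitmx_neq0 i uP)) orbF subr_eq0 => /eqP.
have i01 : (ord0 : 'I_m.+1) != ord_max.
  by rewrite -val_eqE /= eq_sym -lt0n; have := prime_gt1 p_prime.
pose f g := dd g 0 ord0 / dd g 0 ord_max.
apply: (@field_mul_group_cyclic _ S _ f) => [g h Sg Sh|g Sg].
  have [c nc ec] := rM g h; rewrite /f.
  have E i : dd (g * h)%g 0 i = (iota c)^-1 * (dd g 0 i * dd h 0 i).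
    by rewrite (ddM g h i _ Sg Sh ec) mulKf // fmorph_eq0.
  by rewrite !E; field; rewrite !nd // fmorph_eq0 nc.
split=> [f1|->].
  apply: r_faithful; apply: NNPP => nsg; move/eqP: i01; apply.
  apply: (eigenbasis_inj (rA g) nsg uP (ddP g Sg)).
  by rewrite -[LHS](divfK (nd g ord_max Sg)) -/(f g) f1 mul1r.
have [c nc e1] := r_one; have E i : dd 1%g 0 i = iota c.
  have := eigenbasis_row i (ddP 1%g (group1 S)); rewrite e1 mul_mx_scalar => /eqP.
  by rewrite -subr_eq0 -scalerBl scaler_eq0 (negbTE (row_unitmx_neq0 i uP)) orbF subr_eq0 => /eqP.
by rewrite /f !E divff // fmorph_eq0.
Qed.

Lemma lc_conj z g : z != 1%g -> lc z (z ^ g)%g -> coprime #[g]%g m.+1 -> commute z g.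
Proof.
move=> nz zg co; suff h : lc z g^-1%g by rewrite -[g]invgK; apply: commuteV; exact: lc_commute.
have [c nc e] := rM g^-1%g z; have [c' nc' e'] := rM (z ^ g)%g g^-1%g.
have eq : (z ^ g * g^-1 = g^-1 * z)%g by rewrite conjgE -!mulgA mulgV mulg1.
apply: (@normalizing_commute _ _ ((iota c / iota c') *: r (z ^ g)%g) #[g^-1]%g) => //.
- exact: not_scalar.
- by rewrite e -scalemxAl e' eq scalerA divfK // fmorph_eq0.
- by rewrite -scalemxAr zg scalemxAl.
- by rewrite orderV.
have [s _ ->] := rX_order g^-1%g; exact: scalar_mxC.
Qed.

Definition pow_equiv (u v : k) := exists2 e, e != 0 & u = e ^+ m.+1 * v.

Lemma pow_equiv_refl u : pow_equiv u u.
Proof. by exists 1; rewrite ?oner_eq0 // expr1n mul1r. Qed.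
Lemma pow_equiv_sym u v : pow_equiv u v -> pow_equiv v u.
Proof.
move=> [e ne ->]; exists e^-1; first by rewrite invr_eq0.
by rewrite mulrA -exprMn mulVf // expr1n mul1r.
Qed.
Lemma pow_equiv_trans u v w : pow_equiv u v -> pow_equiv v w -> pow_equiv u w.
Proof.
by move=> [e ne ->] [e' ne' ->]; exists (e * e'); rewrite ?mulf_neq0 // mulrA exprMn.
Qed.
Lemma pow_equivM u v u' v' : pow_equiv u v -> pow_equiv u' v' -> pow_equiv (u * u') (v * v').
Proof.
move=> [e ne ->] [e' ne' ->]; exists (e * e'); rewrite ?mulf_neq0 // exprMn; ring.
Qed.

(* The reduced norm, with values in k* modulo p-th powers. *)
Lemma norm_exists : exists N : gT -> k, [/\ forall g, \det (r g) = iota (N g),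
  forall g, N g != 0 & forall g h, pow_equiv (N (g * h)%g) (N g * N h)].
Proof.
have [N hN] := functional_choice (fun g c => \det (r g) = iota c) (fun g => A_det (rA g)).
have N0 g : N g != 0 by rewrite -(fmorph_eq0 iota) -hN -unitfE -unitmxE ru.
exists N; split=> // g h; apply: pow_equiv_sym; have [c nc e] := rM g h; exists c => //.
apply: (fmorph_inj iota); rewrite !rmorphM rmorphXn /= -!hN -det_mulmx e detZ.
by [].
Qed.

(** The norm takes values in a commutative group of exponent p, so commutators and p-th powers fall
    into its kernel. *)
Lemma norm_kernel : exists H : {group gT},
  [/\ coprime #|H| m.+1, (H <| [set: gT])%g, forall g, (g ^+ m.+1)%g \in H
    & forall g h, [~ g, h]%g \in H].
Proof.
have [N [hN N0 NM]] := norm_exists; pose Q g := pow_equiv (N g) 1.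
have N1 : Q 1%g.
  have [e ne h] := NM 1%g 1%g; rewrite mulg1 in h; apply: pow_equiv_sym; exists e => //.
  by apply: (mulIf (N0 1%g)); rewrite mul1r -mulrA -h.
have QM g h : Q g -> Q h -> Q (g * h)%g.
  move=> qg qh; apply: pow_equiv_trans (NM g h) _; rewrite -[1]mulr1; exact: pow_equivM.
have NV g : pow_equiv (N g^-1%g * N g) 1.
  by apply: pow_equiv_trans N1; rewrite -(mulVg g); apply: pow_equiv_sym.
have NJ g h : pow_equiv (N (g ^ h)%g) (N g).
  rewrite conjgE; apply: pow_equiv_trans (NM _ _) _.
  apply: pow_equiv_trans (pow_equivM (pow_equiv_refl _) (NM _ _)) _.
  rewrite mulrCA -[X in pow_equiv _ X]mulr1; exact: pow_equivM (pow_equiv_refl _) (NV h).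
have NR g h : Q [~ g, h]%g.
  rewrite /commg; apply: pow_equiv_trans (NM _ _) _; apply: pow_equiv_trans (NV g).
  exact: pow_equivM (pow_equiv_refl _) (NJ g h).
have NX g n : pow_equiv (N (g ^+ n)%g) (N g ^+ n).
  elim: n => [|n IH]; first by rewrite expg0 expr0.
  rewrite expgS exprS; apply: pow_equiv_trans (NM _ _) _.
  exact: pow_equivM (pow_equiv_refl _) IH.
have [b bQ] : exists b : gT -> bool, forall g, b g <-> Q g.
  apply: (functional_choice (fun g (b : bool) => b <-> Q g)) => g.
  by case: (classic (Q g)) => h; [exists true | exists false].
have gH : group_set [set g | b g].
  apply/group_setP; split=> [|g h]; rewrite !inE; first by apply/bQ.
  by move=> /bQ qg /bQ qh; apply/bQ; apply: QM.
exists (Group gH); split.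
- rewrite coprime_sym prime_coprime //; apply/negP => /(Cauchy p_prime) [x].
  rewrite inE => /bQ [e ne]; rewrite mulr1 => Nx ox.
  have nx : x != 1%g by rewrite -order_eq1 ox; case: m p_prime.
  have [c nc ec] := rX_order x; rewrite ox in ec.
  by apply: (A_pow_det p_odd (rA x) (not_scalar nx) ec (d := e)); rewrite hN Nx rmorphXn.
- apply/andP; split; first exact: subsetT.
  apply/subsetP => g _; rewrite inE; apply/subsetP => _ /imsetP [h + ->].
  rewrite !inE => /bQ qh; apply/bQ; exact: pow_equiv_trans (NJ _ _) qh.
- move=> g; rewrite inE; apply/bQ; apply: pow_equiv_trans (NX _ _) _.
  by exists (N g); rewrite ?mulr1.
by move=> g h; rewrite inE; apply/bQ.
Qed.

(** H is a Hall subgroup whose quotient is a p-group, so Schur-Zassenhaus gives a complement P;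
    commutators and p-th powers of P lie in both H and P, hence are trivial. *)
Lemma lifts_structure : exists H P : {group gT},
  [/\ (H ><| P = [set: gT])%g, (m.+1.-abelem P)%g, cyclic H & coprime #|H| m.+1].
Proof.
have [H [co nH HX HR]] := norm_kernel.
have pq : (m.+1.-group ([set: gT] / H))%g.
  rewrite -pnat_exponent; apply: pnat_dvd (pnat_id p_prime).
  apply/exponentP => _ /morphimP [x nx _ ->]; rewrite -morphX // /= coset_id //.
have hallH : Hall [set: gT] H.
  rewrite /Hall subsetT -card_quotient ?normal_norm //= coprime_sym.
  by apply: pnat_coprime pq _; rewrite p'natE // -prime_coprime // coprime_sym.
have /splitsP [P /complP [ti defG]] := SchurZassenhaus_split hallH nH.
have coH x : x \in H -> coprime #[x]%g m.+1.
  by move=> Hx; apply: coprime_dvdl co; apply: order_dvdG.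
have HP x : x \in P -> x \in H -> x = 1%g.
  move=> Px Hx; have : x \in (H :&: P)%g by rewrite inE Hx.
  by rewrite ti => /set1P.
exists H, P; split=> //.
- by rewrite sdprodE // (subset_trans (subsetT _)) // normal_norm.
- apply/abelemP => //; split=> [|x Px]; last by apply: HP; [apply: groupX | apply: HX].
  by apply/centsP => x Px y Py; apply/commgP/eqP; apply: HP; [apply: groupR | apply: HR].
have abH : abelian H.
  apply: abelian_of_centralizers => [x y z Hx Hy Hz nx xy xz|x g Hx Hg nx].
    by apply: lc_commute; apply: (lc_trans nx); apply: commute_lc => //; apply: coH.
  by move=> xg; apply: lc_conj => //; [apply: commute_lc => //|]; apply: coH.
by apply: cyclic_lc => x y Hx Hy; apply: commute_lc; [exact: (centsP abH) | exact: coH].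
Qed.

(** P permutes the p eigenlines of a generator x of H. Two elements sending the first line to the
    same line differ by one that fixes it, and so commutes with x. *)
Lemma centralizer_bound (H P : {group gT}) : (H ><| P = [set: gT])%g -> cyclic H ->
  coprime #|H| m.+1 -> H != 1%g :> {set gT} ->
  cyclic 'C_P(H)%g /\ (#|P| <= m.+1 * #|'C_P(H)%g|)%N.
Proof.
move=> /sdprodP [_ _ nHP ti] /cyclicP [x Hx] co nH; rewrite Hx in nHP ti co nH *.
have nx : x != 1%g by apply: contra_neq nH => ->; rewrite cycle1.
have cx g : g \in 'C_P(<[x]>)%g -> lc x g.
  move=> /setIP [_]; rewrite cent_cycle => /cent1P xg; apply: commute_lc => //.
split; first by apply: cyclic_lc => g h Cg Ch; apply: (lc_trans nx); apply: cx.
have [P0 [d [uP e]]] := eigenbasis_exists (rA x) (not_scalar nx).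
have di := eigenbasis_inj (rA x) (not_scalar nx) uP e.
have hf g : exists j, g \in P -> exists2 c, c != 0 & row ord0 P0 *m r g = c *: row j P0.
  have [Pg|nPg] := boolP (g \in P); last by exists ord0.
  have Hxg : (x ^ g^-1)%g \in <[x]>%g by rewrite memJ_norm ?cycle_id // (subsetP nHP) ?groupV.
  have xxg : lc x (x ^ g^-1)%g.
    by apply: commute_lc => //; have /cycleP [i ->] := Hxg; exact: commuteX.
  have [d' e'] := commute_eigenbasis uP e di xxg.
  have [c nc e1] := rM g x; have [c' nc' e2] := rM (x ^ g^-1)%g g.
  have gx : (x ^ g^-1 * g = g * x)%g by rewrite conjgE invgK -!mulgA mulVg mulg1.
  have ex : r g *m r x = ((iota c / iota c') *: r (x ^ g^-1)%g) *m r g.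
    by rewrite e1 -scalemxAl e2 gx scalerA divfK // fmorph_eq0.
  have es : eigenbasis P0 ((iota c / iota c') *: d') ((iota c / iota c') *: r (x ^ g^-1)%g).
    by rewrite /eigenbasis -scalemxAr e' linearZ -scalemxAl.
  by have [j hj] := eigenline_permuted ord0 uP e di (ru g) ex es; exists j.
have [f fP] := functional_choice
  (fun g j => g \in P -> exists2 c, c != 0 & row ord0 P0 *m r g = c *: row j P0) hf.
have <- : size (enum 'I_m.+1) = m.+1 by rewrite -cardE card_ord.
apply: (@index_bound _ _ (enum 'I_m.+1) f); first exact: subsetIl.
  by move=> g _; rewrite mem_enum.
move=> g h Pg Ph fgh; rewrite inE groupM ?groupV //= cent_cycle; apply/cent1P.
apply: commute_sym; apply: lc_commute.
have [c nc eg] := fP g Pg; have [c' nc' eh] := fP h Ph; rewrite fgh in eg.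
have [s ns es] := rM (g * h^-1)%g h; rewrite mulgKV in es.
apply: (common_eigenvector (rA x) (rA _) (row_unitmx_neq0 ord0 uP) (eigenbasis_row ord0 e)
  (d := iota s * (c / c'))).
apply: (can_inj (mulmxK (ru h))); rewrite -mulmxA es -scalemxAr eg -scalemxAl eh !scalerA.
by rewrite -mulrA divfK.
Qed.

(** T consists of the elements whose lifts commute with that of a fixed nontrivial x; its cosets are
    separated by the commutation factor with x, a p-th root of unity. *)
Lemma elementary_bound : (m.+1.-abelem [set: gT])%g -> exists T : {group gT},
  cyclic T /\ (#|[set: gT]| <= m.+1 * #|T|)%N.
Proof.
move=> /(abelemP p_prime) [ab _]; have [e|nT] := eqVneq [set: gT] 1%g.
  by exists 1%G; rewrite cyclic1 e cards1 muln1.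
have [x _ nx] := trivgPn _ nT.
have [b bP] : exists b : gT -> bool, forall g, b g <-> lc x g.
  apply: (functional_choice (fun g (b : bool) => b <-> lc x g)) => g.
  by case: (classic (lc x g)) => h; [exists true | exists false].
have gT0 : group_set [set g | b g].
  apply/group_setP; split=> [|g h]; rewrite !inE.
    by apply/bP; have [c _ e] := r_one; rewrite /lc e scalar_mxC.
  move=> /bP xg /bP xh; apply/bP; have [c nc e] := rM g h.
  have nc' : iota c != 0 by rewrite fmorph_eq0.
  rewrite /lc; apply: (scalerI nc'); rewrite scalemxAr scalemxAl -e.
  by rewrite mulmxA xg -mulmxA xh mulmxA.
exists (Group gT0); split.
  by apply: cyclic_lc => g h; rewrite !inE => /bP xg /bP xh; exact: lc_trans xg xh.
have [f fP] := functional_choice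
  (fun g w => w ^+ m.+1 = 1 /\ r x *m r g = w *: (r g *m r x))
  (fun g => commute_factor (centsP ab x (in_setT _) g (in_setT _))).
have [rs rsE] := closed_field_poly_normal ('X^(m.+1) - 1 : {poly K}).
have mon : 'X^(m.+1) - 1 \is (@monic K) by apply: monicXnsubC.
rewrite (monicP mon) scale1r in rsE.
have <- : size rs = m.+1.
  by apply: succn_inj; rewrite -(size_prod_XsubC rs id) -rsE size_XnsubC.
apply: (@index_bound _ _ rs f); first exact: subsetT.
  move=> g _; have [w1 _] := fP g; rewrite -root_prod_XsubC -rsE rootE !hornerE.
  by rewrite w1 subrr.
move=> g h _ _ fgh; rewrite inE; apply/bP.
have [wp eg] := fP g; have [_ eh] := fP h; rewrite -fgh in eh.
have nw : f g != 0 by apply: contra_eq_neq wp => ->; rewrite expr0n /= eq_sym oner_eq0.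
have [s ns es] := rM (g * h^-1)%g h; rewrite mulgKV in es.
rewrite /lc; apply: (can_inj (mulmxK (ru h))); rewrite -!mulmxA es -scalemxAr eg.
rewrite eh -scalemxAr mulmxA es -scalemxAl !scalerA mulrC.
by [].
Qed.

Lemma eigenbasis_rowX P d (a : Mp) i n : eigenbasis P d a ->
  row i P *m a ^+ n = d 0 i ^+ n *: row i P.
Proof.
move=> e; elim: n => [|n IH]; first by rewrite !expr0 mulmx1 scale1r.
by rewrite exprSr -[_ * a]/(_ *m a) mulmxA IH -scalemxAl (eigenbasis_row _ e) scalerA -exprSr.
Qed.

Lemma horner_mx_eigenvector (v : 'rV[K]_m.+1) b c f : v *m b = c *: v ->
  v *m horner_mx b f = f.[c] *: v.
Proof.
move=> e; elim/poly_ind: f => [|f s IH]; first by rewrite rmorph0 mulmx0 horner0 scale0r.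
rewrite rmorphD rmorphM /= horner_mx_X horner_mx_C mulmxDr mulmxA IH -scalemxAl e mul_mx_scalar.
by rewrite hornerD hornerM hornerX hornerC scalerDl scalerA.
Qed.

(* The eigenvalues of [a] are primitive roots of unity, and those exponents u for which
   l^u is an eigenvalue for a fixed eigenvalue l form a subgroup of order p. *)
Lemma primitive_unit (a : Mp) n : A a -> ~ scalar a -> (0 < n)%N -> a ^+ n = 1 ->
  (forall d, scalar (a ^+ d) -> (n %| d)%N) ->
  (1 < n)%N /\ exists u : 'Z_n, u ^+ m.+1 = 1 /\ (u - 1) \is a GRing.unit.
Proof.
move=> Aa ns n0 an sdiv.
have n1 : (1 < n)%N.
  rewrite ltn_neqAle n0 andbT; apply/eqP => n1; apply: ns; exists 1; by have := an; rewrite -n1 expr1.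
split=> //; have [P [d [uP e]]] := eigenbasis_exists Aa ns; have di := eigenbasis_inj Aa ns uP e.
have nr i := row_unitmx_neq0 i uP.
have prim j : n.-primitive_root (d 0 j).
  have dn : d 0 j ^+ n = 1.
    have := eigenbasis_rowX j n e; rewrite an mulmx1 => /eqP; rewrite -{1}[row j P]scale1r.
    by rewrite -subr_eq0 -scalerBl scaler_eq0 (negbTE (nr _)) orbF subr_eq0 => /eqP.
  have [s ps sn] := prim_order_exists n0 dn.
  suff -> : n = s by [].
  apply/eqP; rewrite eqn_dvd sn andbT; apply: sdiv; exists (iota 1).
  apply: (A_eigenvalue_rational (AX A1 AM _ Aa) (nr j)).
  by rewrite (eigenbasis_rowX _ _ e) (prim_expr_order ps) rmorph1.
set l := d 0 ord0; have pl : n.-primitive_root l := prim ord0.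
have [q qE] := A_char_poly Aa ns.
(* The characteristic polynomial chi has coefficients in k, so chi(a^w) lies in A. It is singular
   because l^w is an eigenvalue, hence zero, and then every d_j^w is a root of chi. *)
have clos i j w : d 0 i = l ^+ w -> exists t, d 0 t = d 0 j ^+ w.
  move=> iw; have AH : A (horner_mx (a ^+ w) (char_poly a)).
    by rewrite qE; apply: (A_horner AD AZ A1 AM); apply: (AX A1 AM).
  have root_d : (char_poly a).[d 0 i] = 0.
    apply/eqP; rewrite -[_ == 0]/(root _ _) -eigenvalue_root_char; apply/eigenvalueP.
    by exists (row i P); rewrite ?(eigenbasis_row _ e).
  have H0 : horner_mx (a ^+ w) (char_poly a) = 0.
    have := @A_eigenvalue_rational _ (row ord0 P) 0 AH (nr _); rewrite rmorph0 raddf0; apply.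
    by rewrite (horner_mx_eigenvector _ (eigenbasis_rowX _ _ e)) -/l -iw root_d.
  have : root (char_poly a) (d 0 j ^+ w).
    have := horner_mx_eigenvector (char_poly a) (eigenbasis_rowX j w e).
    rewrite H0 mulmx0 => /esym/eqP; by rewrite scaler_eq0 (negbTE (nr _)) orbF.
  rewrite -eigenvalue_root_char => /eigenvalueP [v ev nv].
  by have [t nt h] := eigenbasis_eigenvalue uP e nv ev; exists t; apply: h.
have hg j : exists u : {unit 'Z_n}, d 0 j = l ^+ (val u : nat).
  have [i ei] := prim_rootP pl (prim_expr_order (prim j)).
  have co : coprime n i by rewrite coprime_sym -(prim_root_exp_coprime i pl) -ei.
  have ui : (i%:R : 'Z_n) \is a GRing.unit by rewrite unitZpE.
  by exists (FinRing.unit 'Z_n ui); rewrite /= val_Zp_nat // prim_expr_mod.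
have [g gP] := functional_choice (fun j (u : {unit 'Z_n}) => d 0 j = l ^+ (val u : nat)) hg.
have eq_unit (u v : {unit 'Z_n}) : l ^+ (val u : nat) = l ^+ (val v : nat) -> u = v.
  move=> /eqP; rewrite (eq_prim_root_expr pl) => /eqP h; apply: val_inj; apply: val_inj.
  have lt (x : 'Z_n) : (x < n)%N by rewrite -[X in (_ < X)%N](Zp_cast n1).
  by move: h; rewrite !modn_small.
have g_inj : injective g by move=> i j gij; apply: di; rewrite gP gij -gP.
pose R : {set {unit 'Z_n}} := [set u : {unit 'Z_n} | [exists j, d 0 j == l ^+ (val u : nat)]].
have RP (u : {unit 'Z_n}) : reflect (exists j, d 0 j = l ^+ (val u : nat)) (u \in R).
  by rewrite inE; apply: (iffP existsP) => -[j /eqP h]; exists j => //; apply/eqP.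
have ZE (x : nat) : (x %% (Zp_trunc n).+2 = x %% n)%N by rewrite (Zp_cast n1).
have gR : group_set R.
  apply/group_setP; split=> [|u v /RP [i ei] /RP [j ej]].
    by apply/RP; exists ord0; rewrite /= ZE modn_small.
  apply/RP; have [t et] := clos i j _ ei; exists t; rewrite et ej -exprM mulnC.
  by rewrite /= ZE (prim_expr_mod pl).
have oR : #|Group gR| = m.+1.
  have -> : Group gR = g @: [set: 'I_m.+1] :> {set _}.
    apply/setP => u; apply/RP/imsetP => [[j ej]|[j _ ->]]; last by exists j.
    by exists j => //; apply: eq_unit; rewrite -ej gP.
  by rewrite card_imset // cardsT card_ord.
have [u Ru nu] : exists2 u, u \in Group gR & u != 1%g.
  by apply/trivgPn; rewrite -cardG_gt1 oR; exact: prime_gt1.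
exists (val u); split.
  have : (u ^+ m.+1)%g = 1%g by apply/eqP; rewrite -order_dvdn -oR order_dvdG.
  by move=> /(congr1 val); rewrite FinRing.val_unitX.
have [j ej] := RP _ Ru; set w : nat := val (val u) in ej.
have wn : coprime n w.
  have : (val u : 'Z_n) \is a GRing.unit := valP u.
  by rewrite -[val u](natr_Zp (val u)) unitZpE.
have w0 : (0 < w)%N by case: (w) wn => //; rewrite /coprime gcdn0 => /eqP h; rewrite h in n1.
have -> : (val u : 'Z_n) - 1 = (w.-1)%:R.
  by rewrite -[val u](natr_Zp (val u)) -/w -{1}(prednK w0) -natr1 addrK.
(* If a prime t divided n and w - 1, then for s = n/t the matrix a^s would have the same eigenvalue
   on two eigenlines, so it would be scalar and n would divide s. *)
rewrite unitZpE //; apply: contraT => nco.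
have [t t_pr /andP [tn tw]] : exists2 t, prime t & (t %| n)%N && (t %| w.-1)%N.
  exists (pdiv (gcdn n w.-1)); last by rewrite -dvdn_gcd pdiv_dvd.
  by apply: pdiv_prime; rewrite ltn_neqAle eq_sym nco gcdn_gt0 n0.
set s := (n %/ t)%N; have st : (s * t = n)%N by rewrite /s divnK.
have s0 : (0 < s)%N by rewrite lt0n; apply: contraTneq n0 => s0; rewrite -st s0.
have : (n %| s)%N.
  apply: sdiv; apply: NNPP => nss.
  have es : eigenbasis P (\row_i d 0 i ^+ s) (a ^+ s).
    apply/row_matrixP => i; rewrite row_mul (eigenbasis_rowX _ _ e).
    by rewrite row_mul row_diag_mx -scalemxAl -rowE mxE.
  have := eigenbasis_inj (AX A1 AM s Aa) nss uP es (x1 := j) (x2 := ord0).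
  rewrite !mxE -/l ej -exprM => j0; have jE : j = ord0.
    apply: j0; rewrite -{1}(prednK w0) mulSn exprD mulnC.
    have /dvdnP [z ->] := tw; by rewrite mulnCA st exprM exprAC (prim_expr_order pl) expr1n mulr1.
  have : l ^+ w = l ^+ 1 by rewrite expr1 -ej jE.
  move=> /eqP; rewrite (eq_prim_root_expr pl) => w1; case/eqP: nu; apply: eq_unit.
  by apply/eqP; rewrite (eq_prim_root_expr pl) /= ZE modn_mod.
move=> /(dvdn_leq s0); rewrite -st; have := prime_gt1 t_pr; nia.
Qed.

(** To apply [primitive_unit], the lift of x is rescaled by an element of k so that its n-th power
    is exactly 1. *)
Lemma exponent_unit (x : gT) : x != 1%g -> coprime #[x]%g m.+1 ->
  (1 < #[x]%g)%N /\ exists u : 'Z_(#[x]%g), u ^+ m.+1 = 1 /\ (u - 1) \is a GRing.unit.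
Proof.
move=> nx co; have [c nc ec] := rX_order x; have [N hN] := A_det (rA x).
set n := #[x]%g in ec co *.
have Nc : N ^+ n = c ^+ m.+1.
  apply: (fmorph_inj iota); rewrite !rmorphXn -hN; have := congr1 (fun v : Mp => \det v) ec.
  rewrite det_scalar => <-; elim: (n) => [|i IH]; first by rewrite !expr0 det1.
  by rewrite !exprS -[_ * _ in RHS]/(_ *m _) det_mulmx IH.
have nN : N != 0.
  by rewrite -(fmorph_eq0 iota) -hN -unitfE -unitmxE.
have [s [t st]] : exists s t, (t * m.+1 = s * n + 1)%N.
  case: (egcdnP n (ltn0Sn m)) => t s h _; exists s, t; rewrite h.
  by move: co; rewrite /coprime gcdnC => /eqP ->.
(* From N^n = c^p and t p = s n + 1 it follows that y^n = c, so an n-th root of c exists in k. *)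
pose y := N ^+ t / c ^+ s; have ny : y != 0 by rewrite mulf_neq0 ?invr_eq0 ?expf_neq0.
have yn : y ^+ n = c.
  rewrite /y exprMn exprVn -!exprM mulnC exprM Nc -exprM mulnC st exprD expr1.
  by rewrite mulrAC divff ?mul1r // expf_neq0.
have zn : iota y^-1 != 0 by rewrite fmorph_eq0 invr_eq0.
apply: (@primitive_unit (iota y^-1 *: r x)).
- exact: AZ.
- by move=> /(scalarZ zn); exact: not_scalar.
- exact: order_gt0.
- by rewrite exprZn ec -rmorphXn exprVn yn scale_scalar_mx -rmorphM mulVf // rmorph1.
move=> i; rewrite exprZn => /(scalarZ (expf_neq0 _ zn)) /scalar_rX /eqP.
by rewrite order_dvdn.
Qed.

Theorem lifts_embedding : exists (n : nat) (hT : finGroupType),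
  [/\ (0 < n)%N, balanced_sdprod n m.+1 hT &
    exists S : {group (hT * 'Z_m.+1)%type}, [set: gT] \isog S].
Proof.
have [H [P [HP abP cycH co]]] := lifts_structure; have pP := abelem_pgroup abP.
have [_ HPE nHP tiHP] := sdprodP HP.
have small (D : {group gT}) : D \subset P -> (#|D| <= m.+1)%N -> (#|D| %| m.+1)%N.
  move=> sDP; have [i ->] := p_natP (pgroupS sDP pP) => le.
  have : (i <= 1)%N by rewrite -(leq_exp2l _ _ (prime_gt1 p_prime)) expn1.
  by case: i {le} => [|[|//]] _; rewrite ?expn0 ?expn1 ?dvd1n.
have cyc_small (D : {group gT}) : D \subset P -> cyclic D -> (#|D| %| m.+1)%N.
  move=> sDP cD; have [->|nD] := eqVneq (D : {set gT}) 1%g; first by rewrite cards1.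
  by rewrite (cyclic_abelem_prime (abelemS sDP abP) cD nD).
have split (T : {group gT}) : T \subset P -> (#|P| <= m.+1 * #|T|)%N ->
    exists Q : {group gT}, (T \x Q = P)%g /\ (#|Q| %| m.+1)%N.
  move=> sTP le; have [Q TQ] := abelem_split_dprod abP sTP; exists Q; split=> //.
  have [_ TQE _ _] := dprodP TQ; apply: small; first by rewrite -TQE mulG_subr.
  by move: le; rewrite -(dprod_card TQ) mulnC leq_pmul2r.
(* With H trivial, G is T times Q with both orders dividing p: T goes into the complement of some
   balanced group and Q into the extra factor. *)
have [H1|nH] := eqVneq (H : {set gT}) 1%g.
  have PT : P :=: [set: gT] by rewrite -HPE H1 mul1g.
  have [T [cT le]] : exists T : {group gT}, cyclic T /\ (#|P| <= m.+1 * #|T|)%N.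
    by rewrite PT; apply: elementary_bound; rewrite -PT.
  have sTP : T \subset P by rewrite PT subsetT.
  have [Q [TQ Qp]] := split T sTP le; rewrite PT in TQ.
  (* Modulo n = 2^p - 1 the multiplier 2 satisfies 2^p = 1, and 2 - 1 = 1 is a unit. *)
  have n1 : (1 < 2 ^ m.+1 - 1)%N.
    have := prime_gt1 p_prime; move: p_odd; case: (m) => [|[|i]] // _ _.
    by rewrite !expnS; have := expn_gt0 2 i; lia.
  have [n [n_gt1 nE]] : exists n, (1 < n)%N /\ (2 ^ m.+1 = n + 1)%N.
    by exists (2 ^ m.+1 - 1)%N; rewrite subnK ?expn_gt0.
  have [||hT bal] := @balanced_affine n m.+1 2%:R n_gt1 p_prime.
  - by rewrite -natrX nE natrD pchar_Zp // add0r.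
  - have -> : 2%:R - 1 = 1 :> 'Z_n by rewrite -[2%N]addn1 natrD addrK.
    exact: unitr1.
  exists n, hT; split=> //; first exact: ltnW.
  have [[N [M [_ Mp _]]] _] := bal.
  have [S TS] := isog_prime_order p_prime (cyc_small T sTP cT)
    (etrans (card_isog Mp) (card_Zp (prime_gt0 p_prime))).
  exact: (dprod_embedding p_prime TQ TS Qp).
have [cC le] := centralizer_bound HP cycH co nH; set C := 'C_P(H)%G in cC le.
have sCP : C \subset P by apply: subsetIl.
have [Q [CQ Qp]] := split C sCP le; have Cp := cyc_small C sCP cC.
have [_ CQE cCQ tiCQ] := dprodP CQ; have sQP : Q \subset P by rewrite -CQE mulG_subr.
have cCH : (C \subset 'C(H))%g by apply: subsetIr.
have cent_Q y : y \in Q -> (y \in 'C(H))%g -> y = 1%g.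
  move=> Qy cy; have : y \in (C :&: Q)%g by rewrite !inE (subsetP sQP) // cy.
  by rewrite tiCQ => /set1P.
have oH : (0 < #|H|)%N := cardG_gt0 H.
have HZ : H \isog Zp #|H| by rewrite isog_cyclic_card // cyclic_Zp card_Zp /=.
(* Now P centralizes H and G is H times C; H goes into the normal part of an affine group of the
   same order, whose multiplier comes from eigenvalues. *)
have [Q1|nQ] := eqVneq (Q : {set gT}) 1%g.
  have HC : (H \x C)%g = [set: gT].
    rewrite dprodE //; first by rewrite -HPE -CQE Q1 mulg1.
    by apply/trivgP; rewrite -tiHP setIS.
  have [x Hx] := cyclicP cycH.
  have nx : x != 1%g by apply: contra_neq nH => x1; rewrite Hx x1 cycle1.
  have [|n1 [u [up u1]]] := exponent_unit nx; first by rewrite /order -Hx.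
  have [hT bal] := balanced_affine n1 p_prime up u1.
  exists #[x]%g, hT; split=> //.
  have [[N [M [Nn _ _]]] _] := bal.
  have HN : H \isog N by apply: isog_trans HZ _; rewrite isog_sym Hx.
  exact: (dprod_embedding p_prime HC HN Cp).
have cQ : #|Q| = m.+1.
  have [/eqP|/eqP //] := orP (proj2 (primeP p_prime) _ Qp).
  by move=> q1; case/negP: nQ; rewrite trivg_card1 q1.
have nHQ : (Q \subset 'N(H))%g := subset_trans sQP nHP.
have tiHQ : (H :&: Q = 1)%g by apply/trivgP; rewrite -tiHP setIS.
have HQ : (H ><| Q)%g = (H <*> Q)%G by rewrite /= norm_joinEr // sdprodE.
have HQE : (H * Q)%g = (H <*> Q)%G by rewrite /= norm_joinEr.
have UC : ((H <*> Q)%G \x C)%g = [set: gT].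
  rewrite dprodE.
  - by rewrite -HQE -mulgA (centC cCQ) CQE.
  - by rewrite /= centY subsetI cCH centsC.
  apply/trivgP/subsetP => c /setIP [+ Cc]; rewrite -HQE => /mulsgP [h q Hh Qq cE].
  have h1 : h = 1%g.
    have : h \in (H :&: P)%g.
      by rewrite inE Hh -[h](mulgK q) -cE groupM ?groupV ?(subsetP sCP _ Cc) ?(subsetP sQP).
    by rewrite tiHP => /set1P.
  have : c \in (C :&: Q)%g by rewrite inE Cc cE h1 mul1g.
  by rewrite tiCQ.
exists #|H|, (subg_of (H <*> Q)%G); split=> //; last first.
  apply: (dprod_embedding p_prime UC _ Cp); exact: (isog_subg (H <*> Q)%G).
apply: (balanced_subg HQ HZ).
  by rewrite isog_cyclic_card ?cyclic_Zp ?card_Zp ?cQ ?eqxx // prime_cyclic // cQ.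
have abH := cyclic_abelian cycH.
(* A central element h q has q centralizing H, so q = 1. If h were nontrivial, transitivity of
   commuting lifts through it would make all of Q centralize H. *)
apply/trivgP/subsetP => z /setIP [+ /centP cz]; rewrite -HQE => /mulsgP [h q Hh Qq zE].
have q1 : q = 1%g.
  apply: (cent_Q q Qq); apply/centP => x Hx.
  have zx : commute z x by apply: cz; rewrite mem_gen // inE Hx.
  have -> : q = (h^-1 * z)%g by rewrite zE mulKg.
  apply: commute_sym; apply: commuteM; last exact: commute_sym.
  by apply: commuteV; apply: (centsP abH).
rewrite q1 mulg1 in zE; rewrite inE; apply: contraT => nz.
have [y Qy ny] := trivgPn _ nQ; case/eqP: ny; apply: (cent_Q y Qy).
have cz' : coprime #[z]%g m.+1 by apply: coprime_dvdl co; rewrite zE order_dvdG.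
apply/centP => x Hx; apply: lc_commute; apply: (lc_trans nz); apply: commute_lc => //.
  by apply: cz; rewrite mem_gen // inE Qy orbT.
by apply: cz; rewrite mem_gen // inE Hx.
Qed.
End Lifts.

(** * The automorphism group *)

Section AutomorphismGroup.
Variables (k : fieldType) (K : closedFieldType) (iota : {rmorphism k -> K}) (m : nat).
Variables (X : atlas K) (f : pt X -> ppt K m) (g : ppt K m -> pt X).
Hypothesis Xvar : is_variety iota X.
Hypothesis f_mor : @is_morphism K K idfun X (projective_space K m) f.
Hypothesis g_mor : @is_morphism K K idfun (projective_space K m) X g.
Hypotheses (fK : cancel f g) (gK : cancel g f).
Variables (KK : fieldType) (cst : {rmorphism K -> KK}) (z : 'I_m -> KK).
Local Notation pev := (mmap cst).
Hypothesis z_free : forall A, pev z A = 0 -> A = 0.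
Hypothesis z_gen : generates cst z.
Variable pd : 'I_m -> KK -> KK.
Hypothesis pd_deriv : forall j, deriv cst (pd j).
Hypothesis pdz : forall j i, pd j (z i) = (i == j)%:R.
Hypothesis m_gt1 : (1 < m)%N.
Hypothesis p_neq0 : m.+1%:R != 0 :> K.
Variable xi : forall i, 'I_(chart_dim (a := X) i) -> KK.
Arguments xi : clear implicits.
Hypothesis xiP : forall i x, chart_dom i x -> forall t, Rl cst z (f x) (xi i t) (cx i x t).
Variable i0 : 'I_(chart_num X).
Hypothesis ne0 : exists x, chart_dom i0 x.
Local Notation K0 := (krat iota cst xi i0).
Local Notation mz := (mz cst z).
Local Notation ratmx := (ratmx cst z pd K0).

Let K0k c : K0 (cst (iota c)). Proof. exact: kratC. Qed.
Let K0D a b : K0 a -> K0 b -> K0 (a + b). Proof. exact: kratD. Qed.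
Let K0M a b : K0 a -> K0 b -> K0 (a * b). Proof. exact: kratM. Qed.
Let K0V a : K0 a -> K0 a^-1. Proof. exact: kratV. Qed.
Let disj := krat_disj Xvar g_mor fK gK z_free z_gen xiP ne0.
Let xi_gen := xi_generates Xvar f_mor g_mor fK gK z_free z_gen xiP ne0.
Let xi_K0 t : K0 (xi i0 t). Proof. exact: krat_xi. Qed.
Let rat_gen := rational_generation Xvar f_mor g_mor fK gK z_free z_gen xiP ne0 pd_deriv pdz m_gt1 p_neq0.

Lemma mz_rank1 (u : 'cV[K]_m.+1) (rho : 'M[K]_m.+1) j :
  mz (u *m row j rho) = zr cst z rho j *: map_mx cst u.
Proof.
apply/matrixP => i l; rewrite ord1 !mxE mulr_suml; apply: eq_bigr => t _.
by rewrite !mxE big_ord1 !mxE rmorphM /=; ring.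
Qed.

Lemma ratmx_no_rank1 : ~ isomorphic iota X (projective_space K m) ->
  forall (u : 'cV[K]_m.+1) (rho : 'M[K]_m.+1), rho \in unitmx -> u != 0 ->
  ~ forall j, ratmx (u *m row j rho).
Proof.
move=> nontriv u rho urho nu h; apply: nontriv.
have p_neq : exists pd : 'I_m -> KK -> KK,
  (forall j, deriv cst (pd j)) /\ forall j i, pd j (z i) = (i == j)%:R by exists pd.
have [L LE] := collineation_exists urho.
have urho' : invmx rho \in unitmx by rewrite unitmx_inv.
have [L' L'E] := collineation_exists urho'.
apply: (trivialization Xvar f_mor g_mor fK gK z_free z_gen xiP ne0 urho p_neq _ LE L'E) => j.
have nz0 := zr_neq0 urho p_neq ord0.
apply: (J0_ratio pd_deriv pdz p_neq0 K0k K0D K0M K0V disj xi_gen xi_K0 (h ord0) (h j)).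
  by rewrite mz_rank1 scaler_eq0 (negbTE nz0) /= map_mx_eq0.
by rewrite !mz_rank1 scalerA divfK.
Qed.

Variables (gT : finGroupType) (phi : gT -> pt X -> pt X).
Hypothesis phi_aut : is_finite_aut_group iota phi.
Local Notation pulls := (pulls f g cst z).

Lemma finite_aut_cancel a b : (b * a = 1)%g -> cancel (phi a) (phi b).
Proof. by have [_ phi1 phiM _] := phi_aut; move=> ba x; rewrite -phiM ba phi1. Qed.

Lemma lifts_exist : exists (s : gT -> {rmorphism KK -> KK}) (r : gT -> 'M[K]_m.+1),
  [/\ forall a, r a \in unitmx, forall a, ratmx (r a),
      forall a y, pulls (phi a) y (s a y) & forall a, represents cst z (s a) (r a)].
Proof.
have [phi_mor phi1 phiM phi_inj] := phi_aut.
have [s sP] : exists s : gT -> {rmorphism KK -> KK}, forall a y, pulls (phi a) y (s a y).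
  apply: (functional_choice (fun a (s : {rmorphism KK -> KK}) => forall y, pulls (phi a) y (s y))).
  move=> a; apply: (pullback_exists Xvar f_mor g_mor fK gK z_free z_gen xiP (phi_mor a)).
  exact: (@finite_aut_cancel a^-1%g a (mulgV a)).
have sK a b : (a * b = 1)%g -> (b * a = 1)%g -> cancel (s a) (s b).
  move=> ab ba y.
  apply/esym; apply: (pulls_comp Xvar f_mor g_mor fK gK z_free z_gen xiP (phi_mor b) _ (sP a y) (sP b _)).
    by exists (phi a); split; apply: finite_aut_cancel.
  have := pulls_id gK z_free z_gen y; apply: gnr_mono => l [c [h1 h2]]; exists c; split=> //.
  by rewrite /pmap /= (finite_aut_cancel ab).
have s_cst a c : s a (cst c) = cst c.
  exact: (pulls_uniq z_free z_gen (sP a _) (pulls_cst _ _ z_free _ _)).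
have sK0 a y : K0 y -> K0 (s a y).
  move=> Ky; apply: (pulls_krat Xvar f_mor g_mor fK gK z_free z_gen xiP (phi_mor a) _ ne0 Ky (sP a y)).
  exact: (@finite_aut_cancel a^-1%g a (mulgV a)).
have hr a : exists v, [/\ v \in unitmx, ratmx v & represents cst z (s a) v].
  apply: (represented_rational z_gen z_free pd_deriv pdz m_gt1 p_neq0 (sK a a^-1%g (mulgV a) (mulVg a))
    (sK a^-1%g a (mulVg a) (mulgV a)) (s_cst a) (s_cst _) _ K0k K0D K0M disj xi_gen xi_K0 _ rat_gen (sK0 _) (sK0 _)).
    move=> d _; apply: (pulls_regder Xvar f_mor g_mor fK gK z_free z_gen xiP (phi_mor a)
      (phi_mor a^-1%g) _ _ (sP a) (sP a^-1%g)).
      exact: finite_aut_cancel (mulVg a).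
    exact: finite_aut_cancel (mulgV a).
  exact: (ratmxM pd_deriv pdz m_gt1 p_neq0 K0k K0D K0M disj xi_gen xi_K0 rat_gen).
have [r rP] := functional_choice (fun a v => [/\ v \in unitmx, ratmx v & represents cst z (s a) v]) hr.
by exists s, r; split=> // a; have [] := rP a.
Qed.

Theorem finite_aut_embedding : prime m.+1 -> odd m.+1 ->
  ~ isomorphic iota X (projective_space K m) ->
  exists (n : nat) (hT : finGroupType),
  [/\ (0 < n)%N, balanced_sdprod n m.+1 hT &
    exists S : {group (hT * 'Z_m.+1)%type}, [set: gT] \isog S].
Proof.
move=> p_prime p_odd nontriv; have [phi_mor phi1 phiM phi_inj] := phi_aut.
have [s [r [ru rA sP rP]]] := lifts_exist.
have nr a : r a != 0 by apply: contraTneq (ru a) => ->; rewrite unitmxE det0 unitr0.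
have s_cst a c : s a (cst c) = cst c.
  exact: (pulls_uniq z_free z_gen (sP a _) (pulls_cst _ _ z_free _ _)).
apply: (@lifts_embedding k K iota m ratmx _ _ _ _ _ _ p_prime _ p_neq0 p_odd gT r) => //.
- exact: ratmxD.
- exact: ratmxZ.
- exact: ratmx1.
- exact: (ratmxM pd_deriv pdz m_gt1 p_neq0 K0k K0D K0M disj xi_gen xi_K0 rat_gen).
- exact: (ratmx_disj pd_deriv pdz p_neq0 disj xi_gen xi_K0).
- exact: ratmx_no_rank1.
- move=> a b; apply: (represents_uniq pd_deriv pdz m_gt1 (ru _) (rP (a * b)%g)).
  have e : s (a * b)%g =1 s b \o s a.
    move=> y; apply: (pulls_comp Xvar f_mor g_mor fK gK z_free z_gen xiP (phi_mor b) _ (sP a y) (sP b _)).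
      by exists (phi b^-1%g); split; apply: finite_aut_cancel; rewrite ?mulVg ?mulgV.
    have := sP (a * b)%g y; apply: gnr_mono => l [c [h1 h2]]; exists c; split=> //.
    by rewrite /pmap /= -phiM.
  by move=> j; rewrite e; apply: (represents_comp (s_cst b) (rP a) (rP b)).
move=> a [c rc]; apply: phi_inj => x; rewrite phi1.
have nc : c != 0 by apply: contra_neq (nr a) => c0; rewrite rc c0 raddf0.
apply: (pulls_faithful Xvar f_mor g_mor fK gK z_free z_gen xiP (phi_mor a)).
  by exists (phi a^-1%g); split; apply: finite_aut_cancel; rewrite ?mulVg ?mulgV.
have ra := rP a; rewrite rc in ra; move=> j; have := sP a (z j).
by rewrite (represents_id_scalar nc ra).
Qed.
End AutomorphismGroup.

(* Conclusion: generic coordinates in all charts *)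
Local Close Scope ring_scope.

Theorem theorem1p4 (p : nat) (k : fieldType) (kbar : closedFieldType)
    (iota : {rmorphism k -> kbar}) (X : atlas kbar)
    (gT : finGroupType) (phi : gT -> pt X -> pt X)
    (p_prime : prime p) (p_ge3 : 3 <= p)
    (char_k : p \notin [pchar k]%R)
    (kbar_closure : is_algebraic_closure iota)
    (X_nontrivial : nontrivial_severi_brauer iota p.-1 X)
    (G_aut : is_finite_aut_group iota phi) :
  exists (n : nat) (hT : finGroupType),
    [/\ 0 < n,
        balanced_sdprod n p hT
      & exists S : {group (hT * 'Z_p)%type}, [set: gT] \isog S].
Proof.
case: p p_prime p_ge3 char_k X_nontrivial => // m p_prime p_ge3 char_k.
move=> [[Xvar [f [g [f_mor g_mor fK gK]]]] nontriv].
have p_neq0 : (m.+1%:R != 0 :> kbar)%R.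
  rewrite -(rmorph_nat iota) fmorph_eq0; apply: contra char_k => h.
  by rewrite inE p_prime.
have p_odd : odd m.+1.
  by case: (even_prime p_prime) => // e; rewrite e in p_ge3.
have z_free := @ratvar_free kbar m; have z_gen := @ratvar_gen kbar m.
have [pd [pd_deriv pdz]] := @ratvar_deriv kbar m.
have h i := constructive_indefinite_description _ (generic_chart_exists Xvar g_mor fK z_free z_gen i).
pose xi i := proj1_sig (h i).
have xiP i x : chart_dom i x -> forall t, Rl (ratcst kbar m) (@ratvar kbar m) (f x) (xi i t) (cx i x t).
  exact: (proj2_sig (h i)).
have [l _] := gnr_ex (gnr_true (K := kbar) (m := m) (Q := fun=> True) (fun=> I)).
have [i0 di0] := variety_cover Xvar (g l).
have ne0 : exists x, chart_dom i0 x by exists (g l).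
(* The bound [p_ge3] on m + 1 is convertible to 1 < m. *)
exact: (finite_aut_embedding Xvar f_mor g_mor fK gK z_free z_gen pd_deriv pdz p_ge3 p_neq0 xiP ne0 G_aut).
Qed.
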